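(* Let $\varphi:\Sigma^n\to\mathbb{S}^{n+1}$ be an isometric immersion with constant mean curvature $H$ of a compact oriented manifold $\Sigma^n$. Assume that $|A|^2-2nH^2\geq 0$ on $\Sigma$ and that $\Sigma$ is not totally umbilical. Then the following hold. (1) If $H=\pm 1$, then $\mathrm{Ind}_T(\Sigma)\geq n+2$. (2) If $\int_{\Sigma}|\nabla l_v|^2\,d\Sigma\geq n\int_{\Sigma}l_v^2\,d\Sigma$ for all $v\in\mathbb{R}^{n+2}$ and $|H|\leq 1$, then $\mathrm{Ind}_T(\Sigma)\geq n+2$. (3) If $\int_{\Sigma}|\nabla l_v|^2\,d\Sigma\leq n\int_{\Sigma}l_v^2\,d\Sigma$ for all $v\in\mathbb{R}^{n+2}$ and $|H|\geq 1$, then $\mathrm{Ind}_T(\Sigma)\geq n+2$.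
   Context: $\mathbb{S}^{n+1}\subset\mathbb{R}^{n+2}$ is the unit Euclidean sphere. $\varphi:\Sigma^n\to\mathbb{S}^{n+1}$ is an immersed hypersurface with the induced metric, and $N$ is a globally defined unit normal vector field along $\varphi$ (tangent to $\mathbb{S}^{n+1}$). The shape operator is $AX=-\bar\nabla_X N$ for tangent fields $X$ on $\Sigma$, where $\bar\nabla$ is the Levi-Civita connection of $\mathbb{S}^{n+1}$. The mean curvature is $H=\frac1n\mathrm{tr}(A)$, and $|A|^2=\mathrm{tr}(A^2)$. $\Sigma$ is totally umbilical if $A=H\,I$ at every point of $\Sigma$, where $I$ is the identity. $d\Sigma$ is the area element, and $\nabla$ and $\Delta$ are the gradient and the Laplacian (divergence of the gradient) of $\Sigma$. For $v\in\mathbb{R}^{n+2}$, $l_v=\langle\varphi,v\rangle$ is a smooth function on $\Sigma$. The Jacobi operator is $J=\Delta+|A|^2+n$, and the associated quadratic form on $C^\infty(\Sigma)$ is $Q(f)=-\int_\Sigma fJf\,d\Sigma$. Let $C^\infty_T(\Sigma)=\{f\in C^\infty(\Sigma):\int_\Sigma f\,d\Sigma=0\}$. The weak index is $\mathrm{Ind}_T(\Sigma)=\max\{\dim V: V\subset C_T^\infty(\Sigma)\text{ a linear subspace with } Q(f)<0\text{ for all } f\in V,\ f\neq 0\}$. *)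

(* Defs.v *)
From HB Require Import structures.
From mathcomp Require Import all_boot all_order all_algebra.
From mathcomp Require Import all_classical all_reals all_analysis.
From mathcomp Require Import measurable_realfun.
Import Order.TTheory GRing.Theory Num.Theory.
Import numFieldNormedType.Exports.

Set Implicit Arguments.
Unset Strict Implicit.
Unset Printing Implicit Defensive.

Local Open Scope classical_set_scope.
Local Open Scope ring_scope.

Definition partial (R : realType) (n : nat) (W : normedModType R) (i : 'I_n)
    (f : 'rV[R]_n -> W) : 'rV[R]_n -> W :=
  fun x => 'D_(delta_mx ord0 i) f x.

(* C^oo on an open set: the iterated partial derivatives of all orders exist
   and are (Frechet) differentiable, hence continuous, at every point of U. *)
Definition smooth_on (R : realType) (n : nat) (W : normedModType R)
    (U : set 'rV[R]_n) (f : 'rV[R]_n -> W) : Prop :=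
  forall s : seq 'I_n, forall x, U x ->
    differentiable (foldr (fun i g => partial i g) f s) x.

(* Values of cmap and cinv outside cdom and ccod are irrelevant. *)
Record chart (R : realType) (M : topologicalType) (n : nat) := Chart {
  cdom : set M;
  ccod : set 'rV[R]_n;
  cmap : M -> 'rV[R]_n;
  cinv : 'rV[R]_n -> M;
  open_cdom : open cdom;
  open_ccod : open ccod;
  cmap_cod : forall p, cdom p -> ccod (cmap p);
  cinv_dom : forall x, ccod x -> cdom (cinv x);
  cmapK : forall p, cdom p -> cinv (cmap p) = p;
  cinvK : forall x, ccod x -> cmap (cinv x) = x;
  cmap_continuous : forall p, cdom p -> {for p, continuous cmap};
  cinv_continuous : forall x, ccod x -> {for x, continuous cinv}
}.

Definition overlap (R : realType) (M : topologicalType) (n : nat)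
    (c c' : chart R M n) : set 'rV[R]_n :=
  [set x | ccod c x /\ cdom c' (cinv c x)].

Definition transition (R : realType) (M : topologicalType) (n : nat)
    (c c' : chart R M n) : 'rV[R]_n -> 'rV[R]_n :=
  fun x => cmap c' (cinv c x).

(* chart_at selects one chart of the atlas around each point. *)
Record smooth_structure (R : realType) (M : topologicalType) (n : nat) :=
  SmoothStructure {
  atlas : set (chart R M n);
  chart_at : M -> chart R M n;
  atlas_chart_at : forall p, atlas (chart_at p);
  cdom_chart_at : forall p, cdom (chart_at p) p;
  atlas_compat : forall c c', atlas c -> atlas c' ->
    smooth_on (overlap c c') (transition c c')
}.

Definition oriented (R : realType) (M : topologicalType) (n : nat)
    (S : smooth_structure R M n) : Prop :=
  forall c c', atlas S c -> atlas S c' ->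
    forall x, overlap c c' x -> 0 < \det (jacobian (transition c c') x).

Definition smooth_map (R : realType) (M : topologicalType) (n : nat)
    (S : smooth_structure R M n) (W : normedModType R) (f : M -> W) : Prop :=
  forall c, atlas S c -> smooth_on (ccod c) (f \o cinv c).

(* Value at p of an object given by its expression in charts.  The objects to
   which it is applied below (functions, traces, A = H I) do not depend on the
   chart around p. *)
Definition at_point (R : realType) (M : topologicalType) (n : nat)
    (S : smooth_structure R M n) (T : Type)
    (F : chart R M n -> 'rV[R]_n -> T) (p : M) : T :=
  F (chart_at S p) (cmap (chart_at S p) p).

Definition dotv (R : realType) (m : nat) (u v : 'rV[R]_m) : R :=
  (u *m v^T) ord0 ord0.

(* Row i is the i-th coordinate derivative of F in the chart c. *)
Definition chart_diff (R : realType) (M : topologicalType) (n m : nat)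
    (F : M -> 'rV[R]_m) (c : chart R M n) (x : 'rV[R]_n) : 'M[R]_(n, m) :=
  jacobian (F \o cinv c) x.

Definition sphere_immersion (R : realType) (M : topologicalType) (n : nat)
    (S : smooth_structure R M n) (phi : M -> 'rV[R]_n.+2) : Prop :=
  [/\ smooth_map S phi,
      forall p, dotv (phi p) (phi p) = 1 &
      forall c, atlas S c -> forall x, ccod c x -> row_free (chart_diff phi c x)].

Definition unit_normal (R : realType) (M : topologicalType) (n : nat)
    (S : smooth_structure R M n) (phi N : M -> 'rV[R]_n.+2) : Prop :=
  [/\ smooth_map S N,
      forall p, dotv (N p) (N p) = 1,
      forall p, dotv (N p) (phi p) = 0 &
      forall c, atlas S c -> forall x, ccod c x ->
        chart_diff phi c x *m (N (cinv c x))^T = 0].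

(* Gram matrix of the induced metric in the coordinate frame. *)
Definition metric (R : realType) (M : topologicalType) (n : nat)
    (phi : M -> 'rV[R]_n.+2) (c : chart R M n) (x : 'rV[R]_n) : 'M[R]_n :=
  chart_diff phi c x *m (chart_diff phi c x)^T.

Definition area_density (R : realType) (M : topologicalType) (n : nat)
    (phi : M -> 'rV[R]_n.+2) (c : chart R M n) (x : 'rV[R]_n) : R :=
  Num.sqrt (\det (metric phi c x)).

(* Row i is the Levi-Civita derivative in the sphere of the field W along phi
   in the direction of the i-th coordinate field: the derivative in R^(n+2)
   projected onto the tangent space phi^bot of the sphere. *)
Definition sphere_nabla (R : realType) (M : topologicalType) (n : nat)
    (phi W : M -> 'rV[R]_n.+2) (c : chart R M n) (x : 'rV[R]_n) :
    'M[R]_(n, n.+2) :=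
  let D := chart_diff W c x in
  let q := phi (cinv c x) in
  D - (D *m q^T) *m q.

(* Row i holds the coordinates, in the coordinate frame, of A applied to the
   i-th coordinate field, i.e. shape *m chart_diff phi = - sphere_nabla N.
   The matrix acts on row vectors. *)
Definition shape (R : realType) (M : topologicalType) (n : nat)
    (phi N : M -> 'rV[R]_n.+2) (c : chart R M n) (x : 'rV[R]_n) : 'M[R]_n :=
  - sphere_nabla phi N c x *m pinvmx (chart_diff phi c x).

Definition mean_curvature (R : realType) (M : topologicalType) (n : nat)
    (S : smooth_structure R M n) (phi N : M -> 'rV[R]_n.+2) (p : M) : R :=
  n%:R^-1 * \tr (at_point S (shape phi N) p).

Definition shape_norm2 (R : realType) (M : topologicalType) (n : nat)
    (S : smooth_structure R M n) (phi N : M -> 'rV[R]_n.+2) (p : M) : R :=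
  let A := at_point S (shape phi N) p in \tr (A *m A).

Definition totally_umbilical (R : realType) (M : topologicalType) (n : nat)
    (S : smooth_structure R M n) (phi N : M -> 'rV[R]_n.+2) : Prop :=
  forall p, at_point S (shape phi N) p = (mean_curvature S phi N p)%:M.

Definition grad (R : realType) (M : topologicalType) (n : nat)
    (phi : M -> 'rV[R]_n.+2) (f : M -> R) (c : chart R M n) (x : 'rV[R]_n) :
    'rV[R]_n :=
  (\row_i partial i (f \o cinv c) x) *m invmx (metric phi c x).

Definition grad_norm2 (R : realType) (M : topologicalType) (n : nat)
    (S : smooth_structure R M n) (phi : M -> 'rV[R]_n.+2) (f : M -> R) :
    M -> R :=
  at_point S (fun c x => dotv (grad phi f c x *m metric phi c x)
                              (grad phi f c x)).

(* div X = G^(-1/2) sum_i d_i (G^(1/2) X^i), where G = det g. *)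
Definition divergence (R : realType) (M : topologicalType) (n : nat)
    (phi : M -> 'rV[R]_n.+2) (X : chart R M n -> 'rV[R]_n -> 'rV[R]_n)
    (c : chart R M n) (x : 'rV[R]_n) : R :=
  (area_density phi c x)^-1 *
  \sum_(i < n) partial i (fun y => area_density phi c y * X c y ord0 i) x.

Definition laplacian (R : realType) (M : topologicalType) (n : nat)
    (S : smooth_structure R M n) (phi : M -> 'rV[R]_n.+2) (f : M -> R) :
    M -> R :=
  at_point S (divergence phi (grad phi f)).

Definition jacobi (R : realType) (M : topologicalType) (n : nat)
    (S : smooth_structure R M n) (phi N : M -> 'rV[R]_n.+2) (f : M -> R) :
    M -> R :=
  fun p => laplacian S phi f p + shape_norm2 S phi N p * f p + n%:R * f p.

Definition height (R : realType) (M : topologicalType) (m : nat)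
    (phi : M -> 'rV[R]_m) (v : 'rV[R]_m) : M -> R :=
  fun p => dotv (phi p) v.

Notation borel M := (g_sigma_algebraType (@open M)).

(* Lebesgue integral over R^n as an iterated integral; used for nonnegative
   Borel functions only, where it is the integral for the product measure
   by Tonelli. *)
Fixpoint lebesgue_int (R : realType) (n : nat) :
    ('rV[R]_n -> \bar R) -> \bar R :=
  match n return ('rV[R]_n -> \bar R) -> \bar R with
  | 0 => fun f => f 0
  | n'.+1 => fun f => (\int[@lebesgue_measure R]_t
      lebesgue_int (fun y : 'rV[R]_n' => f (row_mx (const_mx t : 'rV_1) y)))%E
  end.

(* mu is the Riemannian measure of the induced metric: in every chart it is
   sqrt(det g) dx_1...dx_n.  This determines mu, and makes it finite when M is
   compact. *)
Definition area_measure (R : realType) (M : ptopologicalType) (n : nat)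
    (S : smooth_structure R M n) (phi : M -> 'rV[R]_n.+2)
    (mu : {measure set (borel M) -> \bar R}) : Prop :=
  forall c, atlas S c ->
  forall f : borel M -> \bar R, measurable_fun [set: borel M] f ->
    (forall p, (0 <= f p)%E) ->
  (\int[mu]_(p in cdom c) f p =
   lebesgue_int ((fun x => f (cinv c x) * (area_density phi c x)%:E)
                 \_ (ccod c)))%E.

Definition jacobi_form (R : realType) (M : ptopologicalType) (n : nat)
    (S : smooth_structure R M n) (phi N : M -> 'rV[R]_n.+2)
    (mu : {measure set (borel M) -> \bar R}) (f : M -> R) : R :=
  - \int[mu]_p (f p * jacobi S phi N f p).

Definition smooth_mean_zero (R : realType) (M : ptopologicalType) (n : nat)
    (S : smooth_structure R M n) (mu : {measure set (borel M) -> \bar R}) :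
    set (M -> R) :=
  [set f | smooth_map S f /\ \int[mu]_p f p = 0].

Definition subspace_of_dim (R : realType) (M : Type) (V : set (M -> R))
    (d : nat) : Prop :=
  exists e : 'I_d -> M -> R,
    (forall a : 'I_d -> R,
       (forall p, \sum_(i < d) a i * e i p = 0) -> forall i, a i = 0) /\
    V = [set f | exists a : 'I_d -> R, f = fun p => \sum_(i < d) a i * e i p].

(* The maximum is taken as a supremum in the extended reals, so that no
   a priori finiteness of the index is needed. *)
Definition weak_index (R : realType) (M : ptopologicalType) (n : nat)
    (S : smooth_structure R M n) (phi N : M -> 'rV[R]_n.+2)
    (mu : {measure set (borel M) -> \bar R}) : \bar R :=
  ereal_sup [set d%:R%:E | d in [set d | exists V : set (M -> R),
    [/\ subspace_of_dim V d,
        V `<=` smooth_mean_zero S mu &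
        forall f, V f -> f <> (fun=> 0) -> jacobi_form S phi N mu f < 0]]].

(* Main.v *)
From HB Require Import structures.
From mathcomp Require Import all_boot all_order all_algebra.
From mathcomp Require Import all_classical all_reals all_analysis.
From mathcomp Require Import measurable_realfun ring lra.
From mathcomp Require finmap.
Require Import Defs.
Import Order.TTheory GRing.Theory Num.Theory.
Import numFieldNormedType.Exports.

(** For v in R^(n+2) let l = <phi, v> and f = <N, v> be the heights of the
    position and of the normal.  Constant mean curvature gives
<<
      Delta l = - n l + n H f,        Delta f = n H l - |A|^2 f,
>>
    the second formula through the contracted Codazzi equation.  The test
    functions are u = l - H f, one for each v.  Integrating Delta l shows that u
    has mean zero, and a direct computation gives J u = (|A|^2 - n H^2) l.
    The integral of |A|^2 l f that appears in Q (u) is removed by the symmetry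
    of the Laplacian for the pair (l, f), and that of l f by Green's formula for
    l with itself.  What remains (jacobi_form_test) is
<<
      Q (u) = - int (|A|^2 - 2 n H^2) l^2 - n H^2 int f^2
              + (1 - H^2) (n int l^2 - int |grad l|^2).
>>
    The first term is nonpositive by the pinching assumption, and the last one
    is nonpositive in each of the three cases.  So Q (u) <= 0, with equality
    only if v = 0 (jacobi_form_neg).  Indeed, equality with H <> 0 gives f = 0,
    then n H int l^2 = 0 by the symmetry of the Laplacian, so that v is
    orthogonal to N, to phi and to the tangent spaces.  Equality with H = 0
    gives |A| l = 0; near a point with A <> 0 the function l then vanishes, v is
    a multiple of N there, and N is locally constant, against A <> 0.  Such a
    point exists because the immersion is not totally umbilical.  Hence v -> u
    is injective and its image is a space of dimension n + 2 on which Q is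
    negative.

    The two formulas for the Laplacian are matrix identities in one chart
    (dv_position, dv_normal).  They are proved by pairing both sides with the
    frame made of the coordinate fields, the position and the normal, using
    Jacobi's formula for the derivative of a determinant (partial_det) and the
    symmetry of second derivatives (schwarz).  Green's formula (green) is
    proved in one chart for functions with compact support there (green_chart):
    the integral of a partial derivative vanishes because iterated Lebesgue
    integrals are invariant under translations (Lint_partial).  It is
    globalized by a C1 partition of unity (partition_of_unity).  The strict
    inequality uses that the area measure charges every open set
    (integral_gt0). *)

Set Implicit Arguments.
Unset Strict Implicit.
Unset Printing Implicit Defensive.

Local Open Scope classical_set_scope.
Local Open Scope ring_scope.

(** * Functions of class C1 and symmetry of second derivatives *)

Section continuous_at_arith.
Context {R : realType} {T : topologicalType}.
Implicit Types (f g : T -> R) (x : T).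

Lemma contD f g x : {for x, continuous f} -> {for x, continuous g} ->
  {for x, continuous (fun y => f y + g y)}.
Proof. by move=> fc gc; exact: (cvgD fc gc). Qed.

Lemma contM f g x : {for x, continuous f} -> {for x, continuous g} ->
  {for x, continuous (fun y => f y * g y)}.
Proof. by move=> fc gc; exact: (cvgM fc gc). Qed.

Lemma contN f x : {for x, continuous f} -> {for x, continuous (fun y => - f y)}.
Proof. by move=> fc; exact: (cvgN fc). Qed.

Lemma contV f x : f x != 0 -> {for x, continuous f} ->
  {for x, continuous (fun y => (f y)^-1)}.
Proof. by move=> fx0 fc; exact: (cvgV fx0 fc). Qed.

Lemma cont_cst (a : R) x : {for x, continuous (fun _ : T => a)}.
Proof. by apply: cst_continuous. Qed.

Lemma cont_sum (I : Type) (r : seq I) (P : pred I) (F : I -> T -> R) x :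
  (forall i, {for x, continuous (F i)}) ->
  {for x, continuous (fun y => \sum_(i <- r | P i) F i y)}.
Proof.
move=> FC; elim: r => [|i r IH].
  rewrite (_ : (fun y => _) = fun=> 0); first exact: cont_cst.
  by apply/funext => y; rewrite big_nil.
rewrite (_ : (fun y => _) = fun y =>
  (if P i then F i y else 0) + \sum_(j <- r | P j) F j y); last first.
  by apply/funext => y; rewrite big_cons; case: (P i); rewrite ?add0r.
apply: contD => //; case: (P i); [exact: FC|exact: cont_cst].
Qed.

End continuous_at_arith.

Section C1.
Context {R : realType} {n : nat}.
Implicit Types (U : set 'rV[R]_n) (f g : 'rV[R]_n -> R).

Lemma near_eq_differentiable (V W : normedModType R) (f g : V -> W) x :
  (\near x, f x = g x) -> differentiable f x -> differentiable g x.
Proof.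
move=> fg /diff_locallyP [dfc dfx].
have fgx : f x = g x by exact: nbhs_singleton fg.
have gE : g \o shift x = cst (g x) + 'd f x +o_ 0 id.
  apply/eqaddoP => e e0; move/eqaddoP : dfx => /(_ e e0).
  apply: filter_app.
  have : \forall y \near 0, f (y + x) = g (y + x).
    by move: fg; rewrite (near_shift 0) /=; apply: filterS => y /=; rewrite subr0.
  apply: filterS => y /= E.
  by rewrite -[X in (`|X| <= _ -> _)]/((f (y + x)) - (f x + 'd f x y)) 
    -[X in (_ -> `|X| <= _)]/((g (y + x)) - (g x + 'd f x y)) E fgx.
have dgE := diff_unique dfc gE.
by apply/diff_locallyP; split; rewrite dgE.
Qed.

(** One continuous derivative is all that Green's formula asks of area densities,
    inverse metrics and cut-offs; position and normal themselves are smooth. *)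
Definition C1 U f := forall x, U x ->
  differentiable f x /\ forall i, {for x, continuous (partial i f)}.

Lemma C1_differentiable U f x : C1 U f -> U x -> differentiable f x.
Proof. by move=> h /h[]. Qed.

Lemma C1_continuous U f x : C1 U f -> U x -> {for x, continuous f}.
Proof. by move=> h /h[/differentiable_continuous]. Qed.

Lemma C1_partial_continuous U f x i : C1 U f -> U x ->
  {for x, continuous (partial i f)}.
Proof. by move=> h /h[]. Qed.
Arguments C1_partial_continuous {U f x} i.

Lemma near_continuous (T : topologicalType) (W : topologicalType) (f g : T -> W) x :
  (\near x, f x = g x) -> {for x, continuous f} -> {for x, continuous g}.
Proof.
move=> fg fc; have E := nbhs_singleton fg.
suff : g y @[y --> x] --> f x by rewrite E.
by apply: cvg_trans fc; exact: near_eq_cvg.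
Qed.

Lemma open_near U x (P : 'rV[R]_n -> Prop) : open U -> U x ->
  (forall y, U y -> P y) -> \forall y \near x, P y.
Proof. by move=> oU Ux h; apply: filterS h _; exact: open_nbhs_nbhs. Qed.

Lemma partial_near (W : normedModType R) (f g : 'rV[R]_n -> W) i x :
  (\near x, f x = g x) -> partial i f x = partial i g x.
Proof. exact: near_eq_derive. Qed.

Lemma partial_eq_on (W : normedModType R) U (f g : 'rV[R]_n -> W) i x :
  open U -> U x -> (forall y, U y -> f y = g y) ->
  partial i f x = partial i g x.
Proof. by move=> oU Ux h; apply/partial_near/(open_near oU). Qed.

Lemma C1_intro U f (df : 'I_n -> 'rV[R]_n -> R) : open U ->
  (forall x, U x -> differentiable f x) ->
  (forall x i, U x -> partial i f x = df i x) ->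
  (forall x i, U x -> {for x, continuous (df i)}) -> C1 U f.
Proof.
move=> oU fd fE dfc x Ux; split; first exact: fd.
move=> i; apply: near_continuous (dfc x i Ux).
by apply: (open_near oU) => // y Uy; rewrite fE.
Qed.

Lemma C1_eq U f g : open U -> (forall x, U x -> f x = g x) -> C1 U f -> C1 U g.
Proof.
move=> oU fg fC; apply: (@C1_intro _ _ (fun i => partial i f)) => //.
- move=> x Ux; apply: near_eq_differentiable (C1_differentiable fC Ux).
  exact: (open_near oU).
- move=> x i Ux; apply: (partial_eq_on i oU Ux) => y Uy; exact/esym/fg.
- move=> x i Ux; by have [_ h] := fC _ Ux; exact: (h i).
Qed.

Lemma C1_cst U (a : R) : open U -> C1 U (fun=> a).
Proof.
move=> oU; apply: (@C1_intro _ _ (fun _ _ => 0)) => //.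
- by move=> x i _; rewrite /partial derive_cst.
- move=> x i _; apply: cst_continuous.
Qed.

Lemma partialD f g i x : differentiable f x -> differentiable g x ->
  partial i (fun y => f y + g y) x = partial i f x + partial i g x.
Proof. by move=> df dg; rewrite /partial deriveD//; exact: diff_derivable. Qed.

Lemma partialM f g i x : differentiable f x -> differentiable g x ->
  partial i (fun y => f y * g y) x = f x * partial i g x + g x * partial i f x.
Proof. by move=> df dg; rewrite /partial deriveM//; exact: diff_derivable. Qed.

Lemma C1D U f g : open U -> C1 U f -> C1 U g -> C1 U (fun y => f y + g y).
Proof.
move=> oU fC gC.
apply: (@C1_intro _ _ (fun i y => partial i f y + partial i g y)) => //.
- by move=> x Ux; apply: differentiableD;
    [exact: C1_differentiable fC Ux|exact: C1_differentiable gC Ux].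
- by move=> x i Ux; rewrite partialD//;
    [exact: C1_differentiable fC Ux|exact: C1_differentiable gC Ux].
- move=> x i Ux; apply: contD.
    exact: (C1_partial_continuous i fC Ux).
  exact: (C1_partial_continuous i gC Ux).
Qed.

Lemma C1M U f g : open U -> C1 U f -> C1 U g -> C1 U (fun y => f y * g y).
Proof.
move=> oU fC gC.
apply: (@C1_intro _ _ (fun i y => f y * partial i g y + g y * partial i f y)) => //.
- by move=> x Ux; apply: differentiableM;
    [exact: C1_differentiable fC Ux|exact: C1_differentiable gC Ux].
- by move=> x i Ux; rewrite partialM//;
    [exact: C1_differentiable fC Ux|exact: C1_differentiable gC Ux].
- move=> x i Ux; apply: contD; apply: contM.
  + exact: C1_continuous fC Ux.
  + exact: (C1_partial_continuous i gC Ux).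
  + exact: C1_continuous gC Ux.
  + exact: (C1_partial_continuous i fC Ux).
Qed.

Lemma C1_sum U (I : Type) (r : seq I) (P : pred I) (F : I -> 'rV[R]_n -> R) :
  open U -> (forall i, C1 U (F i)) -> C1 U (fun y => \sum_(i <- r | P i) F i y).
Proof.
move=> oU FC; elim: r => [|i r IH].
  by apply: (C1_eq oU) (C1_cst 0 oU) => x _; rewrite big_nil.
case Pi : (P i); last first.
  by apply: (C1_eq oU _ IH) => x _; rewrite big_cons Pi.
by apply: (C1_eq oU _ (C1D oU (FC i) IH)) => x _; rewrite big_cons Pi.
Qed.

Lemma C1_prod U (I : Type) (r : seq I) (P : pred I) (F : I -> 'rV[R]_n -> R) :
  open U -> (forall i, C1 U (F i)) -> C1 U (fun y => \prod_(i <- r | P i) F i y).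
Proof.
move=> oU FC; elim: r => [|i r IH].
  by apply: (C1_eq oU) (C1_cst 1 oU) => x _; rewrite big_nil.
case Pi : (P i); last first.
  by apply: (C1_eq oU _ IH) => x _; rewrite big_cons Pi.
by apply: (C1_eq oU _ (C1M oU (FC i) IH)) => x _; rewrite big_cons Pi.
Qed.

Lemma differentiable_bigsum (I : Type) (r : seq I) (P : pred I)
    (F : I -> 'rV[R]_n -> R) x :
  (forall i, differentiable (F i) x) ->
  differentiable (fun y => \sum_(i <- r | P i) F i y) x.
Proof.
move=> Fd; elim: r => [|k r IH].
  rewrite (_ : (fun y => _) = cst 0); first exact: differentiable_cst.
  by apply/funext => y; rewrite big_nil.
case Pi : (P k); last first.
  rewrite (_ : (fun y => _) = (fun y => \sum_(i0 <- r | P i0) F i0 y)) //.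
  by apply/funext => y; rewrite big_cons Pi.
rewrite (_ : (fun y => _) = (fun y => F k y + \sum_(i0 <- r | P i0) F i0 y)).
  exact: differentiableD.
by apply/funext => y; rewrite big_cons Pi.
Qed.

Lemma partial_sum (I : Type) (r : seq I) (P : pred I) (F : I -> 'rV[R]_n -> R) i x :
  (forall i, differentiable (F i) x) ->
  partial i (fun y => \sum_(i <- r | P i) F i y) x =
  \sum_(k <- r | P k) partial i (F k) x.
Proof.
move=> Fd; elim: r => [|k r IH].
  rewrite big_nil (_ : (fun y => _) = cst 0); last by apply/funext => y; rewrite big_nil.
  by rewrite /partial derive_cst.
rewrite big_cons; case Pi : (P k); last first.
  rewrite (_ : (fun y => _) = (fun y => \sum_(i0 <- r | P i0) F i0 y)) ?IH//.
  by apply/funext => y; rewrite big_cons Pi.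
rewrite (_ : (fun y => _) = (fun y => F k y + \sum_(i0 <- r | P i0) F i0 y)).
  by rewrite partialD ?IH//; exact: differentiable_bigsum.
by apply/funext => y; rewrite big_cons Pi.
Qed.

Lemma differentiable_bigprod (I : Type) (r : seq I) (F : I -> 'rV[R]_n -> R) x :
  (forall i, differentiable (F i) x) ->
  differentiable (fun y => \prod_(i <- r) F i y) x.
Proof.
move=> Fd; elim: r => [|k r IH].
  rewrite (_ : (fun y => _) = cst 1); first exact: differentiable_cst.
  by apply/funext => y; rewrite big_nil.
rewrite (_ : (fun y => _) = (fun y => F k y * \prod_(i0 <- r) F i0 y)).
  exact: differentiableM.
by apply/funext => y; rewrite big_cons.
Qed.

Lemma partial_prod (I : eqType) (r : seq I) (F : I -> 'rV[R]_n -> R) i x :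
  uniq r -> (forall i, differentiable (F i) x) ->
  partial i (fun y => \prod_(k <- r) F k y) x =
  \sum_(k <- r) \prod_(l <- r) (if l == k then partial i (F l) x else F l x).
Proof.
move=> + Fd; elim: r => [_|a r IH /= /andP[ar ur]].
  rewrite big_nil (_ : (fun y => _) = cst 1); last by apply/funext => y; rewrite big_nil.
  by rewrite /partial derive_cst.
rewrite (_ : (fun y => _) = (fun y => F a y * \prod_(i0 <- r) F i0 y)); last first.
  by apply/funext => y; rewrite big_cons.
rewrite partialM//; last exact: differentiable_bigprod.
rewrite IH// big_cons big_cons eqxx addrC; congr (_ + _).
  rewrite mulrC; congr (_ * _); apply: eq_big_seq => l lr.
  by case: eqP => // la; rewrite -la lr in ar.
rewrite mulr_sumr; apply: eq_big_seq => k kr; rewrite big_cons.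
by case: eqP => // ak; rewrite ak kr in ar.
Qed.

Lemma partial_comp1 (q : R -> R) f i x : differentiable f x -> derivable q (f x) 1 ->
  partial i (fun y => q (f y)) x = (q^`())%classic (f x) * partial i f x.
Proof.
move=> df dq; have dq' := (derivable1_diffP _ _).1 dq.
rewrite /partial (deriveE _ (differentiable_comp df dq')) diff_comp//=.
by rewrite (deriv1E dq)/= deriveE// mulrC.
Qed.

Lemma C1_comp1 U (q : R -> R) f : open U -> C1 U f ->
  (forall x, U x -> derivable q (f x) 1 /\ {for f x, continuous (q^`())%classic}) ->
  C1 U (fun y => q (f y)).
Proof.
move=> oU fC qC.
apply: (@C1_intro _ _ (fun i y => (q^`())%classic (f y) * partial i f y)) => //.
- move=> x Ux; apply: differentiable_comp; first exact: C1_differentiable fC Ux.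
  by apply/derivable1_diffP; have [] := qC _ Ux.
- move=> x i Ux; apply: partial_comp1; first exact: C1_differentiable fC Ux.
  by have [] := qC _ Ux.
- move=> x i Ux; apply: contM.
  + apply: continuous_comp; first exact: C1_continuous fC Ux.
    by have [] := qC _ Ux.
  + exact: (C1_partial_continuous i fC Ux).
Qed.

End C1.

Arguments C1_partial_continuous {R n U f x} i.

Section C1_more.
Context {R : realType} {n : nat}.
Implicit Types (U : set 'rV[R]_n) (f g : 'rV[R]_n -> R).

Lemma C1N U f : open U -> C1 U f -> C1 U (fun y => - f y).
Proof.
move=> oU fC; apply: (C1_eq oU _ (C1M oU (C1_cst (-1) oU) fC)) => x _.
by rewrite mulN1r.
Qed.

Lemma C1B U f g : open U -> C1 U f -> C1 U g -> C1 U (fun y => f y - g y).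
Proof. by move=> oU fC gC; exact: (C1D oU fC (C1N oU gC)). Qed.

Lemma is_derive1_inv (x : R) : x != 0 -> is_derive x 1 (@GRing.inv R) (- x ^- 2).
Proof.
move=> x0; apply: DeriveDef.
  by apply: (@derivableV R R id) => //; exact: derivable_id.
rewrite (_ : GRing.inv = (fun y => (id y)^-1)) // deriveV//.
by rewrite derive_id; exact: mulr1.
Qed.

Lemma C1V U f : open U -> C1 U f -> (forall x, U x -> f x != 0) ->
  C1 U (fun y => (f y)^-1).
Proof.
move=> oU fC f0; apply: (C1_comp1 oU fC) => x /f0 fx0; split.
  by have [] := is_derive1_inv fx0.
have : {for f x, continuous (fun y : R => - y ^- 2)}.
  apply: contN; apply: contV; first by rewrite expf_neq0.
  exact: exprn_continuous.
apply: near_continuous; near=> y.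
rewrite derive1E; apply/esym.
suff y0 : y != 0 by have [_ ->] := is_derive1_inv y0.
near: y; exact: (cvgr_neq0 (f x)).
Unshelve. all: by end_near. Qed.

Lemma C1_sqrt U f : open U -> C1 U f -> (forall x, U x -> 0 < f x) ->
  C1 U (fun y => Num.sqrt (f y)).
Proof.
move=> oU fC f0; apply: (C1_comp1 oU fC) => x /f0 fx0; split.
  by have [] := is_derive1_sqrt fx0.
have : {for f x, continuous (fun y : R => (2 * Num.sqrt y)^-1)}.
  apply: contV; first by rewrite mulf_neq0// gt_eqF// sqrtr_gt0.
  by apply: contM; [exact: cont_cst|]; exact: sqrt_continuous.
apply: near_continuous; near=> y.
rewrite derive1E; apply/esym.
suff y0 : 0 < y by have [_ ->] := is_derive1_sqrt y0.
near: y; exact: lt_nbhsr.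
Unshelve. all: by end_near. Qed.

Lemma C1_coord U i : open U -> C1 U (fun x => x ord0 i).
Proof.
move=> oU; apply: (C1_intro (df := fun j _ => (i == j)%:R) oU).
- move=> x _; exact: differentiable_coord.
- move=> x j _; rewrite /partial deriveE; last exact: differentiable_coord.
  have @f : {linear 'rV[R]_n -> R}.
    by exists (fun N : 'rV[R]_n => N ord0 i); do 2![eexists]; do ?[constructor];
     rewrite ?mxE// => ? *; rewrite ?mxE//; move=> ?; rewrite !mxE.
  rewrite (_ : (fun _ => _) = f) // diff_lin; last exact: coord_continuous.
  by rewrite /= mxE eqxx.
- move=> x j _; apply: cst_continuous.
Qed.

End C1_more.

Section mean_value.
Context {R : realType} {n : nat}.
Implicit Types (U : set 'rV[R]_n) (f : 'rV[R]_n -> R) (a v x : 'rV[R]_n).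

Lemma is_derive_line f a v (t : R) : derivable f (a + t *: v) v ->
  is_derive t 1 (fun s => f (a + s *: v)) ('D_v f (a + t *: v)).
Proof.
have E : (fun h : R => h^-1 *: (((fun s => f (a + s *: v)) \o shift t) (h *: 1)
     - f (a + t *: v))) =
  (fun h => h^-1 *: ((f \o shift (a + t *: v)) (h *: v) - f (a + t *: v))).
  apply/funext => h /=; congr (_ *: (f _ - _)).
  by rewrite [h%:A]mulr1 scalerDl addrCA.
by move=> df; apply: DeriveDef; rewrite ?/derivable ?/derive E.
Qed.

Lemma MVT_line f (i : 'I_n) a (h : R) : 0 < h ->
  (forall t, 0 <= t <= h -> differentiable f (a + t *: delta_mx ord0 i)) ->
  exists2 c, 0 <= c <= h &
    f (a + h *: delta_mx ord0 i) - f a = h * partial i f (a + c *: delta_mx ord0 i).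
Proof.
move=> h0 df.
have dl t : 0 <= t <= h -> is_derive t 1 (fun s => f (a + s *: delta_mx ord0 i))
  (partial i f (a + t *: delta_mx ord0 i)).
  by move=> /df /diff_derivable D; exact: is_derive_line.
have [||c] := @MVT_segment R (fun s => f (a + s *: delta_mx ord0 i))
   (fun t => partial i f (a + t *: delta_mx ord0 i)) 0 h (ltW h0).
- by move=> t /[!in_itv]/= /andP[t0 th]; apply: dl; rewrite !ltW.
- apply: derivable_within_continuous => t /[!in_itv]/= th.
  by have [] := dl _ th.
- rewrite in_itv/= => ch; rewrite scale0r addr0 subr0 => ->.
  by exists c => //; rewrite mulrC.
Qed.

Lemma delta_norm_le (i : 'I_n) (t : R) : `|t *: delta_mx ord0 i : 'rV[R]_n| <= `|t|.
Proof.
rewrite normrZ ler_piMr// [leLHS]/Num.Def.normr/= mx_normrE.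
apply: bigmax_le => // j _; rewrite mxE.
by case: (_ && _); rewrite ?normr1 ?normr0.
Qed.

Lemma derive_translate f a b v : 'D_v (fun y => f (y + b)) a = 'D_v f (a + b).
Proof.
rewrite /derive; set F := fun h : R => _; set G := fun h : R => _.
by suff -> : F = G by []; apply/funext => s; rewrite /F /G /= addrA.
Qed.

Lemma dist_via_common (p q p' q' e : R) : `|p - p'| < e / 2 -> `|q - q'| < e / 2 ->
  q' = p' -> `|p - q| <= e.
Proof.
move=> h1 h2 E; rewrite (_ : p - q = (p - p') - (q - q')); last by rewrite E; ring.
by rewrite (le_trans (ler_normB _ _))//; lra.
Qed.

(** Both mixed derivatives are limits of the same second difference: the mean
    value theorem, applied along the two directions in either order, writes it as
    a mixed derivative at a point within distance 2 h of x. *)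
Lemma schwarz U f (i j : 'I_n) x : open U -> U x ->
  C1 U f -> (forall k, C1 U (partial k f)) ->
  partial i (partial j f) x = partial j (partial i f) x.
Proof.
move=> oU Ux fC pC.
have key (p q : 'I_n) (h : R) : 0 < h ->
   (forall y, `|y| <= h + h -> U (x + y)) ->
   exists2 y, `|y| <= h + h &
     f (x + h *: delta_mx ord0 p + h *: delta_mx ord0 q) - f (x + h *: delta_mx ord0 p)
     - (f (x + h *: delta_mx ord0 q) - f x)
     = h * (h * partial q (partial p f) (x + y)).
  move=> h0 hU.
  have sm (t s : R) : 0 <= t <= h -> 0 <= s <= h ->
    `|t *: delta_mx ord0 p + s *: delta_mx ord0 q : 'rV[R]_n| <= h + h.
    move=> /andP[t0 th] /andP[s0 sh]; rewrite (le_trans (ler_normD _ _))//.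
    by rewrite lerD// (le_trans (delta_norm_le _ _))// ger0_norm.
  have hh : 0 <= h <= h by rewrite lexx ltW.
  have h00 : 0 <= (0 : R) <= h by rewrite lexx ltW.
  pose g y := f (y + h *: delta_mx ord0 q) - f y.
  have dsh y : U (y + h *: delta_mx ord0 q) ->
      differentiable (fun y => f (y + h *: delta_mx ord0 q)) y.
    by move=> Uy; apply: differentiable_comp => //; exact: C1_differentiable fC Uy.
  have U1 t : 0 <= t <= h ->
     U (x + t *: delta_mx ord0 p + h *: delta_mx ord0 q).
    by move=> th; rewrite -addrA; apply: hU; exact: sm.
  have U2 t : 0 <= t <= h -> U (x + t *: delta_mx ord0 p).
    move=> th; apply: hU.
    by have := sm t 0 th h00; rewrite scale0r addr0.
  have [t th|c ch gE] := @MVT_line g p x h h0.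
    apply: differentiableB; first exact/dsh/U1.
    exact: (C1_differentiable fC (U2 _ th)).
  have E : partial p g (x + c *: delta_mx ord0 p) =
    partial p f (x + c *: delta_mx ord0 p + h *: delta_mx ord0 q)
    - partial p f (x + c *: delta_mx ord0 p).
    rewrite /partial deriveB//; last 2 first.
    - exact/diff_derivable/dsh/U1.
    - exact: diff_derivable (C1_differentiable fC (U2 _ ch)).
    by rewrite derive_translate.
  have [t th|d dh pE] := @MVT_line (partial p f) q (x + c *: delta_mx ord0 p) h h0.
    apply: (C1_differentiable (pC p)); rewrite -addrA; apply: hU; exact: sm.
  exists (c *: delta_mx ord0 p + d *: delta_mx ord0 q); first exact: sm.
  by rewrite -/(g (x + h *: delta_mx ord0 p)) -/(g x) gE E pE addrA.
apply/eqP; rewrite -subr_eq0 -normr_le0; apply/ler_addgt0Pl => e e0; rewrite addr0.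
have ci := C1_partial_continuous i (pC j) Ux.
have cj := C1_partial_continuous j (pC i) Ux.
have e2 : 0 < e / 2 by rewrite divr_gt0.
have /nbhs_ballP [d /= d0 dP] : \forall y \near x, U y /\
   (`|partial i (partial j f) x - partial i (partial j f) y| < e / 2 /\
    `|partial j (partial i f) x - partial j (partial i f) y| < e / 2).
  apply: filterI; first exact: open_nbhs_nbhs.
  apply: filterI.
    by apply: cvgr_dist_lt ci _ e2.
  by apply: cvgr_dist_lt cj _ e2.
pose h := d / 4.
have h0 : 0 < h by rewrite divr_gt0.
have hb y : `|y| <= h + h -> ball x d (x + y).
  move=> yh; rewrite -ball_normE/= opprD addNKr normrN (le_lt_trans yh)//.
  by rewrite /h; lra.
have hU y : `|y| <= h + h -> U (x + y) by move=> /hb /dP [].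
have [y yh yE] := key i j h h0 hU.
have [z zh zE] := key j i h h0 hU.
have yz : partial j (partial i f) (x + y) = partial i (partial j f) (x + z).
  have hn : h != 0 by rewrite gt_eqF.
  apply: (mulfI hn); apply: (mulfI hn); apply: etrans (esym yE) (etrans _ zE).
  have A4 (p q r s : R) : p - q - (r - s) = p - r - (q - s) by ring.
  by rewrite A4 [in LHS](addrAC x).
have [_ [_ Y]] := dP _ (hb _ yh).
have [_ [Z _]] := dP _ (hb _ zh).
exact: dist_via_common Z Y yz.
Qed.

End mean_value.

(** * Smooth maps and the chain rule *)

Section smooth.
Context {R : realType} {n : nat}.
Implicit Types (U : set 'rV[R]_n).

Notation iter_partial f s := (foldr (fun i g => partial i g) f s).

(** An operation that commutes with every single partial derivative commutes with
    the iterated ones, so it preserves smoothness; it is used for sums, multiples,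
    coordinates and inner products with a fixed vector. *)
Lemma iter_partial_comb U (W W' W'' : normedModType R) (f : 'rV[R]_n -> W)
    (g : 'rV[R]_n -> W') (h : 'rV[R]_n -> W'') (L : W -> W' -> W'') :
  open U -> smooth_on U f -> smooth_on U g ->
  (forall (u : 'rV[R]_n -> W) (v : 'rV[R]_n -> W') x i,
     differentiable u x -> differentiable v x ->
     partial i (fun y => L (u y) (v y)) x = L (partial i u x) (partial i v x)) ->
  (forall (u : 'rV[R]_n -> W) (v : 'rV[R]_n -> W') x,
     differentiable u x -> differentiable v x ->
     differentiable (fun y => L (u y) (v y)) x) ->
  (forall x, U x -> h x = L (f x) (g x)) -> smooth_on U h.
Proof.
move=> oU fS gS Lp Ld hE.
have E s : forall x, U x -> iter_partial h s x =
    L (iter_partial f s x) (iter_partial g s x).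
  elim: s => [|i s IH] x Ux /=; first exact: hE.
  rewrite (partial_eq_on i oU Ux IH).
  exact: Lp (fS s x Ux) (gS s x Ux).
move=> s x Ux.
apply: near_eq_differentiable (Ld _ _ _ (fS s x Ux) (gS s x Ux)).
by apply: (open_near oU) => // y Uy; rewrite E.
Qed.

Lemma smooth_onD U (W : normedModType R) (f g : 'rV[R]_n -> W) : open U ->
  smooth_on U f -> smooth_on U g -> smooth_on U (fun x => f x + g x).
Proof.
move=> oU fS gS; apply: (iter_partial_comb (L := fun a b => a + b) oU fS gS).
- by move=> u v x i du dv; rewrite /partial deriveD//; exact: diff_derivable.
- by move=> u v x du dv; exact: differentiableD.
- by [].
Qed.

Lemma smooth_onZ U (W : normedModType R) (k : R) (f : 'rV[R]_n -> W) : open U ->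
  smooth_on U f -> smooth_on U (fun x => k *: f x).
Proof.
move=> oU fS; apply: (iter_partial_comb (L := fun a b => k *: a) oU fS fS).
- by move=> u v x i du dv; rewrite /partial deriveZ//; exact: diff_derivable.
- by move=> u v x du dv; exact: differentiableZ.
- by [].
Qed.

Lemma partial_coord (m : nat) (f : 'rV[R]_n -> 'rV[R]_m) i a x :
  differentiable f x -> partial i (fun y => f y ord0 a) x = partial i f x ord0 a.
Proof.
move=> df; rewrite /partial derive_mx ?mxE//; exact: diff_derivable.
Qed.

Lemma differentiable_coordf (m : nat) (f : 'rV[R]_n -> 'rV[R]_m) a x :
  differentiable f x -> differentiable (fun y => f y ord0 a) x.
Proof.
move=> df; apply: (@differentiable_comp _ _ _ _ f (fun y => y ord0 a)) df _.
exact: differentiable_coord.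
Qed.

Lemma smooth_on_coord (m : nat) U (f : 'rV[R]_n -> 'rV[R]_m) a : open U ->
  smooth_on U f -> smooth_on U (fun x => f x ord0 a).
Proof.
move=> oU fS; apply: (iter_partial_comb (L := fun (u _ : 'rV[R]_m) => u ord0 a : R) oU fS fS).
- by move=> u v x i du dv; exact: partial_coord.
- by move=> u v x du dv; exact: differentiable_coordf.
- by [].
Qed.

Lemma smooth_on_partial U (W : normedModType R) (f : 'rV[R]_n -> W) i :
  smooth_on U f -> smooth_on U (partial i f).
Proof. by move=> fS s x Ux; have := fS (rcons s i) x Ux; rewrite foldr_rcons. Qed.

Lemma smooth_on_C1 U (f : 'rV[R]_n -> R) : smooth_on U f -> C1 U f.
Proof.
move=> fS x Ux; split; first exact: (fS [::] x Ux).
by move=> i; exact: differentiable_continuous (fS [:: i] x Ux).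
Qed.

Lemma jacobianE (m : nat) (f : 'rV[R]_n -> 'rV[R]_m) x i a :
  differentiable f x -> jacobian f x i a = partial i (fun y => f y ord0 a) x.
Proof.
move=> df; rewrite partial_coord// /partial deriveEjacobian//.
by rewrite -rowE [RHS]mxE.
Qed.

Lemma partial_comp (m : nat) (T : 'rV[R]_n -> 'rV[R]_m) (g : 'rV[R]_m -> R) i x :
  differentiable T x -> differentiable g (T x) ->
  partial i (fun y => g (T y)) x =
  \sum_j partial i (fun y => T y ord0 j) x * partial j g (T x).
Proof.
move=> dT dg; rewrite {1}/partial (deriveE _ (differentiable_comp dT dg)).
rewrite diff_comp//= -(deriveE _ dT).
rewrite [X in 'd g _ X]row_sum_delta linear_sum; apply: eq_bigr => j _.
by rewrite linearZ /= partial_coord// /partial (deriveE _ dg).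
Qed.

Lemma C1_comp (m : nat) U (V : set 'rV[R]_m) (T : 'rV[R]_n -> 'rV[R]_m)
    (g : 'rV[R]_m -> R) : open U ->
  smooth_on U T -> (forall x, U x -> V (T x)) -> C1 V g -> C1 U (fun y => g (T y)).
Proof.
move=> oU TS UV gC.
have dT x : U x -> differentiable T x by exact: (TS [::]).
apply: (C1_intro (df := fun i y =>
  \sum_j partial i (fun y => T y ord0 j) y * partial j g (T y)) oU).
- move=> x Ux; apply: differentiable_comp; first exact: dT.
  exact: C1_differentiable gC (UV _ Ux).
- move=> x i Ux; apply: partial_comp; first exact: dT.
  exact: C1_differentiable gC (UV _ Ux).
- move=> x i Ux; apply: cont_sum => j; apply: contM.
    exact: C1_partial_continuous i (smooth_on_C1 (smooth_on_coord j oU TS)) Ux.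
  apply: continuous_comp; first exact: differentiable_continuous (dT _ Ux).
  exact: C1_partial_continuous j gC (UV _ Ux).
Qed.

End smooth.

(** * Derivatives of matrix-valued functions *)

Section matrix_calculus.
Context {R : realType} {n : nat}.
Implicit Types (U : set 'rV[R]_n) (x : 'rV[R]_n).

Definition dmx p q (k : 'I_n) (F : 'rV[R]_n -> 'M[R]_(p, q)) x : 'M[R]_(p, q) :=
  \matrix_(i, j) partial k (fun y => F y i j) x.

Definition diffmx p q (F : 'rV[R]_n -> 'M[R]_(p, q)) x :=
  forall i j, differentiable (fun y => F y i j) x.

Definition C1mx U p q (F : 'rV[R]_n -> 'M[R]_(p, q)) :=
  forall i j, C1 U (fun y => F y i j).

Lemma C1mx_diff U p q (F : 'rV[R]_n -> 'M[R]_(p, q)) x : C1mx U F -> U x -> diffmx F x.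
Proof. by move=> FC Ux i j; exact: C1_differentiable (FC i j) Ux. Qed.

Lemma diffmx_tr p q (F : 'rV[R]_n -> 'M[R]_(p, q)) x :
  diffmx F x -> diffmx (fun y => (F y)^T) x.
Proof.
move=> FC i j; rewrite (_ : (fun y => _) = (fun y => F y j i)); first exact: FC.
by apply/funext => y; rewrite mxE.
Qed.

Lemma dmx_tr p q k (F : 'rV[R]_n -> 'M[R]_(p, q)) x :
  dmx k (fun y => (F y)^T) x = (dmx k F x)^T.
Proof.
apply/matrixP => i j; rewrite !mxE; congr (partial k _ x).
by apply/funext => y; rewrite mxE.
Qed.

Lemma dmx_cst p q k (A : 'M[R]_(p, q)) x : dmx k (fun=> A) x = 0.
Proof. by apply/matrixP => i j; rewrite !mxE /partial derive_cst. Qed.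

Lemma mulmx_entry p q r (F : 'rV[R]_n -> 'M[R]_(p, q)) (G : 'rV[R]_n -> 'M[R]_(q, r)) i j :
  (fun y => (F y *m G y) i j) = (fun y => \sum_k F y i k * G y k j).
Proof. by apply/funext => y; rewrite mxE. Qed.

Lemma diffmxM p q r (F : 'rV[R]_n -> 'M[R]_(p, q)) (G : 'rV[R]_n -> 'M[R]_(q, r)) x :
  diffmx F x -> diffmx G x -> diffmx (fun y => F y *m G y) x.
Proof.
move=> dF dG i j; rewrite mulmx_entry.
by apply: differentiable_bigsum => k; exact: differentiableM.
Qed.

Lemma dmxM p q r k (F : 'rV[R]_n -> 'M[R]_(p, q)) (G : 'rV[R]_n -> 'M[R]_(q, r)) x :
  diffmx F x -> diffmx G x ->
  dmx k (fun y => F y *m G y) x = dmx k F x *m G x + F x *m dmx k G x.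
Proof.
move=> dF dG; apply/matrixP => i j; rewrite !mxE mulmx_entry.
rewrite partial_sum; last by move=> l; exact: differentiableM.
rewrite -big_split; apply: eq_bigr => l _ /=.
by rewrite partialM// !mxE [RHS]addrC; congr (_ + _); exact: mulrC.
Qed.

Lemma dmxZ p q k (f : 'rV[R]_n -> R) (F : 'rV[R]_n -> 'M[R]_(p, q)) x :
  differentiable f x -> diffmx F x ->
  dmx k (fun y => f y *: F y) x = partial k f x *: F x + f x *: dmx k F x.
Proof.
move=> df dF; apply/matrixP => i j; rewrite !mxE.
rewrite (_ : (fun y => _) = (fun y => f y * F y i j)); last first.
  by apply/funext => y; rewrite mxE.
by rewrite partialM// [RHS]addrC; congr (_ + _); exact: mulrC.
Qed.

Lemma dmx_eq_on U p q k (F G : 'rV[R]_n -> 'M[R]_(p, q)) x : open U -> U x ->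
  (forall y, U y -> F y = G y) -> dmx k F x = dmx k G x.
Proof.
move=> oU Ux FG; apply/matrixP => i j; rewrite !mxE.
by apply: (partial_eq_on k oU Ux) => y Uy; rewrite FG.
Qed.

Lemma C1mx_eq U p q (F G : 'rV[R]_n -> 'M[R]_(p, q)) : open U ->
  (forall y, U y -> F y = G y) -> C1mx U F -> C1mx U G.
Proof. by move=> oU FG FC i j; apply: (C1_eq oU _ (FC i j)) => y Uy; rewrite FG. Qed.

Lemma C1mx_tr U p q (F : 'rV[R]_n -> 'M[R]_(p, q)) : C1mx U F ->
  C1mx U (fun y => (F y)^T).
Proof.
move=> FC i j; rewrite (_ : (fun y => _) = (fun y => F y j i)); first exact: FC.
by apply/funext => y; rewrite mxE.
Qed.

Lemma C1mxM U p q r (F : 'rV[R]_n -> 'M[R]_(p, q)) (G : 'rV[R]_n -> 'M[R]_(q, r)) :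
  open U -> C1mx U F -> C1mx U G -> C1mx U (fun y => F y *m G y).
Proof.
move=> oU FC GC i j; rewrite mulmx_entry.
by apply: (C1_sum _ _ oU) => k; exact: (C1M oU (FC i k) (GC k j)).
Qed.

Lemma C1mxZ U p q (f : 'rV[R]_n -> R) (F : 'rV[R]_n -> 'M[R]_(p, q)) :
  open U -> C1 U f -> C1mx U F -> C1mx U (fun y => f y *: F y).
Proof.
move=> oU fC FC i j; apply: (C1_eq oU _ (C1M oU fC (FC i j))) => y _.
by rewrite mxE.
Qed.

Lemma C1_det U p (F : 'rV[R]_n -> 'M[R]_p) : open U -> C1mx U F ->
  C1 U (fun y => \det (F y)).
Proof.
move=> oU FC; apply: (C1_sum _ _ oU) => s; apply: (C1M oU (C1_cst _ oU)).
by apply: (C1_prod _ _ oU) => i; exact: FC.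
Qed.

(** Jacobi's formula: the product rule differentiates one row at a time, and the
    expansion along that row produces the cofactors of the original matrix. *)
Lemma partial_det p k (F : 'rV[R]_n -> 'M[R]_p) x : diffmx F x ->
  partial k (fun y => \det (F y)) x = \tr (\adj (F x) *m dmx k F x).
Proof.
move=> dF; pose M i := \matrix_(l, j) if l == i then dmx k F x l j else F x l j.
transitivity (\sum_i \det (M i)).
  rewrite /determinant partial_sum; last first.
    move=> s; apply: differentiableM; first exact: differentiable_cst.
    exact: differentiable_bigprod.
  rewrite [RHS]exchange_big; apply: eq_bigr => s _ /=.
  rewrite partialM; [|exact: differentiable_cst|exact: differentiable_bigprod].
  rewrite {2}/partial derive_cst mulr0 addr0 -mulr_sumr; congr (_ * _).
  rewrite partial_prod//; last exact: index_enum_uniq.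
  apply: eq_bigr => i _; apply: eq_bigr => l _; rewrite !mxE.
  by case: eqP => // ->.
rewrite mxtrace_mulC /mxtrace; apply: eq_bigr => i _.
rewrite (expand_det_row _ i) mxE; apply: eq_bigr => j _.
rewrite !mxE eqxx; congr (_ * _); rewrite /cofactor; congr (_ * \det _).
by apply/matrixP => a b; rewrite !mxE [_ == i]eq_sym (negbTE (neq_lift i a)).
Qed.

Lemma partial_det_unit p k (F : 'rV[R]_n -> 'M[R]_p) x : diffmx F x ->
  F x \in unitmx ->
  partial k (fun y => \det (F y)) x = \det (F x) * \tr (invmx (F x) *m dmx k F x).
Proof.
move=> dF Fu; rewrite partial_det// /invmx Fu -scalemxAl mxtraceZ mulrA divff ?mul1r//.
by move: Fu; rewrite unitmxE unitfE.
Qed.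

Lemma C1mx_inv U p (F : 'rV[R]_n -> 'M[R]_p) : open U -> C1mx U F ->
  (forall y, U y -> F y \in unitmx) -> C1mx U (fun y => invmx (F y)).
Proof.
move=> oU FC Fu.
have H : C1mx U (fun y => (\det (F y))^-1 *: \adj (F y)).
  apply: (C1mxZ oU).
    apply: (C1V oU (C1_det oU FC)) => y /Fu.
    by rewrite unitmxE unitfE.
  move=> i j; rewrite (_ : (fun y => _) = (fun y => (-1) ^+ (j + i) *
      \det (row' j (col' i (F y))))); last first.
    by apply/funext => y; rewrite mxE.
  apply: (C1M oU (C1_cst _ oU)); apply: (C1_det oU) => a b.
  rewrite (_ : (fun y => _) = (fun y => F y (lift j a) (lift i b))); first exact: FC.
  by apply/funext => y; rewrite !mxE.
by apply: (C1mx_eq oU _ H) => y /Fu uy; rewrite /invmx uy.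
Qed.

Lemma dmx_inv U p k (F : 'rV[R]_n -> 'M[R]_p) x : open U -> C1mx U F ->
  (forall y, U y -> F y \in unitmx) -> U x ->
  dmx k (fun y => invmx (F y)) x = - (invmx (F x) *m dmx k F x *m invmx (F x)).
Proof.
move=> oU FC Fu Ux.
have IC := C1mx_inv oU FC Fu.
have := dmxM k (C1mx_diff IC Ux) (C1mx_diff FC Ux).
rewrite (dmx_eq_on k oU Ux (G := fun=> 1%:M)); last by move=> y /Fu; exact: mulVmx.
rewrite dmx_cst => /esym /eqP; rewrite addr_eq0 => /eqP /(congr1 (mulmx^~ (invmx (F x)))).
by rewrite mulmxK ?Fu// mulNmx.
Qed.

(** Row j of F is the j-th component of a vector field with values in R^q, so this
    is the coordinate divergence, without the area density. *)
Definition dv q (F : 'rV[R]_n -> 'M[R]_(n, q)) x : 'rV[R]_q :=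
  \row_b \sum_j partial j (fun y => F y j b) x.

Lemma dv_eq_on U q (F G : 'rV[R]_n -> 'M[R]_(n, q)) x : open U -> U x ->
  (forall y, U y -> F y = G y) -> dv F x = dv G x.
Proof.
move=> oU Ux FG; apply/rowP => b; rewrite !mxE; apply: eq_bigr => j _.
by apply: (partial_eq_on j oU Ux) => y Uy; rewrite FG.
Qed.

Lemma dvM p q (F : 'rV[R]_n -> 'M[R]_(n, p)) (Y : 'rV[R]_n -> 'M[R]_(q, p)) x b :
  diffmx F x -> diffmx Y x ->
  dv (fun y => F y *m (Y y)^T) x ord0 b = (dv F x *m (Y x)^T) ord0 b +
    \sum_j \sum_a F x j a * partial j (fun y => Y y b a) x.
Proof.
move=> dF dY; rewrite !mxE.
transitivity (\sum_j \sum_a partial j (fun y => F y j a * (Y y)^T a b) x).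
  apply: eq_bigr => j _; rewrite mulmx_entry partial_sum// => a.
  by apply: differentiableM; [exact: dF|exact: (diffmx_tr dY)].
rewrite exchange_big/= [X in _ = _ + X]exchange_big/= -big_split/=.
apply: eq_bigr => a _; rewrite mxE mulr_suml -big_split/=; apply: eq_bigr => j _.
have E : (fun y => (Y y)^T a b) = (fun y => Y y b a) by apply/funext => y; rewrite mxE.
rewrite partialM; [|exact: dF|exact: (diffmx_tr dY)].
by rewrite E [RHS]addrC; congr (_ + _); exact: mulrC.
Qed.

End matrix_calculus.

(** * Gram matrices and adapted frames *)

Section gram.
Context {R : realType}.

Lemma dotvE m (u v : 'rV[R]_m) : dotv u v = \sum_i u ord0 i * v ord0 i.
Proof. by rewrite /dotv mxE; apply: eq_bigr => i _; rewrite mxE. Qed.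

Lemma dotvv_eq0 m (u : 'rV[R]_m) : dotv u u = 0 -> u = 0.
Proof.
rewrite dotvE => /psumr_eq0P h; apply/rowP => i; rewrite mxE.
by have /eqP := h (fun i _ => sqr_ge0 _) i isT; rewrite sqrf_eq0 => /eqP.
Qed.

Lemma tr11 (A : 'M[R]_1) : A^T = A.
Proof. by apply/matrixP => i j; rewrite mxE !ord1. Qed.

Lemma gram_unit n m (D : 'M[R]_(n, m)) : row_free D -> D *m D^T \in unitmx.
Proof.
move=> Df; rewrite -row_free_unit; apply/row_freeP.
suff /row_freeP : row_free (D *m D^T) by [].
rewrite -kermx_eq0; apply/eqP/row_matrixP => i; rewrite row0.
set u := row i _.
have uG : u *m (D *m D^T) = 0.
  by rewrite /u -row_mul mulmx_ker row0.
have uD : u *m D = 0.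
  by apply: dotvv_eq0; rewrite /dotv trmx_mul mulmxA -(mulmxA u) uG mul0mx mxE.
by apply/eqP; rewrite -(mulmx_free_eq0 _ Df) uD.
Qed.

Lemma det_gram_ge0 p q (W : 'M[R]_(p, q)) : p = q -> 0 <= \det (W *m W^T).
Proof. by move=> e; subst q; rewrite det_mulmx det_tr; exact: sqr_ge0. Qed.

Section frame.
Variables (n : nat) (D : 'M[R]_(n, n.+2)) (X N : 'rV[R]_n.+2).
Hypotheses (Df : row_free D) (XX : X *m X^T = 1%:M) (NN : N *m N^T = 1%:M)
  (NX : N *m X^T = 0) (DX : D *m X^T = 0) (DN : D *m N^T = 0).
Let G := D *m D^T.
Let W := col_mx D (col_mx X N).

Let XN : X *m N^T = 0. Proof. by rewrite -[LHS]trmxK trmx_mul trmxK NX trmx0. Qed.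
Let XD : X *m D^T = 0. Proof. by rewrite -[LHS]trmxK trmx_mul trmxK DX trmx0. Qed.
Let ND : N *m D^T = 0. Proof. by rewrite -[LHS]trmxK trmx_mul trmxK DN trmx0. Qed.

Lemma frame_gram : W *m W^T = block_mx G 0 0 1%:M.
Proof.
rewrite /W !tr_col_mx mul_col_row mul_mx_row mul_col_mx DX DN XD ND -/G.
rewrite mul_col_row XX NN XN NX row_mx0 col_mx0.
by rewrite -scalar_mx_block.
Qed.

(** Completing D by the orthonormal pair X, N gives a square matrix W, and W W^T has
    the same determinant as D D^T; hence this determinant is the square of det W. *)
Lemma gram_det_gt0 : 0 < \det G.
Proof.
rewrite lt_neqAle; apply/andP; split.
  by have := gram_unit Df; rewrite unitmxE unitfE eq_sym.
have : 0 <= \det (W *m W^T) by apply: det_gram_ge0; rewrite addn2.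
by rewrite frame_gram det_ublock det1 mulr1.
Qed.

(** The orthogonal projections onto the tangent space, the position and the normal
    add up to the identity: their sum minus 1 is killed by the matrix W of the
    frame, which has full rank. *)
Lemma frame_complete : D^T *m invmx G *m D + X^T *m X + N^T *m N = 1%:M.
Proof.
have Gu : G \in unitmx := gram_unit Df.
have Wfull : row_full W.
  have : row_free W.
    rewrite -kermx_eq0; apply/eqP/row_matrixP => i; rewrite row0.
    set u := row i _.
    have uG : u *m W *m W^T = 0.
      by rewrite /u -mulmxA -row_mul mulmxA mulmx_ker mul0mx row0.
    rewrite -mulmxA frame_gram in uG.
    have Bu : block_mx G 0 0 1%:M \in @unitmx R (n + (1 + 1)).
      by rewrite unitmxE det_ublock det1 mulr1 -unitmxE.
    by rewrite -(mulmxK Bu u) uG mul0mx.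
  by rewrite /row_free /row_full => /eqP ->; rewrite addn2.
apply/eqP; rewrite -subr_eq0; apply/eqP.
set Z := _ - _.
have WZ : W *m Z = 0.
  rewrite mul_col_mx mul_col_mx /Z !mulmxBr !mulmxDr !mulmx1 !mulmxA.
  rewrite DX DN XX NN XN NX XD ND -/G (mulmxV Gu) !mul0mx !mul1mx.
  by rewrite !(addr0, add0r) !subrr !col_mx0.
by rewrite -(mul1mx Z) -(mulVpmx Wfull) -mulmxA WZ mulmx0.
Qed.

Lemma frame_decomp p (V : 'M[R]_(p, n.+2)) :
  V = V *m D^T *m invmx G *m D + V *m X^T *m X + V *m N^T *m N.
Proof. by rewrite -{1}[V]mulmx1 -frame_complete !mulmxDr !mulmxA. Qed.

Lemma frame_eq0 p (V : 'M[R]_(p, n.+2)) :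
  V *m D^T = 0 -> V *m X^T = 0 -> V *m N^T = 0 -> V = 0.
Proof.
by move=> a b c; rewrite (frame_decomp V) a b c !mul0mx !addr0.
Qed.

End frame.
End gram.

(** * Laplacians of position and normal on a coordinate patch *)

Section smooth_jacobian.
Context {R : realType} {n m : nat}.
Variable U : set 'rV[R]_n.
Hypothesis oU : open U.

(** Jacobians enter the computations below through their entries only; keeping J
    abstract separates matrix algebra from the definition of the differential. *)
Definition is_jac (F : 'rV[R]_n -> 'rV[R]_m) (J : 'rV[R]_n -> 'M[R]_(n, m)) :=
  forall y i a, U y -> J y i a = partial i (fun z => F z ord0 a) y.

Lemma is_jac_jacobian F : smooth_on U F -> is_jac F (jacobian F).
Proof. by move=> FS y i a Uy; apply: jacobianE; exact: (FS [::] _ Uy). Qed.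

Section jac.
Variables (F : 'rV[R]_n -> 'rV[R]_m) (J : 'rV[R]_n -> 'M[R]_(n, m)).
Hypothesis FS : smooth_on U F.
Hypothesis FJ : is_jac F J.

Lemma C1mx_smooth : C1mx U F.
Proof. by move=> i a; rewrite ord1; exact: smooth_on_C1 (smooth_on_coord a oU FS). Qed.

Lemma C1mx_jac : C1mx U J.
Proof.
move=> i a; apply: (C1_eq oU _ (smooth_on_C1 (smooth_on_partial i
  (smooth_on_coord a oU FS)))) => y Uy.
by rewrite FJ.
Qed.

Lemma dmx_row k y : U y -> dmx k F y = row k (J y).
Proof.
by move=> Uy; apply/matrixP => i a; rewrite [LHS]mxE [RHS]mxE FJ// ord1.
Qed.

Lemma dmx_jac_sym j k a y : U y ->
  partial j (fun z => J z k a) y = dmx k J y j a.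
Proof.
move=> Uy; rewrite mxE.
rewrite (partial_eq_on j oU Uy (fun z Uz => FJ k a Uz)).
rewrite (partial_eq_on k oU Uy (fun z Uz => FJ j a Uz)).
apply: (schwarz j k oU Uy).
  exact: smooth_on_C1 (smooth_on_coord a oU FS).
by move=> l; exact: smooth_on_C1 (smooth_on_partial l (smooth_on_coord a oU FS)).
Qed.

End jac.

Lemma jac_orth F J H K (c : 'M[R]_1) y :
  smooth_on U F -> smooth_on U H -> is_jac F J -> is_jac H K ->
  (forall z, U z -> F z *m (H z)^T = c) -> U y ->
  J y *m (H y)^T + K y *m (F y)^T = 0.
Proof.
move=> FS HS FJ HK FH Uy; apply/row_matrixP => k; rewrite row0.
have dF := C1mx_diff (C1mx_smooth FS) Uy.
have dH := C1mx_diff (C1mx_smooth HS) Uy.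
have := dmxM k dF (diffmx_tr dH).
rewrite (dmx_eq_on k oU Uy FH) dmx_cst dmx_tr (dmx_row FJ)// (dmx_row HK)//.
move=> /esym E; rewrite linearD/= !row_mul -[X in _ + X = _]tr11 trmx_mul trmxK.
exact: E.
Qed.

End smooth_jacobian.

(** The immersion and its normal read in one chart: X and N are the position and
    the normal as vectors of R^(n+2), and D and E are their Jacobians.  Then
    D D^T is the metric, and - E D^T is the second fundamental form. *)
Record is_patch (R : realType) (n : nat) (U : set 'rV[R]_n)
    (X N : 'rV[R]_n -> 'rV[R]_n.+2) (D E : 'rV[R]_n -> 'M[R]_(n, n.+2)) : Prop :=
  IsPatch {
  patch_open : open U;
  patch_X : smooth_on U X;
  patch_N : smooth_on U N;
  patch_D : is_jac U X D;
  patch_E : is_jac U N E;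
  patch_free : forall y, U y -> row_free (D y);
  patch_XX : forall y, U y -> X y *m (X y)^T = 1%:M;
  patch_NN : forall y, U y -> N y *m (N y)^T = 1%:M;
  patch_NX : forall y, U y -> N y *m (X y)^T = 0;
  patch_DN : forall y, U y -> D y *m (N y)^T = 0 }.

Section patch.
Context {R : realType} {n : nat}.
Variables (U : set 'rV[R]_n) (X N : 'rV[R]_n -> 'rV[R]_n.+2).
Variables D E : 'rV[R]_n -> 'M[R]_(n, n.+2).
Hypothesis patchP : is_patch U X N D E.

Let oU := patch_open patchP.
Let XS := patch_X patchP.
Let NS := patch_N patchP.
Let DE := patch_D patchP.
Let EE := patch_E patchP.
Let Df := patch_free patchP.
Let XX := patch_XX patchP.
Let NN := patch_NN patchP.
Let NX := patch_NX patchP.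
Let DN := patch_DN patchP.

Let G y := D y *m (D y)^T.
Let w y := Num.sqrt (\det (G y)).
Let Gi y := invmx (G y).

Lemma patch_DX y : U y -> D y *m (X y)^T = 0.
Proof.
move=> Uy; have := jac_orth oU XS XS DE DE XX Uy; rewrite -mulr2n -scaler_nat.
by move=> /eqP; rewrite scaler_eq0 pnatr_eq0 => /eqP.
Qed.

Lemma patch_EN y : U y -> E y *m (N y)^T = 0.
Proof.
move=> Uy; have := jac_orth oU NS NS EE EE NN Uy; rewrite -mulr2n -scaler_nat.
by move=> /eqP; rewrite scaler_eq0 pnatr_eq0 => /eqP.
Qed.

Lemma patch_EX y : U y -> E y *m (X y)^T = 0.
Proof.
by move=> Uy; have := jac_orth oU NS XS EE DE NX Uy; rewrite (DN Uy) addr0.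
Qed.

Lemma patch_metric_unit y : U y -> G y \in unitmx. Proof. by move=> Uy; exact/gram_unit/Df. Qed.

Lemma patch_density_gt0 y : U y -> 0 < w y.
Proof.
move=> Uy; rewrite sqrtr_gt0.
exact: (gram_det_gt0 (Df Uy) (XX Uy) (NN Uy) (NX Uy) (patch_DX Uy) (DN Uy)).
Qed.

Let GiT y : (Gi y)^T = Gi y.
Proof. by rewrite trmx_inv /G trmx_mul trmxK. Qed.

Let h y := E y *m (D y)^T.

(** Differentiating D N^T = 0 expresses E D^T through the second derivatives of X,
    which are symmetric. *)
Lemma patch_second_form_sym y : U y -> (h y)^T = h y.
Proof.
move=> Uy; rewrite /h trmx_mul trmxK; apply/matrixP => k j.
have key a b : (E y *m (D y)^T) a b + \sum_c N y ord0 c * dmx a D y b c = 0.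
  have dD := C1mx_diff (C1mx_jac oU XS DE) Uy; have dN := C1mx_diff (C1mx_smooth oU NS) Uy.
  have := congr1 (fun A : 'M[R]_(n, 1) => A b ord0) (dmxM a dD (diffmx_tr dN)).
  rewrite (dmx_eq_on a oU Uy DN) dmx_cst dmx_tr (dmx_row EE)// mxE [RHS]mxE.
  move=> /esym H; rewrite -[RHS]H [RHS]addrC; congr (_ + _).
    rewrite [LHS]mxE [RHS]mxE; apply: eq_bigr => c _.
    by rewrite mulrC; congr (_ * _); rewrite !mxE.
  by rewrite [RHS]mxE; apply: eq_bigr => c _; rewrite mulrC; congr (_ * _); rewrite mxE.
have K : (E y *m (D y)^T) k j = (E y *m (D y)^T) j k.
  have a := key k j; have b := key j k.
  rewrite (eq_bigr (fun c => N y ord0 c * dmx k D y j c)) in b.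
    by apply: (addIr (\sum_c N y ord0 c * dmx k D y j c)); rewrite a b.
  by move=> c _; rewrite -(dmx_jac_sym oU XS DE) // [in RHS]mxE.
by rewrite -[LHS]/((D y *m (E y)^T) k j) -[D y *m _]trmxK trmx_mul trmxK mxE K.
Qed.

Let S y := - (E y - (E y *m (X y)^T) *m X y) *m pinvmx (D y).

(** E is tangent, because N has unit length and is orthogonal to X; so E is
    determined by its products with D. *)
Lemma shape_patch y : U y -> S y = - (h y *m Gi y).
Proof.
move=> Uy; rewrite /S patch_EX// mul0mx subr0.
have {1}-> : E y = h y *m Gi y *m D y.
  by rewrite [LHS](frame_decomp (Df Uy) (XX Uy) (NN Uy) (NX Uy) (patch_DX Uy) (DN Uy))
    patch_EX// patch_EN// !mul0mx !addr0.
rewrite mulNmx -(mulmxA (h y *m Gi y)).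
by rewrite (mulmxVp (Df Uy)) mulmx1.
Qed.



Lemma patch_metric_C1 : C1mx U G.
Proof. exact: (C1mxM oU (C1mx_jac oU XS DE) (C1mx_tr (C1mx_jac oU XS DE))). Qed.

Let det0 y : U y -> 0 < \det (G y).
Proof. by move=> /patch_density_gt0; rewrite /w sqrtr_gt0. Qed.

Lemma patch_density_C1 : C1 U w.
Proof. exact: (C1_sqrt oU (C1_det oU patch_metric_C1) det0). Qed.

Lemma patch_invmetric_C1 : C1mx U Gi.
Proof. exact: (C1mx_inv oU patch_metric_C1 patch_metric_unit). Qed.

Lemma patch_D_C1 : C1mx U D. Proof. exact: (C1mx_jac oU XS DE). Qed.
Lemma patch_E_C1 : C1mx U E. Proof. exact: (C1mx_jac oU NS EE). Qed.

Let partial_w k y : U y ->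
  partial k w y = w y / 2 * \tr (Gi y *m dmx k G y).
Proof.
move=> Uy; have d0 := det0 Uy.
have [dq Eq] := is_derive1_sqrt d0.
rewrite /w (partial_comp1 _ (C1_differentiable (C1_det oU patch_metric_C1) Uy) dq) derive1E Eq.
rewrite (partial_det_unit k (C1mx_diff patch_metric_C1 Uy) (patch_metric_unit Uy)) mulrA;
  congr (_ * _).
have s0 : Num.sqrt (\det (G y)) != 0 by rewrite gt_eqF// sqrtr_gt0.
by rewrite -{2}(sqr_sqrtr (ltW d0)); field.
Qed.

Let P y := w y *: (Gi y *m D y).
Let Q y := w y *: (Gi y *m E y).

Let PC : C1mx U P.
Proof.
exact: (C1mxZ oU patch_density_C1 (C1mxM oU patch_invmetric_C1 patch_D_C1)).
Qed.
Let QC : C1mx U Q.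
Proof.
exact: (C1mxZ oU patch_density_C1 (C1mxM oU patch_invmetric_C1 patch_E_C1)).
Qed.

Lemma tr_mul_tr p q (A B : 'M[R]_(p, q)) :
  \sum_j \sum_a A j a * B j a = \tr (A *m B^T).
Proof.
by apply: eq_bigr => j _; rewrite mxE; apply: eq_bigr => a _; rewrite mxE.
Qed.

Lemma dv_cst q (A : 'M[R]_(n, q)) y : dv (fun=> A) y = 0.
Proof. by apply/rowP => b; rewrite !mxE big1// => j _; rewrite /partial derive_cst. Qed.

(** When F is pointwise orthogonal to Y, the product rule turns the divergence of F
    along Y into minus the contraction of F with the derivative of Y. *)
Lemma dv_pair_vec (F : 'rV[R]_n -> 'M[R]_(n, n.+2)) (Y : 'rV[R]_n -> 'rV[R]_n.+2)
    (J : 'rV[R]_n -> 'M[R]_(n, n.+2)) y :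
  C1mx U F -> smooth_on U Y -> is_jac U Y J -> (forall z, U z -> F z *m (Y z)^T = 0) ->
  U y -> dv F y *m (Y y)^T = (- \tr (F y *m (J y)^T))%:M.
Proof.
move=> FC YS YJ FY Uy; rewrite [LHS]mx11_scalar; congr (_%:M).
have := dvM ord0 (C1mx_diff FC Uy) (C1mx_diff (C1mx_smooth oU YS) Uy).
rewrite (dv_eq_on oU Uy FY) dv_cst [X in X = _]mxE => /esym/eqP.
rewrite addr_eq0 => /eqP ->; congr (- _); rewrite -tr_mul_tr.
by apply: eq_bigr => j _; apply: eq_bigr => a _; rewrite YJ.
Qed.

Lemma dv_pair_jac (F : 'rV[R]_n -> 'M[R]_(n, n.+2)) (Y : 'rV[R]_n -> 'rV[R]_n.+2)
    (J : 'rV[R]_n -> 'M[R]_(n, n.+2)) y k :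
  C1mx U F -> smooth_on U Y -> is_jac U Y J -> U y ->
  dv (fun z => F z *m (J z)^T) y ord0 k =
  (dv F y *m (J y)^T) ord0 k + \tr (F y *m (dmx k J y)^T).
Proof.
move=> FC YS YJ Uy.
rewrite (dvM _ (C1mx_diff FC Uy) (C1mx_diff (C1mx_jac oU YS YJ) Uy)).
congr (_ + _); rewrite -tr_mul_tr; apply: eq_bigr => j _; apply: eq_bigr => a _.
by rewrite (dmx_jac_sym oU YS YJ).
Qed.

Let tr_sym p (A B : 'M[R]_p) : \tr (A *m B) = \tr (B^T *m A^T).
Proof. by rewrite -mxtrace_tr trmx_mul. Qed.

Lemma patch_DE y : U y -> D y *m (E y)^T = h y.
Proof. by move=> Uy; rewrite -[RHS]patch_second_form_sym// /h trmx_mul trmxK. Qed.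

(** Divided by the area density w, the left-hand side is the Laplacian of the
    position, so this is the classical formula Delta X = - n X + n H N.  Both sides
    have the same products with X, N and the coordinate fields; the tangential
    products vanish by Jacobi's formula dw = w / 2 tr (G^-1 dG). *)
Lemma dv_position y : U y ->
  dv P y = w y *: (- n%:R *: X y - \tr (h y *m Gi y) *: N y).
Proof.
move=> Uy; apply/eqP; rewrite -subr_eq0; apply/eqP.
have GGi : G y *m Gi y = 1%:M by rewrite mulmxV// patch_metric_unit.
have GiG : Gi y *m G y = 1%:M by rewrite mulVmx// patch_metric_unit.
have XN : X y *m (N y)^T = 0 by rewrite -[LHS]trmxK trmx_mul trmxK NX// trmx0.
have XD : X y *m (D y)^T = 0 by rewrite -[LHS]trmxK trmx_mul trmxK patch_DX// trmx0.
have ND : N y *m (D y)^T = 0 by rewrite -[LHS]trmxK trmx_mul trmxK DN// trmx0.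
apply: (frame_eq0 (Df Uy) (XX Uy) (NN Uy) (NX Uy) (patch_DX Uy) (DN Uy));
  rewrite mulmxBl -scalemxAl mulmxBl -!scalemxAl.
- rewrite XD ND !scaler0 subr0 scaler0 subr0; apply/rowP => k; rewrite [RHS]mxE.
  have := dv_pair_jac k PC XS DE Uy.
  rewrite (dv_eq_on oU Uy (G := fun z => w z *: 1%:M)); last first.
    by move=> z Uz; rewrite /P -scalemxAl -mulmxA -/(G z) mulVmx// patch_metric_unit.
  rewrite mxE (bigD1 k)//= big1 => [|j jk]; last first.
    rewrite (_ : (fun y => _) = cst 0) ?/partial ?derive_cst//.
    by apply/funext => z; rewrite !mxE (negbTE jk) mulr0.
  rewrite (_ : (fun y => _) = w); last by apply/funext => z; rewrite !mxE eqxx mulr1.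
  rewrite addr0 partial_w// => /eqP; rewrite -subr_eq => /eqP <-.
  rewrite /G (dmxM k (C1mx_diff patch_D_C1 Uy) (diffmx_tr (C1mx_diff patch_D_C1 Uy))) dmx_tr.
  have E1 : \tr (Gi y *m (dmx k D y *m (D y)^T)) = \tr (Gi y *m (D y *m (dmx k D y)^T)).
    by rewrite [LHS]tr_sym !trmx_mul trmxK GiT mxtrace_mulC.
  rewrite mulmxDr mxtraceD E1 /P -scalemxAl mxtraceZ -mulmxA.
  by field.
- rewrite XX// (_ : N y *m (X y)^T = 0) ?NX// scaler0 subr0.
  rewrite (dv_pair_vec PC XS DE _ Uy); last first.
    by move=> z Uz; rewrite /P -scalemxAl -mulmxA patch_DX// mulmx0 scaler0.
  rewrite /P -scalemxAl mxtraceZ -mulmxA -/(G y) GiG mxtrace1.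
  rewrite !scale_scalar_mx -raddfB /= (_ : _ - _ = 0) ?raddf0//; ring.
- rewrite XN NN// scaler0 sub0r.
  rewrite (dv_pair_vec PC NS EE _ Uy); last first.
    by move=> z Uz; rewrite /P -scalemxAl -mulmxA DN// mulmx0 scaler0.
  rewrite /P -scalemxAl mxtraceZ -mulmxA patch_DE// mxtrace_mulC.
  rewrite -[X in _ *: X]scaleNr !scale_scalar_mx -raddfB /= (_ : _ - _ = 0) ?raddf0//; ring.
Qed.

(** This is Delta N = n H X - |A|^2 N for n H constant and equal to c.  The
    tangential part is the contracted Codazzi equation: by symmetry of the second
    fundamental form Q D^T = P E^T, the divergence of the latter involves dv P,
    which is normal by dv_position, and the derivative of tr (P E^T) = - c w. *)
Lemma dv_normal c y : (forall z, U z -> - \tr (h z *m Gi z) = c) -> U y ->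
  dv Q y = w y *: (c *: X y - \tr (h y *m Gi y *m (h y *m Gi y)) *: N y).
Proof.
move=> Hc Uy; apply/eqP; rewrite -subr_eq0; apply/eqP.
have GGi : G y *m Gi y = 1%:M by rewrite mulmxV// patch_metric_unit.
have GiG : Gi y *m G y = 1%:M by rewrite mulVmx// patch_metric_unit.
have XN : X y *m (N y)^T = 0 by rewrite -[LHS]trmxK trmx_mul trmxK NX// trmx0.
have XD : X y *m (D y)^T = 0 by rewrite -[LHS]trmxK trmx_mul trmxK patch_DX// trmx0.
have ND : N y *m (D y)^T = 0 by rewrite -[LHS]trmxK trmx_mul trmxK DN// trmx0.
have XE : X y *m (E y)^T = 0 by rewrite -[LHS]trmxK trmx_mul trmxK patch_EX// trmx0.
have NE : N y *m (E y)^T = 0 by rewrite -[LHS]trmxK trmx_mul trmxK patch_EN// trmx0.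
have Edec : E y = h y *m Gi y *m D y.
  by rewrite [LHS](frame_decomp (Df Uy) (XX Uy) (NN Uy) (NX Uy) (patch_DX Uy) (DN Uy))
    patch_EX// patch_EN// !mul0mx !addr0.
apply: (frame_eq0 (Df Uy) (XX Uy) (NN Uy) (NX Uy) (patch_DX Uy) (DN Uy));
  rewrite mulmxBl -scalemxAl mulmxBl -!scalemxAl.
- rewrite XD ND !scaler0 subr0 scaler0 subr0; apply/rowP => k; rewrite [RHS]mxE.
  have Q1 := dv_pair_jac k QC XS DE Uy.
  have P1 := dv_pair_jac k PC NS EE Uy.
  have QP z : U z -> Q z *m (D z)^T = P z *m (E z)^T.
    by move=> Uz; rewrite /Q /P -!scalemxAl -!mulmxA patch_DE.
  have T0 : dv P y *m (E y)^T = 0.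
    by rewrite dv_position// -scalemxAl mulmxBl -!scalemxAl XE NE !scaler0 subr0 scaler0.
  rewrite (dv_eq_on oU Uy QP) P1 T0 [X in X + _]mxE add0r in Q1.
  have -> : (dv Q y *m (D y)^T) ord0 k =
     \tr (P y *m (dmx k E y)^T) - \tr (Q y *m (dmx k D y)^T) by rewrite Q1 addrK.
  have dP := C1mx_diff PC Uy; have dE := C1mx_diff patch_E_C1 Uy;
    have dD := C1mx_diff patch_D_C1 Uy.
  have dGi := C1mx_diff patch_invmetric_C1 Uy; have dw := C1_differentiable patch_density_C1 Uy.
  have trGih : \tr (Gi y *m h y) = - c by rewrite mxtrace_mulC -(Hc y Uy) opprK.
  have -> : \tr (P y *m (dmx k E y)^T) = - c * partial k w y - \tr (dmx k P y *m (E y)^T).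
    have trPE z : U z -> \tr (P z *m (E z)^T) = - c * w z.
      move=> Uz; rewrite /P -scalemxAl mxtraceZ -mulmxA patch_DE// mxtrace_mulC.
      by rewrite -(Hc z Uz) opprK mulrC.
    have <- : partial k (fun z => \tr (P z *m (E z)^T)) y = - c * partial k w y.
      rewrite (partial_eq_on k oU Uy trPE).
      rewrite partialM; [|exact: differentiable_cst|exact: dw].
      by rewrite {2}/partial derive_cst mulr0 addr0.
    have -> : partial k (fun z => \tr (P z *m (E z)^T)) y =
      \tr (dmx k (fun z => P z *m (E z)^T) y).
      rewrite /mxtrace partial_sum => [|i]; last exact: (diffmxM dP (diffmx_tr dE)).
      by apply: eq_bigr => i _; rewrite [RHS]mxE.
    by rewrite (dmxM k dP (diffmx_tr dE)) dmx_tr mxtraceD addrAC subrr add0r.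
  have -> : \tr (Q y *m (dmx k D y)^T) = w y * \tr (Gi y *m E y *m (dmx k D y)^T).
    by rewrite /Q -scalemxAl mxtraceZ.
  have -> : \tr (dmx k P y *m (E y)^T) = partial k w y * - c +
     w y * (\tr (dmx k Gi y *m h y) + \tr (Gi y *m (dmx k D y *m (E y)^T))).
    rewrite (dmxZ k dw (diffmxM dGi dD)) (dmxM k dGi dD) mulmxDl -!scalemxAl.
    by rewrite mxtraceD !mxtraceZ mulmxDl mxtraceD -!mulmxA patch_DE// trGih.
  rewrite (dmx_inv k oU patch_metric_C1 patch_metric_unit Uy) -/(Gi y).
  set B := dmx k D y *m (D y)^T.
  have dG : dmx k G y = B + B^T.
    by rewrite /G (dmxM k dD (diffmx_tr dD)) dmx_tr /B trmx_mul trmxK.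
  have ET : (E y)^T = (D y)^T *m Gi y *m h y.
    by rewrite {1}Edec trmx_mul (trmx_mul (h y)) GiT patch_second_form_sym// mulmxA.
  have t1 : \tr (Gi y *m (dmx k D y *m (E y)^T)) = \tr (Gi y *m B *m Gi y *m h y).
    by rewrite ET /B !mulmxA.
  have t2 : \tr (Gi y *m E y *m (dmx k D y)^T) = \tr (Gi y *m B *m Gi y *m h y).
    by rewrite -t1 -mxtrace_tr !trmx_mul trmxK GiT mulmxA mxtrace_mulC mulmxA.
  have t3 : \tr (- (Gi y *m dmx k G y *m Gi y) *m h y) =
      - (\tr (Gi y *m B *m Gi y *m h y) *+ 2).
    rewrite dG mulmxDr mulmxDl mulNmx mulmxDl raddfN /= mxtraceD mulr2n.
    congr (- (_ + _)).
    rewrite -mxtrace_tr (trmx_mul _ (h y)) patch_second_form_sym// (trmx_mul _ (Gi y)) GiT.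
    by rewrite (trmx_mul (Gi y)) GiT trmxK mxtrace_mulC !mulmxA.
  by rewrite t1 t2 t3; ring.
- rewrite XX// (_ : N y *m (X y)^T = 0) ?NX// scaler0 subr0.
  rewrite (dv_pair_vec QC XS DE _ Uy); last first.
    by move=> z Uz; rewrite /Q -scalemxAl -mulmxA patch_EX// mulmx0 scaler0.
  rewrite /Q -scalemxAl mxtraceZ -mulmxA -/(h y) mxtrace_mulC -(Hc y Uy).
  rewrite !scale_scalar_mx -raddfB /= (_ : _ - _ = 0) ?raddf0//; ring.
- rewrite XN NN// scaler0 sub0r.
  rewrite (dv_pair_vec QC NS EE _ Uy); last first.
    by move=> z Uz; rewrite /Q -scalemxAl -mulmxA patch_EN// mulmx0 scaler0.
  have -> : \tr (Q y *m (E y)^T) = w y * \tr (h y *m Gi y *m (h y *m Gi y)).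
    rewrite /Q -scalemxAl mxtraceZ {1}Edec -!mulmxA patch_DE//.
    by rewrite mxtrace_mulC -!mulmxA.
  rewrite -[X in _ *: X]scaleNr !scale_scalar_mx -raddfB /= (_ : _ - _ = 0) ?raddf0//; ring.
Qed.

Lemma patch_decomp p (V : 'M[R]_(p, n.+2)) y : U y ->
  V = V *m (D y)^T *m Gi y *m D y + V *m (X y)^T *m X y + V *m (N y)^T *m N y.
Proof.
move=> Uy; exact: (frame_decomp (Df Uy) (XX Uy) (NN Uy) (NX Uy) (patch_DX Uy) (DN Uy)).
Qed.

(** The shape operator, extended by 0 to the normal directions, is a symmetric
    matrix of size n + 2, so the trace of its square is the sum of the squares of
    its entries. *)
Lemma patch_shape_eq0 y : U y ->
  \tr (h y *m Gi y *m (h y *m Gi y)) = 0 -> E y = 0.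
Proof.
move=> Uy; have Edec : E y = h y *m Gi y *m D y.
  by rewrite [LHS](patch_decomp _ Uy) patch_EX// patch_EN// !mul0mx !addr0.
pose A := (D y)^T *m Gi y *m E y.
have AT : A^T = A.
  rewrite /A Edec trmx_mul (trmx_mul (h y *m Gi y)) (trmx_mul (h y)).
  by rewrite (trmx_mul _ (Gi y)) GiT patch_second_form_sym// trmxK !mulmxA.
have DA : D y *m A = E y by rewrite /A !mulmxA -/(G y) mulmxV ?mul1mx// patch_metric_unit.
have -> : \tr (h y *m Gi y *m (h y *m Gi y)) = \tr (A *m A^T).
  rewrite AT; have -> : A *m A = (D y)^T *m (Gi y *m (h y *m Gi y *m E y)).
    by rewrite /A /h !mulmxA.
  rewrite [RHS]mxtrace_mulC -(mulmxA (Gi y)) [RHS]mxtrace_mulC.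
  by rewrite /h !mulmxA.
rewrite -tr_mul_tr => H; rewrite -DA; suff -> : A = 0 by rewrite mulmx0.
apply/matrixP => i j; rewrite [RHS]mxE.
have := psumr_eq0P _ H => /(_ (fun i _ => sumr_ge0 _ (fun j _ => sqr_ge0 _)) i isT) H'.
have := psumr_eq0P _ H' => /(_ (fun i _ => sqr_ge0 _) j isT) /eqP.
by rewrite mulf_eq0 orbb => /eqP.
Qed.

End patch.

(** * Compactly supported functions on the line *)

Section compactly_supported_line.
Context {R : realType}.
Local Notation leb := (@lebesgue_measure R).
Implicit Types (f g : R -> R) (B K : R).

Definition cc1 B f := continuous f /\ forall t, B < `|t| -> f t = 0.

Lemma cc1_restrict B f : cc1 B f -> f = f \_ `[- B, B].
Proof.
move=> [_ f0]; apply/funext => t; rewrite patchE; case: ifPn => //.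
rewrite notin_setE /= in_itv /= => /negP; rewrite -ler_norml -ltNge => Bt.
by rewrite f0.
Qed.

Lemma cc1_integrable B f : cc1 B f -> leb.-integrable setT (EFin \o f).
Proof.
move=> fB; rewrite (cc1_restrict fB) -restrict_EFin.
have : leb.-integrable `[- B, B] (EFin \o f).
  apply: continuous_compact_integrable; first exact: segment_compact.
  by apply: continuous_subspaceT; exact: fB.1.
by move/integrable_mkcond; apply.
Qed.

Lemma cc1_bound B f K : 0 <= B -> cc1 B f -> (forall t, `|f t| <= K) ->
  `|\int[leb]_t f t| <= K * (2 * B).
Proof.
move=> B0 fB fK.
rewrite (cc1_restrict fB) -Rintegral_mkcond.
have cf : {within `[- B, B], continuous f} by apply: continuous_subspaceT; exact: fB.1.
have cfi : leb.-integrable `[- B, B] (EFin \o f).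
  by apply: continuous_compact_integrable => //; exact: segment_compact.
apply: (le_trans (le_normr_Rintegral _ cfi)) => //.
have -> : K * (2 * B) = \int[leb]_(t in `[- B, B]) K.
  rewrite Rintegral_cst//= lebesgue_measure_itv/= lte_fin.
  case: ltP => [_|BB]; first by rewrite -EFinD /=; congr (_ * _); ring.
  have -> : B = 0 by lra.
  by rewrite mulr0.
apply: le_Rintegral => //.
- by apply: integrable_norm.
- apply: continuous_compact_integrable; first exact: segment_compact.
  by apply: continuous_subspaceT => x; apply: cst_continuous.
Qed.

Lemma cc1Z B f k : cc1 B f -> cc1 B (fun t => k * f t).
Proof.
move=> [fc f0]; split; first by move=> x; apply: contM; [exact: cont_cst|exact: fc].
by move=> t Bt; rewrite f0// mulr0.
Qed.

Lemma cc1_gt0 B f t0 : cc1 B f -> (forall t, 0 <= f t) -> 0 < f t0 ->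
  0 < \int[leb]_t f t.
Proof.
move=> fB f0 ft0; have [fc _] := fB.
have : \forall t \near t0, f t0 / 2 < f t.
  have h : f t0 / 2 < f t0 by rewrite ltr_pdivrMr// ltr_pMr// ltrDl.
  have fct : f t @[t --> t0] --> f t0 by exact: fc.
  by apply: (cvgr_gt (f t0) fct).
move=> /nbhs_ballP [e /= e0 be].
have e2 : 0 < e / 2 by rewrite divr_gt0.
have cfi : leb.-integrable setT (EFin \o f) by exact: cc1_integrable fB.
apply: (@lt_le_trans _ _ (\int[leb]_(t in `[(t0 - e / 2)%R, (t0 + e / 2)%R]) (f t0 / 2))).
  rewrite Rintegral_cst//= lebesgue_measure_itv/= lte_fin ifT; last lra.
  by rewrite -EFinD /= mulr_gt0// ?divr_gt0//; lra.
apply: (@le_trans _ _ (\int[leb]_(t in `[(t0 - e / 2)%R, (t0 + e / 2)%R]) f t)).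
  apply: le_Rintegral => //.
  - apply: continuous_compact_integrable; first exact: segment_compact.
    by apply: continuous_subspaceT => x; apply: cst_continuous.
  - exact: integrableS cfi.
  - move=> t /= /[!in_itv]/= /andP[h1 h2]; apply/ltW/be.
    by rewrite -ball_normE/= ltr_distlC; apply/andP; split; lra.
rewrite Rintegral_mkcond; apply: le_Rintegral => //.
- rewrite -restrict_EFin; have :
    leb.-integrable `[(t0 - e / 2)%R, (t0 + e / 2)%R] (EFin \o f) by exact: integrableS cfi.
  by move/integrable_mkcond; apply.
- by move=> t _; rewrite patchE; case: ifP.
Qed.

Lemma cc1_shift B f h : cc1 B f -> cc1 (B + `|h|) (fun t => f (t + h)).
Proof.
move=> [fc f0]; split.
  move=> x; apply: continuous_comp; last exact: fc.
  by apply: cvgD; [exact: cvg_id|apply: cst_continuous].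
move=> t Bt; apply: f0; have := ler_distD h t (- h); move: Bt.
rewrite opprK; have := ler_normB (t + h) h; rewrite addrK; lra.
Qed.

Lemma ge0_integral_shift f h : continuous f -> (forall t, 0 <= f t) ->
  \int[leb]_t f (t + h) = \int[leb]_t f t.
Proof.
move=> fc f0.
have dF (x : R) : is_derive x 1 (fun y : R => y + h) (1 + 0) by apply: is_deriveD.
have F' : (fun y : R => y + h)^`()%classic = cst 1.
  by apply/funext => x; rewrite derive1E; have [_ ->] := dF x; rewrite addr0.
rewrite /Rintegral (@increasing_ge0_integration_by_substitutionT _ (fun y => y + h) f)//.
- by congr fine; apply: eq_integral => x _ /=; rewrite F' /= !fctE /= mulr1.
- by move=> x y xy; rewrite ltrD2r.
- by rewrite F' => x; apply: cst_continuous.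
- by rewrite F'; apply: is_cvg_cst.
- by rewrite F'; apply: is_cvg_cst.
- exact: cvg_addrr_Ny.
- exact: cvg_addrr.
Qed.

Lemma cc1_integral_shift B f h : cc1 B f ->
  \int[leb]_t f (t + h) = \int[leb]_t f t.
Proof.
move=> fB; have [fc fz] := fB.
pose p t := Num.max (f t) 0; pose q t := Num.max (- f t) 0.
have mc (g : R -> R) : cc1 B g -> cc1 B (fun t => Num.max (g t) 0).
  move=> [gc g0]; split; last by move=> t /g0 ->; rewrite maxxx.
  by move=> x; apply: continuous_max; [exact: gc|apply: cst_continuous].
have pB : cc1 B p by exact: mc.
have qB : cc1 B q.
  by apply: mc; have := cc1Z (-1) fB; congr cc1; apply/funext => t; rewrite mulN1r.
have fpq : f = fun t => p t - q t.
  apply/funext => t; rewrite /p /q; case: (lerP (f t) 0) => ft.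
    by rewrite sub0r max_l ?opprK// oppr_ge0.
  by rewrite max_r ?subr0// oppr_le0 ltW.
rewrite fpq RintegralB//; last 2 first.
- exact: cc1_integrable (cc1_shift h pB).
- exact: cc1_integrable (cc1_shift h qB).
rewrite RintegralB//; [|exact: cc1_integrable pB|exact: cc1_integrable qB].
by congr (_ - _); apply: ge0_integral_shift; [exact: pB.1| |exact: qB.1|];
  move=> t; rewrite le_max lexx orbT.
Qed.

End compactly_supported_line.

(** * Iterated integrals of compactly supported functions *)

Section compactly_supported.
Context {R : realType}.
Local Notation leb := (@lebesgue_measure R).

Lemma coord_norm_le n (x : 'rV[R]_n) i : `|x ord0 i| <= `|x|.
Proof.
rewrite [leRHS]/Num.Def.normr/= mx_normrE.
exact: (le_bigmax _ (fun ij : 'I_1 * 'I_n => `|x ij.1 ij.2|) (ord0, i)).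
Qed.

Lemma norm_le_coord n (x : 'rV[R]_n) c : 0 <= c -> (forall i, `|x ord0 i| <= c) ->
  `|x| <= c.
Proof.
move=> c0 h; rewrite [leLHS]/Num.Def.normr/= mx_normrE.
by apply: bigmax_le => // -[i j] _ /=; rewrite ord1.
Qed.

Definition scons n (t : R) (y : 'rV[R]_n) : 'rV[R]_n.+1 := row_mx (const_mx t : 'rV_1) y.

Lemma scons0 n t (y : 'rV[R]_n) : scons t y ord0 ord0 = t.
Proof.
rewrite /scons (_ : ord0 = lshift n (ord0 : 'I_1)); last exact: val_inj.
by rewrite (@row_mxEl _ _ 1 n) mxE.
Qed.

Lemma sconsS n t (y : 'rV[R]_n) j : scons t y ord0 (lift ord0 j) = y ord0 j.
Proof.
rewrite /scons (_ : lift ord0 j = rshift 1 j); last exact: val_inj.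
by rewrite (@row_mxEr _ _ 1 n).
Qed.

Lemma scons_split n (x : 'rV[R]_n.+1) : exists t y, x = scons t y.
Proof.
exists (x ord0 ord0), (\row_j x ord0 (lift ord0 j)).
apply/rowP => i; case: (unliftP ord0 i) => [j ->|->]; last by rewrite scons0.
by rewrite sconsS mxE.
Qed.

Lemma sconsB n t t' (y y' : 'rV[R]_n) : scons t y - scons t' y' = scons (t - t') (y - y').
Proof.
apply/rowP => i; case: (unliftP ord0 i) => [j ->|->].
  by rewrite [LHS]mxE [X in _ + X]mxE !sconsS !mxE.
by rewrite [LHS]mxE [X in _ + X]mxE !scons0.
Qed.

Lemma scons_norm n t (y : 'rV[R]_n) c :
  (`|scons t y| <= c) = (`|t| <= c) && (`|y| <= c).
Proof.
apply/idP/andP => [h|[ht hy]].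
  split; first by rewrite -(scons0 t y) (le_trans (coord_norm_le _ _)).
  apply: norm_le_coord => [|i]; first exact: le_trans (normr_ge0 _) h.
  by rewrite -(sconsS t y) (le_trans (coord_norm_le _ _)).
apply: norm_le_coord => [|i]; first exact: le_trans (normr_ge0 _) ht.
case: (unliftP ord0 i) => [j ->|->]; last by rewrite scons0.
by rewrite sconsS (le_trans (coord_norm_le _ _)).
Qed.

Definition cc n B (g : 'rV[R]_n -> R) :=
  continuous g /\ forall x, B < `|x| -> g x = 0.

(** Heine's theorem on a ball of radius B + 1; the margin 1 takes care of pairs of
    which only one point lies in the support. *)
Lemma cc_unif n B (g : 'rV[R]_n -> R) e : cc B g -> 0 < e ->
  exists2 d, 0 < d & forall x y, `|x - y| < d -> `|g x - g y| < e.
Proof.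
move=> [gc g0] e0.
pose K := [set x : 'rV[R]_n | `|x| <= B + 1].
have cK : compact K.
  apply: bounded_closed_compact.
    by exists (B + 1); split => [|M BM];
      [exact: num_real|move=> x /= /le_trans; apply; exact: ltW].
  rewrite (_ : K = (fun x : 'rV[R]_n => `|x|) @^-1` [set r | r <= B + 1]) //.
  apply: preimage_closed; last exact: closed_le.
  by move=> x _; exact: norm_continuous.
have /compact_near_coveringP H := cK.
have e2 : 0 < e / 2 by rewrite divr_gt0.
have [|d /= d0 dP] := H _ (0 : R)^'+ (fun d x => forall y, `|x - y| < d -> `|g x - g y| < e).
  move=> x _.
  have gx : g y @[y --> x] --> g x by exact: gc.
  have /nbhs_ballP [r /= r0 rP] : \forall y \near x, `|g x - g y| < e / 2.
    by apply: cvgr_dist_lt gx _ e2.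
  have r2 : 0 < r / 2 by rewrite divr_gt0.
  exists (ball x (r / 2), ball (0 : R) (r / 2)) => /=.
    split; first exact: nbhsx_ballx.
    by apply: cvg_within; exact: nbhsx_ballx.
  move=> [x' d] [/= xx'] d0 y x'y.
  have h1 : `|g x - g x'| < e / 2 by apply: rP; apply: le_ball xx'; lra.
  have h2 : `|g x - g y| < e / 2.
    apply: rP; rewrite -ball_normE/=.
    move: xx' d0; rewrite -!ball_normE/= sub0r normrN => xx' d0.
    have := ler_distD x' x y; have := ler_norm d; lra.
  rewrite distrC in h1; have := ler_distD (g x) (g x') (g y); lra.
pose dd := Num.min (d / 2) (1 / 2).
have dd0 : 0 < dd by rewrite lt_min !divr_gt0.
have ddd : ball 0 d dd.
  rewrite -ball_normE/= sub0r normrN gtr0_norm//.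
  by rewrite gt_min; apply/orP; left; lra.
have dd1 : dd <= 1 / 2 by rewrite ge_min lexx orbT.
exists dd => // x y xy.
have [xK|xK] := leP `|x| (B + 1); first exact: (dP dd ddd dd0 x xK).
rewrite (g0 x); last by rewrite (lt_trans _ xK)// ltrDl.
rewrite (g0 y) ?subrr ?normr0//.
have := ler_distD y x 0; rewrite !subr0; lra.
Qed.

Lemma cc_mono n B B' (g : 'rV[R]_n -> R) : B <= B' -> cc B g -> cc B' g.
Proof. by move=> BB [gc g0]; split=> // x /(le_lt_trans BB); exact: g0. Qed.

Lemma ccD n B (f g : 'rV[R]_n -> R) : cc B f -> cc B g -> cc B (fun x => f x + g x).
Proof.
move=> [fc f0] [gc g0]; split; first by move=> x; apply: contD; [exact: fc|exact: gc].
by move=> x Bx; rewrite f0// g0// addr0.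
Qed.

Lemma ccZ n B k (f : 'rV[R]_n -> R) : cc B f -> cc B (fun x => k * f x).
Proof.
move=> [fc f0]; split; first by move=> x; apply: contM; [exact: cont_cst|exact: fc].
by move=> x Bx; rewrite f0// mulr0.
Qed.

Lemma ccB n B (f g : 'rV[R]_n -> R) : cc B f -> cc B g -> cc B (fun x => f x - g x).
Proof.
move=> fB gB; have := ccD fB (ccZ (-1) gB); congr cc; apply/funext => x.
by rewrite mulN1r.
Qed.

Lemma cc_slice n B (g : 'rV[R]_n.+1 -> R) t : cc B g -> cc B (fun y => g (scons t y)).
Proof.
move=> [gc g0]; split => [y|y By].
  have sy : scons t z @[z --> y] --> scons t y.
    apply/(@cvgrPdist_le _ _ _ (nbhs y) (nbhs_filter y)) => /= e e0.
    apply/nbhs_ballP; exists e => //= z; rewrite -ball_normE/= => yz.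
    by rewrite sconsB subrr scons_norm normr0 !ltW.
  by apply: continuous_comp sy _; exact: gc.
apply: g0; rewrite ltNge scons_norm negb_and -!ltNge By orbT //.
Qed.

(** Real-valued counterpart of lebesgue_int.  On continuous functions with compact
    support the iterated integral is linear, so signed functions can be treated
    without product measures. *)
Fixpoint Lint n : ('rV[R]_n -> R) -> R :=
  match n return ('rV[R]_n -> R) -> R with
  | 0 => fun g => g 0
  | n'.+1 => fun g => \int[leb]_t Lint (fun y : 'rV[R]_n' => g (scons t y))
  end.

Lemma LintS n (g : 'rV[R]_n.+1 -> R) :
  Lint g = \int[leb]_t Lint (fun y : 'rV[R]_n => g (scons t y)).
Proof. by []. Qed.

Lemma Lint_zero n : Lint (fun _ : 'rV[R]_n => 0) = 0.
Proof.
elim: n => [//|n IH]; rewrite LintS.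
under eq_Rintegral do rewrite IH.
by rewrite Rintegral_cst// mul0r.
Qed.

(** The four properties need one common induction: in dimension n + 1 each of them
    integrates a partial integral over the first variable, whose continuity comes
    from uniform continuity and from the bound and the linearity in dimension n. *)
Lemma Lint_linear n B : 0 <= B ->
  [/\ forall (g : 'rV[R]_n -> R) K, cc B g -> (forall x, `|g x| <= K) ->
         `|Lint g| <= K * (2 * B) ^+ n,
      forall f g : 'rV[R]_n -> R, cc B f -> cc B g ->
         Lint (fun x => f x + g x) = Lint f + Lint g,
      forall k (f : 'rV[R]_n -> R), cc B f ->
         Lint (fun x => k * f x) = k * Lint f &
      forall (g : 'rV[R]_n.+1 -> R), cc B g ->
         cc1 B (fun t => Lint (fun y => g (scons t y)))].
Proof.
move=> B0.
have slice m : (forall (g : 'rV[R]_m -> R) K, cc B g -> (forall x, `|g x| <= K) ->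
         `|Lint g| <= K * (2 * B) ^+ m) ->
   (forall f g : 'rV[R]_m -> R, cc B f -> cc B g ->
         Lint (fun x => f x + g x) = Lint f + Lint g) ->
   (forall k (f : 'rV[R]_m -> R), cc B f ->
         Lint (fun x => k * f x) = k * Lint f) ->
   forall (g : 'rV[R]_m.+1 -> R), cc B g ->
         cc1 B (fun t => Lint (fun y => g (scons t y))).
  move=> bd ad sc g gB; split; last first.
    move=> t Bt; rewrite (_ : (fun y => _) = fun=> 0) ?Lint_zero//.
    apply/funext => y; apply: gB.2; rewrite ltNge scons_norm negb_and -!ltNge.
    by rewrite Bt.
  move=> t; apply/cvgrPdist_le => /= e e0.
  have e1 : 0 < e / ((2 * B) ^+ m + 1).
    by rewrite divr_gt0// ltr_wpDl// exprn_ge0// mulr_ge0.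
  have [d d0 dP] := cc_unif gB e1.
  near=> s.
  have -> : Lint (fun y => g (scons t y)) - Lint (fun y => g (scons s y)) =
     Lint (fun y => g (scons t y) - g (scons s y)).
    rewrite -[X in _ - X]mul1r -mulNr -sc; last exact: cc_slice.
    rewrite -ad; [|exact: cc_slice|by apply: ccZ; exact: cc_slice].
    by congr Lint; apply/funext => y; rewrite mulN1r.
  apply: le_trans (bd _ (e / ((2 * B) ^+ m + 1)) _ _) _.
  - by apply: ccB; exact: cc_slice.
  - move=> y; apply/ltW/dP; rewrite sconsB subrr.
    apply: (@le_lt_trans _ _ `|t - s|).
      by rewrite scons_norm lexx normr0 normr_ge0.
    by near: s; exact: cvgr_dist_lt.
  - rewrite mulrAC ler_pdivrMr; last by rewrite ltr_wpDl// exprn_ge0// mulr_ge0.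
    by apply: ler_wpM2l; [exact: ltW|rewrite lerDl].
elim: n => [|n [bd ad sc sl]].
  have z g K : cc B g -> (forall x : 'rV[R]_0, `|g x| <= K) -> `|Lint g| <= K * (2 * B) ^+ 0.
    by move=> _ h; rewrite expr0 mulr1; exact: h.
  by split=> //; exact: slice.
have bd' (g : 'rV[R]_n.+1 -> R) K : cc B g -> (forall x, `|g x| <= K) ->
         `|Lint g| <= K * (2 * B) ^+ n.+1.
  move=> gB gK; rewrite LintS exprSr mulrA; apply: cc1_bound => //; first exact: sl.
  by move=> t; apply: bd; [exact: cc_slice|].
have ad' (f g : 'rV[R]_n.+1 -> R) : cc B f -> cc B g ->
    Lint (fun x => f x + g x) = Lint f + Lint g.
  move=> fB gB; rewrite !LintS -RintegralD//; last 2 first.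
  - exact: cc1_integrable (sl _ fB).
  - exact: cc1_integrable (sl _ gB).
  by apply: eq_Rintegral => t _; apply: ad; exact: cc_slice.
have sc' k (f : 'rV[R]_n.+1 -> R) : cc B f -> Lint (fun x => k * f x) = k * Lint f.
  move=> fB; rewrite !LintS -RintegralZl//; last exact: cc1_integrable (sl _ fB).
  by apply: eq_Rintegral => t _; apply: sc; exact: cc_slice.
by split => //; exact: slice.
Unshelve. all: by end_near. Qed.

End compactly_supported.

(** * Translation invariance and integrals of derivatives *)

Section Lint_theory.
Context {R : realType}.
Local Notation leb := (@lebesgue_measure R).

Lemma Lint_bound n B (g : 'rV[R]_n -> R) K : 0 <= B -> cc B g ->
  (forall x, `|g x| <= K) -> `|Lint g| <= K * (2 * B) ^+ n.
Proof. by move=> B0; have [h _ _ _] := Lint_linear n B0; exact: h. Qed.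

Lemma LintD n B (f g : 'rV[R]_n -> R) : 0 <= B -> cc B f -> cc B g ->
  Lint (fun x => f x + g x) = Lint f + Lint g.
Proof. by move=> B0; have [_ h _ _] := Lint_linear n B0; exact: h. Qed.

Lemma LintZ n B k (f : 'rV[R]_n -> R) : 0 <= B -> cc B f ->
  Lint (fun x => k * f x) = k * Lint f.
Proof. by move=> B0; have [_ _ h _] := Lint_linear n B0; exact: h. Qed.

Lemma LintB n B (f g : 'rV[R]_n -> R) : 0 <= B -> cc B f -> cc B g ->
  Lint (fun x => f x - g x) = Lint f - Lint g.
Proof.
move=> B0 fB gB; rewrite -[X in _ = _ - X]mul1r -mulNr -(LintZ _ B0 gB).
by rewrite -(LintD B0 fB (ccZ _ gB)); congr Lint; apply/funext => x; rewrite mulN1r.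
Qed.

Lemma cc_partial_integral n B (g : 'rV[R]_n.+1 -> R) : 0 <= B -> cc B g ->
  cc1 B (fun t => Lint (fun y => g (scons t y))).
Proof. by move=> B0; have [_ _ _ h] := Lint_linear n B0; exact: h. Qed.

Lemma lebesgue_int_Lint n B (g : 'rV[R]_n -> R) : 0 <= B -> cc B g ->
  lebesgue_int (fun x => (g x)%:E) = (Lint g)%:E.
Proof.
move=> B0; elim: n g => [//|n IH] g gB /=.
under eq_integral => t _ do rewrite (IH _ (cc_slice t gB)).
rewrite /Rintegral fineK//; apply: integrable_fin_num => //.
exact: cc1_integrable (cc_partial_integral B0 gB).
Qed.

Lemma Lint_ge0 n (g : 'rV[R]_n -> R) : (forall x, 0 <= g x) -> 0 <= Lint g.
Proof.
elim: n g => [g h|n IH g h]; first exact: h.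
by rewrite LintS; apply: Rintegral_ge0 => t _; apply: IH => y; exact: h.
Qed.

Lemma Lint_gt0 n B (g : 'rV[R]_n -> R) x0 : 0 <= B -> cc B g ->
  (forall x, 0 <= g x) -> 0 < g x0 -> 0 < Lint g.
Proof.
move=> B0; elim: n g x0 => [g x0 _ _|n IH g x0 gB g0 gx0].
  by rewrite (_ : x0 = 0)//; apply/rowP => -[].
rewrite LintS; have [t [y E]] := scons_split x0; subst x0.
apply: (cc1_gt0 (cc_partial_integral B0 gB) (t0 := t)).
  by move=> s; apply: Lint_ge0.
by apply: IH (cc_slice t gB) _ gx0.
Qed.

Lemma cc_shift n B (g : 'rV[R]_n -> R) v : cc B g -> cc (B + `|v|) (fun x => g (x + v)).
Proof.
move=> [gc g0]; split.
  move=> x; apply: continuous_comp; last exact: gc.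
  by apply: differentiable_continuous.
move=> x Bx; apply: g0; have := ler_normB (x + v) v; rewrite addrK; lra.
Qed.

Lemma scons_shift0 n t (y : 'rV[R]_n) h :
  scons t y + h *: delta_mx ord0 ord0 = scons (t + h) y.
Proof.
apply/rowP => i; rewrite [LHS]mxE [X in _ + X]mxE [X in _ * X]mxE.
case: (unliftP ord0 i) => [j ->|->]; first by rewrite !sconsS andbF mulr0 addr0.
by rewrite !scons0 !eqxx mulr1.
Qed.

Lemma scons_shiftS n t (y : 'rV[R]_n) h (k : 'I_n) :
  scons t y + h *: delta_mx ord0 (lift ord0 k) = scons t (y + h *: delta_mx ord0 k).
Proof.
apply/rowP => i; rewrite [LHS]mxE [X in _ + X]mxE [X in _ * X]mxE.
case: (unliftP ord0 i) => [j ->|->].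
  by rewrite !sconsS !mxE (inj_eq (@lift_inj _ ord0)).
by rewrite !scons0 andbF mulr0 addr0.
Qed.

Lemma Lint_shift n B (g : 'rV[R]_n -> R) i h : 0 <= B -> cc B g ->
  Lint (fun x => g (x + h *: delta_mx ord0 i)) = Lint g.
Proof.
move=> B0; elim: n g i => [g []//|n IH g i gB]; rewrite !LintS.
case: (unliftP ord0 i) => [k ->|->].
  apply: eq_Rintegral => t _.
  under [in LHS]eq_fun do rewrite scons_shiftS.
  by rewrite (IH (fun y => g (scons t y)))//; exact: cc_slice.
rewrite -[RHS](cc1_integral_shift h (cc_partial_integral B0 gB)).
apply: eq_Rintegral => t _; congr Lint; apply/funext => y.
by rewrite scons_shift0.
Qed.

Lemma cc_partial n B (g : 'rV[R]_n -> R) i : C1 setT g -> cc B g -> cc B (partial i g).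
Proof.
move=> gC [gc g0]; split; first by move=> x; exact: C1_partial_continuous i gC _.
move=> x Bx; rewrite (partial_near (g := cst 0)) ?/partial ?derive_cst//.
have : \forall y \near x, B < `|y|.
  have nx : `|y| @[y --> x] --> `|x| by exact: norm_continuous.
  by apply: (cvgr_gt `|x| nx).
by apply: filterS => y /g0.
Qed.

(** The difference quotients of g have integral 0 by translation invariance, and
    they converge uniformly, with supports in a fixed ball, to the derivative. *)
Lemma Lint_partial n B (g : 'rV[R]_n -> R) i : 0 <= B -> C1 setT g -> cc B g ->
  Lint (partial i g) = 0.
Proof.
move=> B0 gC gB; have pB := cc_partial i gC gB.
apply/eqP; rewrite -normr_le0; apply/ler_addgt0Pl => e e0; rewrite addr0.
pose V := (2 * (B + 1)) ^+ n.
have B10 : 0 <= B + 1 by rewrite addr_ge0.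
have V0 : 0 <= V by rewrite exprn_ge0// mulr_ge0.
have e1 : 0 < e / (V + 1) by rewrite divr_gt0// ltr_wpDl.
have [d d0 dP] := cc_unif pB e1.
(* h <= 1 keeps the supports of the quotients in the ball of radius B + 1 *)
pose h := Num.min (d / 2) 1.
have h0 : 0 < h by rewrite lt_min divr_gt0/=.
have hd : h < d by rewrite gt_min; apply/orP; left; lra.
have h1 : h <= 1 by rewrite ge_min lexx orbT.
pose v : 'rV[R]_n := h *: delta_mx ord0 i.
pose q x := h^-1 * (g (x + v) - g x).
have vB : `|v| <= 1.
  by rewrite (le_trans (delta_norm_le _ _))// ger0_norm// ltW.
have g1 : cc (B + 1) g by apply: cc_mono gB; rewrite lerDl.
have gs1 : cc (B + 1) (fun x => g (x + v)) by apply: cc_mono (cc_shift v gB); rewrite lerD2l.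
have p1 : cc (B + 1) (partial i g) by apply: cc_mono pB; rewrite lerDl.
have q1 : cc (B + 1) q by apply: ccZ; exact: ccB.
have q0 : Lint q = 0.
  rewrite (LintZ _ B10 (ccB gs1 g1)) (LintB B10 gs1 g1).
  by rewrite (Lint_shift _ _ B0 gB) subrr mulr0.
rewrite -[Lint _]subr0 -q0 -(LintB B10 p1 q1).
apply: le_trans (Lint_bound B10 (ccB p1 q1) (K := e / (V + 1)) _) _.
  move=> x; have [t _|c /andP[c0 ch] gE] := @MVT_line _ _ g i x h h0.
    exact: C1_differentiable gC _.
  rewrite /q /v gE mulKf ?gt_eqF//; apply/ltW/dP.
  rewrite opprD addNKr normrN (le_lt_trans (delta_norm_le _ _))// ger0_norm//.
  exact: le_lt_trans ch hd.
rewrite mulrAC ler_pdivrMr; last by rewrite ltr_wpDl.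
by apply: ler_wpM2l; [exact: ltW|rewrite lerDl].
Qed.

End Lint_theory.

(** * The area measure in one chart *)

Section borel.
Context {R : realType} {M : ptopologicalType}.

Lemma continuous_borel_measurable (G : M -> R) : continuous G ->
  measurable_fun [set: borel M] (G : borel M -> R).
Proof.
move=> Gc; apply: (measurability _ (RGenOpens.measurableE R)).
move=> _ [_ [a [b ->] <-]]; rewrite setTI; apply: sub_sigma_algebra.
by move/continuousP : Gc; apply; exact: interval_open.
Qed.

Lemma compact_cinv_closed n (c : chart R M n) (K : set 'rV[R]_n) :
  hausdorff_space M -> compact K -> K `<=` ccod c -> closed (cinv c @` K).
Proof.
move=> hM cK Kc; apply: compact_closed => //; apply: continuous_compact => //.
by apply: continuous_in_subspaceT => x /[1!inE] /Kc; exact: cinv_continuous.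
Qed.

End borel.

Section chart_integral.
Context {R : realType} {n : nat} {M : ptopologicalType}.
Variables (S : smooth_structure R M n) (phi : M -> 'rV[R]_n.+2).
Variable mu : {measure set (borel M) -> \bar R}.
Hypothesis mu_area : area_measure S phi mu.
Variable c : chart R M n.
Hypothesis cS : atlas S c.
Hypothesis wc : forall x, ccod c x -> {for x, continuous (area_density phi c)}.
Variable K : set 'rV[R]_n.
Hypothesis cK : compact K.
Hypothesis Kc : K `<=` ccod c.

Definition supp_in (G : M -> R) := forall p, G p != 0 -> (cinv c @` K) p.

(** The function on R^n whose Lebesgue integral is the integral of G for the area
    measure, provided that G vanishes outside the chart. *)
Definition ext (G : M -> R) : 'rV[R]_n -> R :=
  (fun x => G (cinv c x) * area_density phi c x) \_ (ccod c).

Let clK : closed K.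
Proof. by apply: compact_closed => //; exact: norm_hausdorff. Qed.

Lemma supp_offK (G : M -> R) x : supp_in G -> ccod c x -> ~ K x -> G (cinv c x) = 0.
Proof.
move=> GK cx Kx; apply/eqP/negP => /negP /GK [y Ky yx]; apply: Kx.
by rewrite -(cinvK cx) -yx cinvK//; exact: Kc.
Qed.

Lemma ext_offK (G : M -> R) x : supp_in G -> ~ K x -> ext G x = 0.
Proof.
move=> GK Kx; rewrite /ext patchE; case: ifPn => // /[1!inE] cx.
by rewrite (supp_offK GK cx Kx) mul0r.
Qed.

Lemma K_bounded : exists2 B : R, 0 <= B & forall x, K x -> `|x| <= B.
Proof.
have [B [Br BK]] := compact_bounded cK.
exists (`|B| + 1); first by rewrite addr_ge0.
by move=> x Kx; apply: BK => //; rewrite (le_lt_trans (ler_norm _))// ltrDl.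
Qed.

Lemma ext_cc (G : M -> R) : supp_in G ->
  (forall x, ccod c x -> {for x, continuous (G \o cinv c)}) ->
  exists2 B : R, 0 <= B & cc B (ext G).
Proof.
move=> GK Gc; have [B B0 BK] := K_bounded; exists B => //; split; last first.
  move=> x Bx; apply: ext_offK => // /BK; by rewrite leNgt Bx.
move=> x; have [cx|cx] := pselect (ccod c x).
  apply: (near_continuous (f := fun x => G (cinv c x) * area_density phi c x)).
    apply: (open_near (@open_ccod _ _ _ c) cx) => y cy.
    by rewrite /ext patchE ifT// inE.
  by apply: contM; [exact: Gc|exact: wc].
apply: (near_continuous (f := fun=> 0)); last by apply: cst_continuous.
have nK : ~ K x by move=> /Kc.
apply: (open_near (U := ~` K)) => //; first exact: closed_openC.
by move=> y Ky; rewrite ext_offK.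
Qed.

Lemma ge0_int_chart (G : M -> R) : continuous G -> supp_in G -> (forall p, 0 <= G p) ->
  (\int[mu]_(p in [set: borel M]) (G p)%:E = (Lint (ext G))%:E)%E.
Proof.
move=> Gc GK G0.
have Gcc x : ccod c x -> {for x, continuous (G \o cinv c)}.
  by move=> cx; apply: continuous_comp; [exact: cinv_continuous|exact: Gc].
have [B B0 GB] := ext_cc GK Gcc.
have := @mu_area c cS (fun p => (G p)%:E).
rewrite integral_mkcond => H.
transitivity (\int[mu]_x ((fun p : borel M => (G p)%:E) \_ (cdom c)) x)%E.
  apply: eq_integral => p _; rewrite patchE; case: ifPn => // /negP.
  rewrite inE => cp; congr (_%:E); apply/eqP/negP => /negP /GK [x Kx xp].
  by apply: cp; rewrite -xp; apply: cinv_dom; exact: Kc.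
rewrite {}H.
- rewrite -(lebesgue_int_Lint B0 GB); congr lebesgue_int; apply/funext => x.
  by rewrite /ext !patchE; case: ifP.
- by apply/measurable_EFinP; exact: continuous_borel_measurable.
- by move=> p; rewrite lee_fin.
Qed.

Lemma ge0_integrable_chart (G : M -> R) : continuous G -> supp_in G ->
  (forall p, 0 <= G p) -> mu.-integrable [set: borel M] (fun p => (G p)%:E).
Proof.
move=> Gc GK G0; apply/integrableP; split.
  by apply/measurable_EFinP; exact: continuous_borel_measurable.
under eq_integral => p _ do rewrite gee0_abs ?lee_fin//.
by rewrite ge0_int_chart// ltry.
Qed.

(** The area measure is prescribed on nonnegative functions; the signed case
    follows by splitting G into its positive and negative parts. *)
Lemma int_chart (G : M -> R) : continuous G -> supp_in G ->
  mu.-integrable [set: borel M] (fun p => (G p)%:E) /\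
  \int[mu]_(p in [set: borel M]) G p = Lint (ext G).
Proof.
move=> Gc GK.
pose P p := Num.max (G p) 0; pose Q p := Num.max (- G p) 0.
have GPQ p : G p = P p - Q p.
  rewrite /P /Q; case: (lerP (G p) 0) => ft.
    by rewrite sub0r max_l ?opprK// oppr_ge0.
  by rewrite max_r ?subr0// oppr_le0 ltW.
have Pc : continuous P.
  by move=> x; apply: continuous_max; [exact: Gc|apply: cst_continuous].
have Qc : continuous Q.
  move=> x; apply: (@continuous_max _ _ (fun p => - G p) (fun=> 0) x).
    by apply: contN; exact: Gc.
  by apply: cst_continuous.
have PK : supp_in P.
  by move=> p h; apply: GK; apply: contra h => /eqP; rewrite /P => ->; rewrite maxxx.
have QK : supp_in Q.
  by move=> p h; apply: GK; apply: contra h => /eqP; rewrite /Q => ->; rewrite oppr0 maxxx.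
have P0 p : 0 <= P p by rewrite le_max lexx orbT.
have Q0 p : 0 <= Q p by rewrite le_max lexx orbT.
have Pi := ge0_integrable_chart Pc PK P0.
have Qi := ge0_integrable_chart Qc QK Q0.
have E : G = fun p => P p - Q p by apply/funext => p; exact: GPQ.
split.
  rewrite E; under eq_fun do rewrite EFinB.
  exact: integrableB.
rewrite {1}E RintegralB//.
rewrite {1}/Rintegral ge0_int_chart// {1}/Rintegral ge0_int_chart//=.
have cc1 (F : M -> R) : continuous F -> supp_in F -> exists2 B, 0 <= B & cc B (ext F).
  move=> Fc FK; apply: ext_cc => // x cx.
  by apply: continuous_comp; [exact: cinv_continuous|exact: Fc].
have [B B0 BP] := cc1 _ Pc PK; have [B' B'0 BQ] := cc1 _ Qc QK.
have BB : B <= Num.max B B' by rewrite le_max lexx.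
have BB' : B' <= Num.max B B' by rewrite le_max lexx orbT.
rewrite -(LintB (le_trans B0 BB) (cc_mono BB BP) (cc_mono BB' BQ)).
congr Lint; apply/funext => x; rewrite /ext !patchE; case: ifP => _; last by rewrite subrr.
by rewrite [in RHS]E mulrBl.
Qed.

End chart_integral.

(** * Cut-off functions *)

Section cutoff.
Context {R : realType}.

(** Squaring removes the corner of the positive part, so that this function is C1
    and can serve as a cut-off profile. *)
Definition possq (t : R) : R := Num.max t 0 ^+ 2.

(** One quadratic estimate valid for all t and h gives the derivative everywhere,
    the corner t = 0 included. *)
Lemma possq_taylor (t h : R) :
  `|possq (h + t) - possq t - h * (2 * Num.max t 0)| <= h ^+ 2.
Proof.
rewrite /possq ler_norml; case: (lerP t 0) => t0; case: (lerP (h + t) 0) => ht;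
  apply/andP; split; nra.
Qed.

Lemma is_derive_possq (t : R) : is_derive t 1 possq (2 * Num.max t 0).
Proof.
suff H : (fun h => h^-1 *: ((possq \o shift t) (h *: 1) - possq t)) @ 0^'
    --> (2 * Num.max t 0 : R).
  apply: DeriveDef; first by apply/cvg_ex; exists (2 * Num.max t 0 : R).
  exact: cvg_lim H.
apply/cvgrPdist_le => /= e e0; near=> h.
have h0 : h != 0 by near: h; exact: nbhs_dnbhs_neq.
have he : `|h| <= e.
  by near: h; apply: dnbhs0_le.
rewrite [h *: 1]mulr1 /GRing.scale/= distrC.
rewrite -(ler_pM2l (_ : 0 < `|h|)) ?normr_gt0// -normrM mulrBr mulVKf//.
apply: le_trans (possq_taylor t h) _.
by rewrite -real_normK ?num_real// expr2 ler_wpM2l.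
Unshelve. all: by end_near. Qed.

Lemma possq_derivable t : derivable possq t 1.
Proof. by have [] := is_derive_possq t. Qed.

Lemma possq_derive_continuous : continuous (possq^`())%classic.
Proof.
rewrite (_ : (_^`())%classic = fun t => 2 * Num.max t 0); last first.
  by apply/funext => t; rewrite derive1E; have [_ ->] := is_derive_possq t.
move=> t; apply: (@contM _ R (fun=> 2) (fun s => Num.max s 0) t); first exact: cont_cst.
by apply: (@continuous_max _ R id (fun=> 0) t); [exact: cvg_id|apply: cst_continuous].
Qed.

Definition bump0 n (a : 'rV[R]_n) (r : R) (x : 'rV[R]_n) : R :=
  possq (r ^+ 2 - \sum_i (x ord0 i - a ord0 i) ^+ 2).

Lemma bump0_ge0 n (a : 'rV[R]_n) r x : 0 <= bump0 a r x.
Proof. exact: sqr_ge0. Qed.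

Lemma bump0_center n (a : 'rV[R]_n) r : 0 < r -> 0 < bump0 a r a.
Proof.
move=> r0; rewrite /bump0 big1 => [|i _]; last by rewrite subrr expr0n.
by rewrite subr0 /possq exprn_gt0// lt_max exprn_gt0.
Qed.

Lemma bump0_supp n (a : 'rV[R]_n) r x : 0 < r -> bump0 a r x != 0 -> `|x - a| <= r.
Proof.
move=> r0; apply: contraNT; rewrite -ltNge => xa.
have : exists i, r < `|x ord0 i - a ord0 i|.
  apply/existsP; rewrite -[X in is_true X]negbK negb_exists; apply/negP => /forallP h.
  move: xa; rewrite ltNge norm_le_coord ?ltW// => i; have := h i.
  by rewrite /= -leNgt !mxE.
move=> [i ri]; rewrite /bump0 /possq max_r ?expr0n// subr_le0.
rewrite (bigD1 i)//=; apply: ler_wpDr; first by apply: sumr_ge0 => j _; exact: sqr_ge0.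
by rewrite -[leRHS]real_normK ?num_real// lerXn2r ?nnegrE// ltW.
Qed.

Lemma bump0_C1 n (a : 'rV[R]_n) r : C1 setT (bump0 a r).
Proof.
have oT := @openT 'rV[R]_n.
apply: (C1_comp1 (q := possq) oT).
  apply: (C1B oT (C1_cst _ oT)); apply: (C1_sum _ _ oT) => i.
  have h := C1B oT (C1_coord i oT) (C1_cst (a ord0 i) oT).
  by have := C1M oT h h; apply: C1_eq => // x _; rewrite expr2.
move=> x _; split; first exact: possq_derivable.
exact: possq_derive_continuous.
Qed.

End cutoff.

(** * Partitions of unity *)

Section mC1.
Context {R : realType} {n : nat} {M : ptopologicalType}.
Variable S : smooth_structure R M n.
Implicit Types (f g : M -> R) (c : chart R M n).

Definition mC1 f := forall c, atlas S c -> C1 (ccod c) (f \o cinv c).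

Lemma smooth_map_mC1 f : smooth_map S f -> mC1 f.
Proof. by move=> fS c cS; exact: smooth_on_C1 (fS c cS). Qed.

Lemma mC1_cst (a : R) : mC1 (fun=> a).
Proof. by move=> c _; exact: C1_cst (@open_ccod _ _ _ c). Qed.

Lemma mC1D f g : mC1 f -> mC1 g -> mC1 (fun p => f p + g p).
Proof. by move=> fC gC c cS; exact: C1D (@open_ccod _ _ _ c) (fC c cS) (gC c cS). Qed.

Lemma mC1M f g : mC1 f -> mC1 g -> mC1 (fun p => f p * g p).
Proof. by move=> fC gC c cS; exact: C1M (@open_ccod _ _ _ c) (fC c cS) (gC c cS). Qed.

Lemma mC1N f : mC1 f -> mC1 (fun p => - f p).
Proof. by move=> fC c cS; exact: C1N (@open_ccod _ _ _ c) (fC c cS). Qed.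

Lemma mC1V f : mC1 f -> (forall p, f p != 0) -> mC1 (fun p => (f p)^-1).
Proof. by move=> fC f0 c cS; exact: C1V (@open_ccod _ _ _ c) (fC c cS) (fun x _ => f0 _). Qed.

Lemma mC1_sum (I : Type) (s : seq I) (F : I -> M -> R) :
  (forall i, mC1 (F i)) -> mC1 (fun p => \sum_(i <- s) F i p).
Proof. by move=> FC c cS; apply: (C1_sum _ _ (@open_ccod _ _ _ c)) => i; exact: FC. Qed.

Lemma cdom_near c p (P : M -> Prop) : cdom c p ->
  (forall q, cdom c q -> P q) -> \forall q \near p, P q.
Proof.
move=> cp h; apply: filterS h _; apply: open_nbhs_nbhs; split=> //.
exact: open_cdom.
Qed.

Lemma continuous_in_chart (W : topologicalType) (F : M -> W) c p : cdom c p ->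
  {for cmap c p, continuous (F \o cinv c)} -> {for p, continuous F}.
Proof.
move=> cp Fc; apply: (near_continuous (f := (F \o cinv c) \o cmap c)).
  by apply: (cdom_near cp) => q cq /=; rewrite cmapK.
by apply: continuous_comp => //; exact: cmap_continuous.
Qed.

Lemma mC1_continuous f : mC1 f -> continuous f.
Proof.
move=> fC p; have cp := cdom_chart_at S p.
apply: (continuous_in_chart cp).
exact: C1_continuous (fC _ (atlas_chart_at S p)) (cmap_cod cp).
Qed.

Lemma preimage_near c x (A : set M) : ccod c x -> open A -> A (cinv c x) ->
  \forall y \near x, A (cinv c y).
Proof.
move=> cx oA Ax; have := cinv_continuous cx; apply.
by apply: open_nbhs_nbhs.
Qed.

Lemma overlap_open c c' : open (overlap c c').
Proof.
rewrite openE => x [cx cx']; apply: filterI.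
  by apply: open_nbhs_nbhs; split=> //; exact: open_ccod.
by apply: preimage_near => //; exact: open_cdom.
Qed.

Lemma transition_cod c c' x : overlap c c' x -> ccod c' (transition c c' x).
Proof. by move=> [cx cx']; exact: cmap_cod. Qed.

Lemma transition_inv c c' x : overlap c c' x ->
  cinv c' (transition c c' x) = cinv c x.
Proof. by move=> [cx cx']; rewrite /transition cmapK. Qed.

Hypothesis hM : hausdorff_space M.

Section bump.
Variables (c : chart R M n) (a : 'rV[R]_n) (r : R).
Hypothesis cS : atlas S c.
Hypothesis r0 : 0 < r.

Definition kball := [set x : 'rV[R]_n | `|x - a| <= r].

Hypothesis Kc : kball `<=` ccod c.

Definition bump (p : M) : R := if p \in cdom c then bump0 a r (cmap c p) else 0.

Lemma kball_compact : compact kball.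
Proof.
apply: bounded_closed_compact.
  exists (`|a| + r); split => [|B aB]; first exact: num_real.
  move=> x /= xa; rewrite -(subrK a x) (le_trans (ler_normD _ _))//.
  by rewrite addrC ltW// (le_lt_trans _ aB)// lerD2l.
rewrite (_ : kball = (fun x : 'rV[R]_n => `|x - a|) @^-1` [set s | s <= r]) //.
apply: preimage_closed; last exact: closed_le.
move=> x _; apply: continuous_comp; last exact: norm_continuous.
by apply: differentiable_continuous.
Qed.

Lemma bump_ge0 p : 0 <= bump p.
Proof. by rewrite /bump; case: ifP => // _; exact: bump0_ge0. Qed.

Lemma bump_supp : supp_in c kball bump.
Proof.
move=> p; rewrite /bump; case: ifPn => [/[1!inE] cp h|]; last by rewrite eqxx.
exists (cmap c p); last exact: cmapK.
exact: bump0_supp h.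
Qed.

Lemma bump_center p : cdom c p -> cmap c p = a -> 0 < bump p.
Proof. by move=> cp pa; rewrite /bump mem_set// pa; exact: bump0_center. Qed.

(** In another chart the bump is, on the overlap, the composition of bump0 with a
    transition map; at a point outside the overlap it vanishes nearby, because the
    image of the closed ball is compact, hence closed in the Hausdorff space M. *)
Lemma bump_mC1 : mC1 bump.
Proof.
move=> c' c'S x cx; have [cx'|ncx] := pselect (cdom c (cinv c' x)).
  have O : C1 (overlap c' c) (bump \o cinv c').
    have E y : overlap c' c y -> bump0 a r (transition c' c y) = (bump \o cinv c') y.
      by move=> [_ cy]; rewrite /= /bump mem_set.
    apply: (C1_eq (@overlap_open c' c) E).
    by apply: (C1_comp (@overlap_open c' c) (atlas_compat c'S cS)) (bump0_C1 a r).
  by apply: O.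
have clK : closed (cinv c @` kball) by apply: compact_cinv_closed => //; exact: kball_compact.
pose V := ccod c' `&` [set y | ~ (cinv c @` kball) (cinv c' y)].
have oV : open V.
  rewrite openE => y [cy Ky]; apply: filterI.
    by apply: open_nbhs_nbhs; split=> //; exact: open_ccod.
  by apply: (preimage_near cy (A := ~` (cinv c @` kball))) => //; exact: closed_openC.
have O : C1 V (bump \o cinv c').
  apply: (C1_eq oV _ (C1_cst 0 oV)) => y [_ Ky] /=.
  by apply/eqP; rewrite eq_sym; apply/negP => /negP /bump_supp.
apply: O; split => //= -[y Ky yx]; apply: ncx; rewrite -yx; apply: cinv_dom.
exact: Kc.
Qed.

End bump.

Lemma exists_radius c x : ccod c x ->
  exists2 r : R, 0 < r & kball x r `<=` ccod c.
Proof.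
move=> cx.
have /nbhs_ballP[e /= e0 eP] : nbhs x (ccod c).
  by apply: open_nbhs_nbhs; split=> //; exact: open_ccod.
exists (e / 2); first by rewrite divr_gt0.
move=> y /= yx; apply: eP; rewrite -ball_normE/= distrC (le_lt_trans yx)//.
by rewrite ltr_pdivrMr// ltr_pMr// ltrDl.
Qed.

Hypothesis cM : compact [set: M].

(** By compactness finitely many bumps are positive somewhere at every point;
    dividing them by their sum gives the partition. *)
Lemma partition_of_unity : exists (s : seq M) (chi : M -> M -> R) (K : M -> set 'rV[R]_n),
  (forall p, [/\ mC1 (chi p), compact (K p), K p `<=` ccod (chart_at S p) &
                 supp_in (chart_at S p) (K p) (chi p)]) /\
  forall q, \sum_(p <- s) chi p q = 1.
Proof.
have H p : {r : R | 0 < r & kball (cmap (chart_at S p) p) r `<=` ccod (chart_at S p)}.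
  by apply: cid2; apply: exists_radius; apply: cmap_cod; exact: cdom_chart_at.
pose r p := s2val (H p).
have r0 p : 0 < r p := s2valP (H p).
pose K p := kball (cmap (chart_at S p) p) (r p).
have Kc p : K p `<=` ccod (chart_at S p) := s2valP' (H p).
pose b p := bump (chart_at S p) (cmap (chart_at S p) p) (r p).
have bC p : mC1 (b p) by apply: bump_mC1; [exact: atlas_chart_at|exact: r0|exact: Kc].
have [D _ DP] : finite_subset_cover [set: M] (fun p => [set q | 0 < b p q]) [set: M].
  move: cM; rewrite compact_cover; apply => [p _|p _].
    rewrite (_ : [set q | 0 < b p q] = b p @^-1` [set s | 0 < s]) //.
    by apply: open_comp; [move=> x _; exact: mC1_continuous|exact: open_gt].
  by exists p => //=; apply: bump_center => //; exact: cdom_chart_at.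
pose h q := \sum_(p <- finmap.enum_fset D) b p q.
have h0 q : 0 < h q.
  have [p /= pD bq] := DP q I.
  have b0 i : 0 <= b i q by exact: bump_ge0.
  rewrite /h lt_neqAle; apply/andP; split; last by apply: sumr_ge0 => i _.
  rewrite eq_sym psumr_eq0//; apply/allPn; exists p => //=.
  by rewrite gt_eqF.
have hC : mC1 h by exact: mC1_sum.
exists (finmap.enum_fset D), (fun p q => b p q * (h q)^-1), K; split.
  move=> p; split.
  - by apply: mC1M => //; apply: mC1V => // q; rewrite gt_eqF.
  - exact: kball_compact.
  - exact: Kc.
  - move=> q; rewrite mulf_eq0 negb_or => /andP[bq _].
    exact: (bump_supp (r0 p) bq).
by move=> q; rewrite -mulr_suml -/(h q) divff// gt_eqF.
Qed.

End mC1.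

(** * Change of chart *)

Lemma invmx_congr (R : comUnitRingType) n (J G : 'M[R]_n) :
  J \in unitmx -> G \in unitmx ->
  invmx (J *m G *m J^T) = (invmx J)^T *m invmx G *m invmx J.
Proof.
move=> Ju Gu; have JTu : J^T \in unitmx by rewrite unitmx_tr.
have JGu : J *m G *m J^T \in unitmx by rewrite !unitmx_mul Ju Gu JTu.
apply: (can_inj (mulKmx JGu)); rewrite mulmxV// trmx_inv !mulmxA.
by rewrite (mulmxK JTu) (mulmxK Gu) (mulmxV Ju).
Qed.

Lemma pair_congr (R : comUnitRingType) n (J I I' : 'M[R]_n) (u u' v v' : 'rV[R]_n) :
  J \in unitmx ->
  I = (invmx J)^T *m I' *m invmx J -> u = u' *m J^T -> v = v' *m J^T ->
  u *m I *m v^T = u' *m I' *m v'^T.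
Proof.
move=> Ju -> -> ->; have JTu : J^T \in unitmx by rewrite unitmx_tr.
by rewrite trmx_mul trmxK trmx_inv !mulmxA (mulmxK JTu) (mulmxKV Ju).
Qed.

Lemma shape_congr (R : comUnitRingType) n m (J I I' A A' : 'M[R]_n) (D D' E E' : 'M[R]_(n, m)) :
  J \in unitmx ->
  A = - (E *m D^T *m I) -> A' = - (E' *m D'^T *m I') ->
  D = J *m D' -> E = J *m E' -> I = (invmx J)^T *m I' *m invmx J ->
  A = J *m A' *m invmx J.
Proof.
move=> Ju -> -> -> -> ->; have JTu : J^T \in unitmx by rewrite unitmx_tr.
rewrite mulmxN mulNmx trmx_mul trmx_inv !mulmxA; congr (- _).
by rewrite (mulmxK JTu).
Qed.

Lemma trace_conj (R : comUnitRingType) n (J A A' : 'M[R]_n) :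
  J \in unitmx -> A = J *m A' *m invmx J ->
  \tr A = \tr A' /\ \tr (A *m A) = \tr (A' *m A').
Proof.
move=> Ju ->; split; first by rewrite mxtrace_mulC mulmxA mulVmx// mul1mx.
by rewrite !mulmxA mulmxKV// mxtrace_mulC !mulmxA mulVmx// mul1mx.
Qed.

Section patch_divergence.
Context {R : realType} {n : nat}.
Variables (U : set 'rV[R]_n) (X N : 'rV[R]_n -> 'rV[R]_n.+2).
Variables D E : 'rV[R]_n -> 'M[R]_(n, n.+2).
Hypothesis patchP : is_patch U X N D E.
Let oU := patch_open patchP.
Let w y := Num.sqrt (\det (D y *m (D y)^T)).
Let Gi y := invmx (D y *m (D y)^T).

Lemma patch_height_grad (F : 'rV[R]_n -> 'rV[R]_n.+2) (J : 'rV[R]_n -> 'M[R]_(n, n.+2))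
    (v : 'rV[R]_n.+2) z : smooth_on U F -> is_jac U F J -> U z ->
  \row_k partial k (fun t => dotv (F t) v) z = v *m (J z)^T.
Proof.
move=> FS FJ Uz; apply/rowP => k; rewrite !mxE.
under [in LHS]eq_fun do rewrite dotvE.
rewrite partial_sum => [|a]; last first.
  apply: differentiableM; last exact: differentiable_cst.
  exact: (C1mx_diff (C1mx_smooth oU FS) Uz).
apply: eq_bigr => a _; rewrite partialM; last exact: differentiable_cst.
  by rewrite {1}/partial derive_cst mulr0 add0r; congr (_ * _); rewrite mxE FJ.
exact: (C1mx_diff (C1mx_smooth oU FS) Uz).
Qed.

(** By the shape of grad, the height of F along v has weighted gradient
    w G^-1 J v^T; the vector v is constant and comes out of the divergence. *)
Lemma patch_laplacian (F : 'rV[R]_n -> 'rV[R]_n.+2) (J : 'rV[R]_n -> 'M[R]_(n, n.+2))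
    (v : 'rV[R]_n.+2) y : smooth_on U F -> is_jac U F J -> U y ->
  (w y)^-1 * \sum_i partial i (fun z => w z *
     ((\row_k partial k (fun t => dotv (F t) v) z) *m Gi z) ord0 i) y =
  (w y)^-1 * dotv (dv (fun z => w z *: (Gi z *m J z)) y) v.
Proof.
move=> FS FJ Uy; congr (_ * _).
have GiT z : (Gi z)^T = Gi z by rewrite trmx_inv trmx_mul trmxK.
have Q1 : C1mx U (fun z => w z *: (Gi z *m J z)).
  apply: (C1mxZ oU (patch_density_C1 patchP)).
  exact: (C1mxM oU (patch_invmetric_C1 patchP) (C1mx_jac oU FS FJ)).
rewrite dotvE.
transitivity (\sum_a \sum_i partial i (fun z => (w z *: (Gi z *m J z)) i a) y * v ord0 a);
  last by apply: eq_bigr => a _; rewrite mxE mulr_suml.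
rewrite exchange_big/=; apply: eq_bigr => i _.
have dQ a : differentiable (fun z => (w z *: (Gi z *m J z)) i a * v ord0 a) y.
  by apply: differentiableM; [exact: C1_differentiable (Q1 i a) Uy|exact: differentiable_cst].
transitivity (partial i (fun z => \sum_a (w z *: (Gi z *m J z)) i a * v ord0 a) y).
  apply: (partial_eq_on i oU Uy) => z Uz.
  rewrite (patch_height_grad v FS FJ Uz).
  rewrite -[Gi z]GiT -mulmxA -trmx_mul mxE mulr_sumr; apply: eq_bigr => a _.
  by rewrite mxE [in RHS]mxE GiT mulrCA mulrC.
rewrite partial_sum//; apply: eq_bigr => a _.
rewrite partialM; [|exact: C1_differentiable (Q1 i a) Uy|exact: differentiable_cst].
by rewrite {1}/partial derive_cst mulr0 add0r mulrC.
Qed.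

End patch_divergence.

Section immersed.
Context {R : realType} {n : nat} {M : ptopologicalType}.
Variables (S : smooth_structure R M n) (phi N : M -> 'rV[R]_n.+2).
Hypothesis phi_imm : sphere_immersion S phi.
Hypothesis N_normal : unit_normal S phi N.

Lemma chart_patch c : atlas S c -> is_patch (ccod c) (phi \o cinv c) (N \o cinv c)
  (chart_diff phi c) (chart_diff N c).
Proof.
move=> cS; have [phiS phi1 phif] := phi_imm; have [NS N1 Nphi NT] := N_normal.
split.
- exact: open_ccod.
- exact: phiS.
- exact: NS.
- exact: is_jac_jacobian (phiS c cS).
- exact: is_jac_jacobian (NS c cS).
- exact: phif.
- by move=> y _; rewrite [LHS]mx11_scalar -[X in X%:M]/(dotv _ _) phi1.
- by move=> y _; rewrite [LHS]mx11_scalar -[X in X%:M]/(dotv _ _) N1.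
- by move=> y _; rewrite [LHS]mx11_scalar -[X in X%:M]/(dotv _ _) Nphi raddf0.
- exact: NT.
Qed.

Section transition.
Variables c c' : chart R M n.
Hypotheses (cS : atlas S c) (c'S : atlas S c').
Variable x : 'rV[R]_n.
Hypothesis cx : overlap c c' x.
Let T := transition c c'.
Let J : 'M[R]_n := \matrix_(i, j) partial i (fun y => T y ord0 j) x.

Lemma partial_transition (f : M -> R) i : differentiable (f \o cinv c') (T x) ->
  partial i (f \o cinv c) x = \sum_j J i j * partial j (f \o cinv c') (T x).
Proof.
move=> df.
have -> : partial i (f \o cinv c) x = partial i (fun y => (f \o cinv c') (T y)) x.
  apply: (partial_eq_on i (@overlap_open _ _ _ c c') cx) => y cy.
  by rewrite /= transition_inv.
rewrite (partial_comp i (atlas_compat cS c'S [::] cx) df).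
by apply: eq_bigr => j _; rewrite mxE.
Qed.

Lemma chart_diff_transition (F : M -> 'rV[R]_n.+2) : smooth_map S F ->
  chart_diff F c x = J *m chart_diff F c' (T x).
Proof.
move=> FS; have [cx1 cx2] := cx; have cT : ccod c' (T x) := transition_cod cx.
apply/matrixP => i a; rewrite (is_jac_jacobian (FS c cS) i a cx1) [RHS]mxE.
have D : differentiable ((fun p => F p ord0 a) \o cinv c') (T x).
  exact: C1_differentiable (smooth_on_C1
    (smooth_on_coord a (@open_ccod _ _ _ c') (FS c' c'S))) cT.
rewrite (partial_transition i D); apply: eq_bigr => j _.
by rewrite -(is_jac_jacobian (FS c' c'S) j a cT).
Qed.

(** Injectivity of the differential of the immersion forces the Jacobian of the
    transition map to be injective. *)
Lemma transition_unit : J \in unitmx.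
Proof.
have [phiS _ phif] := phi_imm; have [cx1 _] := cx.
rewrite -row_free_unit -kermx_eq0.
rewrite -(mulmx_free_eq0 (kermx J) (phif c cS x cx1)).
by rewrite (chart_diff_transition phiS) mulmxA mulmx_ker mul0mx.
Qed.

Lemma metric_transition : metric phi c x = J *m metric phi c' (T x) *m J^T.
Proof.
have [phiS _ phif] := phi_imm.
by rewrite /metric (chart_diff_transition phiS) trmx_mul !mulmxA.
Qed.

Lemma invmetric_transition :
  invmx (metric phi c x) = (invmx J)^T *m invmx (metric phi c' (T x)) *m invmx J.
Proof.
have Ju := transition_unit.
have G'u : metric phi c' (T x) \in unitmx.
  exact (patch_metric_unit (chart_patch c'S) (transition_cod cx)).
by rewrite metric_transition (invmx_congr Ju G'u).
Qed.

(** The matrices of the shape operator in two charts are conjugate; hence the mean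
    curvature and |A|^2, evaluated by at_point in a preferred chart, can be
    computed in any chart. *)
Lemma shape_transition :
  shape phi N c x = J *m shape phi N c' (T x) *m invmx J.
Proof.
have [phiS _ _] := phi_imm; have [NS _ _ _] := N_normal; have [cx1 _] := cx.
have sE d z : atlas S d -> ccod d z -> shape phi N d z =
   - (chart_diff N d z *m (chart_diff phi d z)^T *m invmx (metric phi d z)).
  by move=> dS dz; exact (shape_patch (chart_patch dS) dz).
exact (shape_congr transition_unit (sE _ _ cS cx1) (sE _ _ c'S (transition_cod cx))
  (chart_diff_transition phiS) (chart_diff_transition NS) invmetric_transition).
Qed.

End transition.

Lemma overlap_chart_at c x : ccod c x -> overlap c (chart_at S (cinv c x)) x.
Proof. by move=> cx; split=> //; exact: cdom_chart_at. Qed.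

Lemma trace_shape_chart c x : atlas S c -> ccod c x ->
  \tr (at_point S (shape phi N) (cinv c x)) = \tr (shape phi N c x).
Proof.
move=> cS cx; have o := overlap_chart_at cx.
have aS := atlas_chart_at S (cinv c x).
exact (esym (proj1 (trace_conj (transition_unit cS aS o) (shape_transition cS aS o)))).
Qed.

Lemma trace_shape2_chart c x : atlas S c -> ccod c x ->
  shape_norm2 S phi N (cinv c x) = \tr (shape phi N c x *m shape phi N c x).
Proof.
move=> cS cx; have o := overlap_chart_at cx.
have aS := atlas_chart_at S (cinv c x).
exact (esym (proj2 (trace_conj (transition_unit cS aS o) (shape_transition cS aS o)))).
Qed.

End immersed.

(** * Green's formula in one chart *)

Section Lint_sum.
Context {R : realType}.

Lemma cc_zero n (B : R) : cc B (fun _ : 'rV[R]_n => 0).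
Proof. by split=> // x; apply: cst_continuous. Qed.

Lemma Lint_sum n (I : Type) (s : seq I) (F : I -> 'rV[R]_n -> R) B : 0 <= B ->
  (forall i, cc B (F i)) ->
  cc B (fun x => \sum_(i <- s) F i x) /\
  Lint (fun x => \sum_(i <- s) F i x) = \sum_(i <- s) Lint (F i).
Proof.
move=> B0 FB; elim: s => [|i s [IHc IH]].
  rewrite big_nil (_ : (fun x => _) = fun=> 0).
    by rewrite Lint_zero; split=> //; exact: cc_zero.
  by apply/funext => x; rewrite big_nil.
rewrite big_cons (_ : (fun x => _) = fun x => F i x + \sum_(j <- s) F j x).
  by rewrite (LintD B0 (FB i) IHc) IH; split=> //; exact: ccD.
by apply/funext => x; rewrite big_cons.
Qed.

End Lint_sum.

Section green.
Context {R : realType} {n : nat} {M : ptopologicalType}.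
Variables (S : smooth_structure R M n) (phi N : M -> 'rV[R]_n.+2).
Hypothesis phi_imm : sphere_immersion S phi.
Hypothesis N_normal : unit_normal S phi N.
Variable mu : {measure set (borel M) -> \bar R}.
Hypothesis mu_area : area_measure S phi mu.
Hypothesis hM : hausdorff_space M.
Hypothesis cM : compact [set: M].

Definition chart_grad (f : M -> R) (c : chart R M n) (x : 'rV[R]_n) : 'rV[R]_n :=
  \row_i partial i (f \o cinv c) x.

(** The inner product of the gradients of f and g, from their coordinate
    derivatives. *)
Definition grad_pair (f g : M -> R) (c : chart R M n) (x : 'rV[R]_n) : R :=
  (chart_grad f c x *m invmx (metric phi c x) *m (chart_grad g c x)^T) ord0 ord0.

Lemma chart_grad_transition c c' x f : atlas S c -> atlas S c' -> overlap c c' x ->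
  mC1 S f -> chart_grad f c x = chart_grad f c' (transition c c' x) *m
   (\matrix_(i, j) partial i (fun y => transition c c' y ord0 j) x)^T.
Proof.
move=> cS c'S o fC; apply/rowP => i; rewrite [LHS]mxE.
have df : differentiable (f \o cinv c') (transition c c' x).
  exact: C1_differentiable (fC _ c'S) (transition_cod o).
rewrite (partial_transition cS c'S o i df) [RHS]mxE; apply: eq_bigr => j _.
by rewrite [X in X * _]mxE [RHS]mulrC; congr (_ * _); rewrite !mxE.
Qed.

Lemma grad_pair_chart f g c x : mC1 S f -> mC1 S g -> atlas S c -> ccod c x ->
  at_point S (grad_pair f g) (cinv c x) = grad_pair f g c x.
Proof.
move=> fC gC cS cx; have o := overlap_chart_at S cx.
have aS := atlas_chart_at S (cinv c x).
have h := pair_congr (transition_unit phi_imm cS aS o)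
  (invmetric_transition phi_imm N_normal cS aS o)
  (chart_grad_transition cS aS o fC) (chart_grad_transition cS aS o gC).
exact (esym (congr1 (fun A : 'M[R]_1 => A ord0 ord0) h)).
Qed.

Lemma metric_inv_C1 c : atlas S c -> C1mx (ccod c) (fun y => invmx (metric phi c y)).
Proof. by move=> cS; exact (patch_invmetric_C1 (chart_patch phi_imm N_normal cS)). Qed.

Lemma area_density_C1 c : atlas S c -> C1 (ccod c) (area_density phi c).
Proof. by move=> cS; exact (patch_density_C1 (chart_patch phi_imm N_normal cS)). Qed.

Lemma area_density_gt0 c x : atlas S c -> ccod c x -> 0 < area_density phi c x.
Proof. by move=> cS cx; exact (patch_density_gt0 (chart_patch phi_imm N_normal cS) cx). Qed.

Lemma area_density_continuous c x : atlas S c -> ccod c x ->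
  {for x, continuous (area_density phi c)}.
Proof. by move=> cS; exact: C1_continuous (area_density_C1 cS). Qed.

Lemma grad_pair_continuous f g : mC1 S f -> mC1 S g ->
  continuous (at_point S (grad_pair f g)).
Proof.
move=> fC gC p; have cS := atlas_chart_at S p; have cp := cdom_chart_at S p.
apply: (continuous_in_chart cp); set c := chart_at S p in cS cp *.
have cx := cmap_cod cp; have oc := @open_ccod _ _ _ c.
pose F y := \sum_j \sum_i partial i (f \o cinv c) y * invmx (metric phi c y) i j *
   partial j (g \o cinv c) y.
apply: (near_continuous (f := F)).
  apply: (open_near oc cx) => y cy; rewrite /= grad_pair_chart// /grad_pair /F.
  rewrite [RHS]mxE; apply: eq_bigr => j _; rewrite !mxE mulr_suml.
  by apply: eq_bigr => i _; rewrite !mxE.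
apply: cont_sum => j; apply: cont_sum => i; apply: contM; last first.
  exact: C1_partial_continuous j (gC _ cS) cx.
apply: contM; first exact: C1_partial_continuous i (fC _ cS) cx.
exact: C1_continuous (metric_inv_C1 cS i j) cx.
Qed.

Lemma grad_pair_sum (I : Type) (s : seq I) (F : I -> M -> R) g p :
  (forall i, mC1 S (F i)) ->
  at_point S (grad_pair (fun q => \sum_(i <- s) F i q) g) p =
  \sum_(i <- s) at_point S (grad_pair (F i) g) p.
Proof.
move=> FC; rewrite /at_point /grad_pair; set c := chart_at S p; set x := cmap c p.
have cS : atlas S c := atlas_chart_at S p; have cx : ccod c x := cmap_cod (cdom_chart_at S p).
have -> : chart_grad (fun q => \sum_(i <- s) F i q) c x = \sum_(i <- s) chart_grad (F i) c x.
  apply/rowP => k; rewrite mxE summxE.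
  rewrite (_ : _ \o _ = fun y => \sum_(i <- s) (F i \o cinv c) y)//.
  rewrite partial_sum => [|i]; last exact: C1_differentiable (FC i c cS) cx.
  by apply: eq_bigr => i _; rewrite mxE.
by rewrite !mulmx_suml summxE.
Qed.

Section one_chart.
Variable c : chart R M n.
Hypothesis cS : atlas S c.
Variable K : set 'rV[R]_n.
Hypothesis cK : compact K.
Hypothesis Kc : K `<=` ccod c.
Variables (eta u Lu : M -> R).
Hypothesis etaC : mC1 S eta.
Hypothesis etaK : supp_in c K eta.
Hypothesis uS : smooth_map S u.
Hypothesis Luc : continuous Lu.
Hypothesis LuE : forall x, ccod c x -> divergence phi (grad phi u) c x = Lu (cinv c x).

Let integrand p := eta p * Lu p + at_point S (grad_pair eta u) p.

Let uC : mC1 S u. Proof. exact: smooth_map_mC1. Qed.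

Lemma green_integrand_continuous : continuous integrand.
Proof.
move=> p.
apply: (@contD _ _ (fun q => eta q * Lu q) (at_point S (grad_pair eta u)) p).
  by apply: contM; [exact: (mC1_continuous etaC)|exact: Luc].
exact: (grad_pair_continuous etaC uC).
Qed.

Lemma green_integrand_supp : supp_in c K integrand.
Proof.
move=> p; have [//|Kp] := pselect ((cinv c @` K) p).
have e0 q : ~ (cinv c @` K) q -> eta q = 0.
  by move=> Kq; apply/eqP/negP => /negP /etaK.
rewrite /integrand e0// mul0r add0r.
suff -> : at_point S (grad_pair eta u) p = 0 by rewrite eqxx.
rewrite /at_point /grad_pair.
suff -> : chart_grad eta (chart_at S p) (cmap (chart_at S p) p) = 0.
  by rewrite !mul0mx mxE.
have cp := cdom_chart_at S p.
apply/rowP => i; rewrite !mxE (partial_near (g := cst 0)) ?/partial ?derive_cst//.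
have clK := compact_cinv_closed hM cK Kc.
have : \forall y \near cmap (chart_at S p) p, (~` (cinv c @` K)) (cinv (chart_at S p) y).
  apply: preimage_near; [exact: cmap_cod|exact: closed_openC|].
  by rewrite cmapK.
by apply: filterS => y /e0.
Qed.

Let flux j (x : 'rV[R]_n) : R :=
  ((fun x => eta (cinv c x) * (area_density phi c x * grad phi u c x ord0 j)) \_ (ccod c)) x.

Let clK : closed K.
Proof. by apply: compact_closed => //; exact: norm_hausdorff. Qed.

Let weighted_grad_C1 j : C1 (ccod c) (fun x => area_density phi c x * grad phi u c x ord0 j).
Proof.
have oc := @open_ccod _ _ _ c.
apply: (C1M oc (area_density_C1 cS)).
apply: (C1_eq (f := fun y => \sum_k partial k (u \o cinv c) y * invmx (metric phi c y) k j) oc).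
  by move=> y cy; rewrite /grad mxE; apply: eq_bigr => k _; rewrite mxE.
apply: (C1_sum _ _ oc) => k; apply: (C1M oc); last exact: metric_inv_C1.
exact: smooth_on_C1 (smooth_on_partial k (uS cS)).
Qed.

Let flux_offK j x : ~ K x -> flux j x = 0.
Proof.
move=> Kx; rewrite /flux patchE; case: ifPn => // /[1!inE] cx.
by rewrite (supp_offK Kc etaK cx Kx) mul0r.
Qed.

Let flux_in j x : ccod c x ->
  flux j x = eta (cinv c x) * (area_density phi c x * grad phi u c x ord0 j).
Proof. by move=> cx; rewrite /flux patchE ifT// inE. Qed.

Let flux_C1 j : C1 setT (flux j).
Proof.
move=> x _; have oc := @open_ccod _ _ _ c; have [cx|cx] := pselect (ccod c x).
  have O : C1 (ccod c) (flux j).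
    apply: (C1_eq oc _ (C1M oc (etaC cS) (weighted_grad_C1 j))) => y cy.
    by rewrite flux_in.
  exact: O.
have oK : open (~` K) by exact: closed_openC.
have O : C1 (~` K) (flux j).
  by apply: (C1_eq oK _ (C1_cst 0 oK)) => y Ky; rewrite flux_offK.
by apply: O => /Kc.
Qed.

(** In coordinates w (eta Lu + <grad eta, grad u>) is the divergence of the
    compactly supported field w eta grad u (the function flux), and the integral
    of each of its n terms vanishes by Lint_partial. *)
Lemma green_chart : mu.-integrable [set: borel M] (fun p => (integrand p)%:E) /\
  \int[mu]_(p in [set: borel M]) integrand p = 0.
Proof.
have wc x : ccod c x -> {for x, continuous (area_density phi c)}.
  by move=> cx; exact: area_density_continuous.
have [? ->] := int_chart mu_area cS wc cK Kc green_integrand_continuous green_integrand_supp.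
split=> //.
have [B B0 BK] := K_bounded cK.
have fB j : cc B (flux j).
  split; first by move=> x; exact: C1_continuous (flux_C1 j) _.
  by move=> x Bx; apply: flux_offK => /BK; rewrite leNgt Bx.
have -> : ext phi c integrand = fun x => \sum_j partial j (flux j) x.
  apply/funext => x; have [cx|cx] := pselect (ccod c x); last first.
    have nK : ~ K x by move=> /Kc.
    rewrite (ext_offK phi Kc green_integrand_supp nK).
    rewrite big1// => j _; rewrite (partial_near (g := cst 0)) ?/partial ?derive_cst//.
    apply: (open_near (U := ~` K)); [exact: closed_openC|exact: nK|].
    by move=> y Ky; rewrite flux_offK.
  have oc := @open_ccod _ _ _ c.
  rewrite /ext patchE ifT ?inE// /integrand grad_pair_chart//.
  transitivity (\sum_j (eta (cinv c x) * partial j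
    (fun y => area_density phi c y * grad phi u c y ord0 j) x
    + area_density phi c x * grad phi u c x ord0 j * partial j (eta \o cinv c) x)).
    rewrite big_split/= -mulr_sumr mulrDl; congr (_ + _).
      rewrite -LuE// /divergence -mulrA; congr (_ * _).
      have key (p q : R) : p != 0 -> p^-1 * q * p = q.
        by move=> p0; rewrite mulrAC mulVf ?mul1r.
      exact (key _ _ (lt0r_neq0 (area_density_gt0 cS cx))).
    rewrite mulrC; under [RHS]eq_bigr do rewrite -mulrA.
    rewrite -mulr_sumr; congr (_ * _).
    rewrite /grad_pair -mulmxA.
    have -> : invmx (metric phi c x) *m (chart_grad u c x)^T = (grad phi u c x)^T.
      by rewrite /grad trmx_mul trmx_inv /metric trmx_mul trmxK.
    by rewrite mxE; apply: eq_bigr => j _; rewrite mulrC !mxE.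
  apply: eq_bigr => j _.
  rewrite (partial_eq_on j oc cx (flux_in j)).
  by rewrite (partialM j (C1_differentiable (etaC cS) cx)
    (C1_differentiable (weighted_grad_C1 j) cx)).
have pB j : cc B (partial j (flux j)) by exact: cc_partial.
have [_ ->] := Lint_sum (index_enum 'I_n) B0 pB.
by rewrite big1// => j _; exact: Lint_partial (flux_C1 j) (fB j).
Qed.

End one_chart.
End green.

(** * Green's formula on the manifold *)

Lemma possq_mono (R : realType) (s t : R) : s <= t -> possq s <= possq t.
Proof.
move=> st; rewrite /possq; have m0 (t' : R) : 0 <= Num.max t' 0.
  by rewrite le_max lexx orbT.
rewrite lerXn2r ?nnegrE ?m0// ge_max m0 andbT.
by rewrite le_max st.
Qed.

Lemma bump0_le (R : realType) n (a : 'rV[R]_n) r x : bump0 a r x <= possq (r ^+ 2).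
Proof.
apply: possq_mono; rewrite lerBlDr lerDl; apply: sumr_ge0 => i _; exact: sqr_ge0.
Qed.

Section global.
Context {R : realType} {n : nat} {M : ptopologicalType}.
Variables (S : smooth_structure R M n) (phi N : M -> 'rV[R]_n.+2).
Hypothesis phi_imm : sphere_immersion S phi.
Hypothesis N_normal : unit_normal S phi N.
Variable mu : {measure set (borel M) -> \bar R}.
Hypothesis mu_area : area_measure S phi mu.
Hypothesis hM : hausdorff_space M.
Hypothesis cM : compact [set: M].
Local Notation integrable f := (mu.-integrable [set: borel M] (fun p => (f p)%:E)).

Lemma integral_sum (I : Type) (s : seq I) (F : I -> M -> R) :
  (forall i, integrable (F i)) ->
  integrable (fun p => \sum_(i <- s) F i p) /\
  \int[mu]_(p in [set: borel M]) \sum_(i <- s) F i p =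
  \sum_(i <- s) \int[mu]_(p in [set: borel M]) F i p.
Proof.
move=> Fi; elim: s => [|i s [IHi IH]].
  split.
    rewrite (_ : (fun p => _) = cst 0%E); last by apply/funext => p; rewrite big_nil.
    exact: integrable0.
  rewrite big_nil; under eq_Rintegral do rewrite big_nil.
  by rewrite Rintegral_cst// mul0r.
split.
  rewrite (_ : (fun p => _) = (fun p => (F i p)%:E + (\sum_(j <- s) F j p)%:E)%E).
    exact: integrableD.
  by apply/funext => p; rewrite big_cons EFinD.
rewrite big_cons -IH -RintegralD//; last exact: Fi.
by apply: eq_Rintegral => p _; rewrite big_cons.
Qed.

Lemma area_wc c : atlas S c -> forall x, ccod c x -> {for x, continuous (area_density phi c)}.
Proof. by move=> cS x cx; exact: (area_density_continuous phi_imm N_normal cS cx). Qed.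

Lemma continuous_integrable (G : M -> R) : continuous G -> integrable G.
Proof.
move=> Gc; have [s [chi [K [H chi1]]]] := partition_of_unity S hM cM.
have Fi p : integrable (fun q => chi p q * G q).
  have [chiC cK Kc chiK] := H p.
  have aS := atlas_chart_at S p.
  have chiGc : continuous (fun q => chi p q * G q).
    by move=> q; apply: contM; [exact: (mC1_continuous chiC)|exact: Gc].
  have chiGK : supp_in (chart_at S p) (K p) (fun q => chi p q * G q).
    by move=> q; rewrite mulf_eq0 negb_or => /andP[/chiK].
  by have [] := int_chart mu_area aS (area_wc aS) cK Kc chiGc chiGK.
have [h _] := integral_sum s Fi.
rewrite (_ : G = fun q => \sum_(p <- s) chi p q * G q)//.
by apply/funext => q; rewrite -mulr_suml chi1 mul1r.
Qed.

(** Green's formula: the integrals in the charts are added up along a partition of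
    unity, which is absorbed by zeta. *)
Lemma green (zeta u Lu : M -> R) : mC1 S zeta -> smooth_map S u -> continuous Lu ->
  (forall c x, atlas S c -> ccod c x ->
     divergence phi (grad phi u) c x = Lu (cinv c x)) ->
  \int[mu]_(p in [set: borel M]) (zeta p * Lu p + at_point S (grad_pair phi zeta u) p) = 0.
Proof.
move=> zC uS Luc LuE; have [s [chi [K [H chi1]]]] := partition_of_unity S hM cM.
pose F p q := chi p q * zeta q.
have FC p : mC1 S (F p) by have [chiC _ _ _] := H p; exact: mC1M.
have FK p : supp_in (chart_at S p) (K p) (F p).
  by have [_ _ _ chiK] := H p; move=> q; rewrite mulf_eq0 negb_or => /andP[/chiK].
pose G p q := F p q * Lu q + at_point S (grad_pair phi (F p) u) q.
have GI p : integrable (G p) /\ \int[mu]_(q in [set: borel M]) G p q = 0.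
  have [_ cK Kc _] := H p; have aS := atlas_chart_at S p.
  exact: (green_chart phi_imm N_normal mu_area hM aS cK Kc (FC p) (FK p) uS Luc
    (fun x cx => LuE _ x aS cx)).
have [_] := integral_sum s (fun p => proj1 (GI p)).
rewrite big1 => [|p _]; last exact: (proj2 (GI p)).
move=> <-; congr (Rintegral mu _ _); apply/funext => q.
have zE : zeta = fun q => \sum_(p <- s) F p q.
  by apply/funext => r; rewrite /F -mulr_suml chi1 mul1r.
rewrite /G big_split/= -(grad_pair_sum phi s u q FC) -mulr_suml zE.
by congr (_ + _).
Qed.

(** The area measure charges every open set: f dominates a positive multiple of
    b f for a bump b at p0, and the density is positive. *)
Lemma integral_gt0 (f : M -> R) p0 : continuous f -> (forall p, 0 <= f p) ->
  0 < f p0 -> 0 < \int[mu]_(p in [set: borel M]) f p.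
Proof.
move=> fc f0 fp0; have cS := atlas_chart_at S p0; have cp := cdom_chart_at S p0.
set c := chart_at S p0 in cS cp; set a := cmap c p0.
have [r r0 Kc] := exists_radius (cmap_cod cp : ccod c a).
pose b := bump c a r; have bC : mC1 S b := bump_mC1 hM cS r0 Kc.
have bfc : continuous (fun p => b p * f p).
  by move=> q; apply: contM; [exact: (mC1_continuous bC)|exact: fc].
have bK : supp_in c (kball a r) (fun p => b p * f p).
  by move=> q; rewrite mulf_eq0 negb_or => /andP[/(bump_supp r0)].
have cK : compact (kball a r) by exact: kball_compact.
have [bi bE] := int_chart mu_area cS (area_wc cS) cK Kc bfc bK.
have [B B0 bB] : exists2 B : R, 0 <= B & cc B (ext phi c (fun p => b p * f p)).
  apply: (ext_cc (area_wc cS) cK Kc bK) => x cx.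
  by apply: continuous_comp; [exact: cinv_continuous|exact: bfc].
have bp : 0 < \int[mu]_(p in [set: borel M]) (b p * f p).
  rewrite bE; apply: (Lint_gt0 (x0 := a) B0 bB).
    move=> x; rewrite /ext patchE; case: ifPn => // /[1!inE] cx.
    rewrite mulr_ge0//; last exact: ltW (area_density_gt0 phi_imm N_normal cS cx).
    by rewrite mulr_ge0//; exact: bump_ge0.
  have ca : ccod c a := cmap_cod cp.
  rewrite /ext patchE ifT ?inE// mulr_gt0//;
    last exact: (area_density_gt0 phi_imm N_normal cS ca).
  by rewrite /a cmapK// mulr_gt0//; exact: bump_center.
pose C := possq (r ^+ 2) + 1.
have C0 : 0 < C by rewrite ltr_wpDl// sqr_ge0.
have bleC p : b p <= C.
  rewrite /b /bump; case: ifP => _; last exact: ltW.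
  by apply: (le_trans (bump0_le _ _ _)); rewrite lerDl.
apply: (@lt_le_trans _ _ (C^-1 * \int[mu]_(p in [set: borel M]) (b p * f p))).
  by rewrite mulr_gt0// invr_gt0.
rewrite -RintegralZl//; apply: le_Rintegral => //.
- have := continuous_integrable (G := fun p => C^-1 * (b p * f p)); apply.
  by move=> q; have h := contM (@cont_cst R M C^-1 q) (bfc q); exact h.
- exact: continuous_integrable fc.
- move=> p _; rewrite mulrA ler_piMl// mulrC ler_pdivrMr// mul1r//.
Qed.

End global.

(** * Laplacians of the height functions *)

Section dot.
Context {R : realType} {m : nat}.
Implicit Types u v w : 'rV[R]_m.

Lemma dotvDl u w v : dotv (u + w) v = dotv u v + dotv w v.
Proof. by rewrite /dotv mulmxDl mxE. Qed.

Lemma dotvZl (a : R) u v : dotv (a *: u) v = a * dotv u v.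
Proof. by rewrite /dotv -scalemxAl mxE. Qed.

Lemma dotvDr u w v : dotv v (u + w) = dotv v u + dotv v w.
Proof. by rewrite /dotv linearD mulmxDr mxE. Qed.

Lemma dotvZr (a : R) u v : dotv v (a *: u) = a * dotv v u.
Proof. by rewrite /dotv linearZ -scalemxAr mxE. Qed.

Lemma dotv_sumr (I : Type) (s : seq I) (F : I -> 'rV[R]_m) v :
  dotv v (\sum_(i <- s) F i) = \sum_(i <- s) dotv v (F i).
Proof.
elim: s => [|i s IH]; first by rewrite !big_nil /dotv trmx0 mulmx0 mxE.
by rewrite !big_cons dotvDr IH.
Qed.

End dot.

Lemma dv_comb (R : realType) n q (a b : R) (F G : 'rV[R]_n -> 'M[R]_(n, q)) x :
  diffmx F x -> diffmx G x ->
  dv (fun y => a *: F y + b *: G y) x = a *: dv F x + b *: dv G x.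
Proof.
move=> dF dG; apply/rowP => k; rewrite !mxE !mulr_sumr -big_split/=.
apply: eq_bigr => j _.
have E : (fun y => (a *: F y + b *: G y) j k) = (fun y => a * F y j k + b * G y j k).
  by apply/funext => y; rewrite !mxE.
have dc (e : R) (f : 'rV[R]_n -> R) : differentiable f x -> differentiable (fun y => e * f y) x.
  by move=> df; apply: differentiableM => //; exact: differentiable_cst.
have pc (e : R) (f : 'rV[R]_n -> R) : differentiable f x ->
    partial j (fun y => e * f y) x = e * partial j f x.
  move=> df; rewrite (partialM j (differentiable_cst e x) df).
  by rewrite {2}/partial derive_cst mulr0 addr0.
by rewrite E (partialD j (dc _ _ (dF j k)) (dc _ _ (dG j k))) !pc.
Qed.

Lemma smooth_on_dotv (R : realType) n m (U : set 'rV[R]_n) (F : 'rV[R]_n -> 'rV[R]_m) v :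
  open U -> smooth_on U F -> smooth_on U (fun x => dotv (F x) v).
Proof.
move=> oU FS.
have dC (u : 'rV[R]_n -> 'rV[R]_m) x a : differentiable u x ->
    differentiable (fun y => u y ord0 a * v ord0 a) x.
  by move=> du; apply: differentiableM;
    [exact: differentiable_coordf|exact: differentiable_cst].
have E (u : 'rV[R]_n -> 'rV[R]_m) : (fun y => dotv (u y) v) =
    fun y => \sum_a u y ord0 a * v ord0 a.
  by apply/funext => y; rewrite dotvE.
apply: (iter_partial_comb (L := fun (u _ : 'rV[R]_m) => dotv u v : R) oU FS FS).
- move=> u w x i du _; rewrite E partial_sum => [|a]; last exact: dC.
  rewrite dotvE; apply: eq_bigr => a _.
  rewrite (partialM i (differentiable_coordf a du) (differentiable_cst _ _)).
  by rewrite {1}/partial derive_cst mulr0 add0r mulrC partial_coord.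
- by move=> u w x du _; rewrite E; apply: differentiable_bigsum => a; exact: dC.
- by [].
Qed.

Section patch_heights.
Context {R : realType} {n : nat}.
Variables (U : set 'rV[R]_n) (X N : 'rV[R]_n -> 'rV[R]_n.+2).
Variables D E : 'rV[R]_n -> 'M[R]_(n, n.+2).
Hypothesis P : is_patch U X N D E.
Let oU := patch_open P.
Let w y := Num.sqrt (\det (D y *m (D y)^T)).
Let Gi y := invmx (D y *m (D y)^T).
Let hGi y := E y *m (D y)^T *m Gi y.

Lemma patch_comb_jac a b : is_jac U (fun y => a *: X y + b *: N y)
  (fun y => a *: D y + b *: E y).
Proof.
move=> y i k Uy; rewrite !mxE (patch_D P i k Uy) (patch_E P i k Uy).
have dX := C1_differentiable (C1mx_smooth oU (patch_X P) ord0 k) Uy.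
have dN := C1_differentiable (C1mx_smooth oU (patch_N P) ord0 k) Uy.
have dc (e : R) (f : 'rV[R]_n -> R) : differentiable f y -> differentiable (fun z => e * f z) y.
  by move=> df; apply: differentiableM => //; exact: differentiable_cst.
have pc (e : R) (f : 'rV[R]_n -> R) : differentiable f y ->
    partial i (fun z => e * f z) y = e * partial i f y.
  move=> df; rewrite (partialM i (differentiable_cst e y) df).
  by rewrite {2}/partial derive_cst mulr0 addr0.
have -> : (fun z => (a *: X z + b *: N z) ord0 k) = fun z =>
    a * X z ord0 k + b * N z ord0 k by apply/funext => z; rewrite !mxE.
by rewrite (partialD i (dc _ _ dX) (dc _ _ dN)) !pc.
Qed.

(** The two classical formulas dv_position and dv_normal, combined linearly and
    paired with v. *)
Lemma patch_laplacian_comb a b (v : 'rV[R]_n.+2) c y :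
  (forall z, U z -> - \tr (hGi z) = c) -> U y ->
  (w y)^-1 * \sum_i partial i (fun z => w z *
     ((\row_k partial k (fun t => dotv (a *: X t + b *: N t) v) z) *m Gi z) ord0 i) y =
  a * (- n%:R * dotv (X y) v + c * dotv (N y) v) +
  b * (c * dotv (X y) v - \tr (hGi y *m hGi y) * dotv (N y) v).
Proof.
move=> Hc Uy.
have combS := smooth_onD oU (smooth_onZ a oU (patch_X P)) (smooth_onZ b oU (patch_N P)).
rewrite (patch_laplacian P v combS (patch_comb_jac a b) Uy).
have w0 : 0 < w y := patch_density_gt0 P Uy.
have DC := patch_D_C1 P; have EC := patch_E_C1 P.
have wC := patch_density_C1 P; have GC := patch_invmetric_C1 P.
have PC := C1mxZ oU wC (C1mxM oU GC DC); have QC := C1mxZ oU wC (C1mxM oU GC EC).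
have -> : dv (fun z => w z *: (Gi z *m (a *: D z + b *: E z))) y =
   a *: (w y *: (- n%:R *: X y + c *: N y)) +
   b *: (w y *: (c *: X y - \tr (hGi y *m hGi y) *: N y)).
  have e1 := dv_position P Uy; have e2 := dv_normal P Hc Uy.
  rewrite -scaleNr (Hc _ Uy) in e1.
  rewrite -[X in a *: X]e1 -[X in _ + b *: X]e2.
  rewrite -(dv_comb a b (C1mx_diff PC Uy) (C1mx_diff QC Uy)).
  congr (dv _ y); apply/funext => z.
  rewrite mulmxDr -!scalemxAr scalerDr.
  by rewrite !(scalerA (w z)) !(mulrC (w z)) -!scalerA.
have key (W p q : R) : W != 0 -> W^-1 * (a * (W * p) + b * (W * q)) = a * p + b * q.
  by move=> W0; field.
rewrite dotvDl !(dotvZl, dotvDl) -scaleNr !dotvZl (mulNr (\tr (hGi y *m hGi y))).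
exact (key _ _ _ (lt0r_neq0 w0)).
Qed.

End patch_heights.

Section heights.
Context {R : realType} {n : nat} {M : ptopologicalType}.
Variables (S : smooth_structure R M n) (phi N : M -> 'rV[R]_n.+2).
Hypothesis phi_imm : sphere_immersion S phi.
Hypothesis N_normal : unit_normal S phi N.
Hypothesis n_gt0 : (0 < n)%N.
Variable H : R.
Hypothesis cmc : forall p, mean_curvature S phi N p = H.

Let A2 := shape_norm2 S phi N.

(** The heights of phi, of N and of phi - H N are all heights of such combinations,
    so that one Laplacian formula serves for the three. *)
Definition comb (a b : R) (p : M) : 'rV[R]_n.+2 := a *: phi p + b *: N p.

Lemma height_comb a b v p : height (comb a b) v p = a * height phi v p + b * height N v p.
Proof. by rewrite /height /comb dotvDl !dotvZl. Qed.

Lemma smooth_comb a b : smooth_map S (comb a b).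
Proof.
have [phiS _ _] := phi_imm; have [NS _ _ _] := N_normal => c cS.
have oc := @open_ccod _ _ _ c.
exact: smooth_onD oc (smooth_onZ a oc (phiS c cS)) (smooth_onZ b oc (NS c cS)).
Qed.

Lemma smooth_height (F : M -> 'rV[R]_n.+2) v : smooth_map S F -> smooth_map S (height F v).
Proof. by move=> FS c cS; exact (smooth_on_dotv v (@open_ccod _ _ _ c) (FS c cS)). Qed.

Lemma smooth_phi : smooth_map S phi. Proof. by have [] := phi_imm. Qed.
Lemma smooth_N : smooth_map S N. Proof. by have [] := N_normal. Qed.

Lemma shape_chart c x : atlas S c -> ccod c x -> shape phi N c x =
  - (chart_diff N c x *m (chart_diff phi c x)^T *m invmx (metric phi c x)).
Proof. by move=> cS cx; exact (shape_patch (chart_patch phi_imm N_normal cS) cx). Qed.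

Lemma shape_norm2_chart c x : atlas S c -> ccod c x -> A2 (cinv c x) =
  \tr (chart_diff N c x *m (chart_diff phi c x)^T *m invmx (metric phi c x) *m
      (chart_diff N c x *m (chart_diff phi c x)^T *m invmx (metric phi c x))).
Proof.
move=> cS cx; rewrite /A2 (trace_shape2_chart phi_imm N_normal cS cx) (shape_chart cS cx).
by rewrite mulNmx mulmxN opprK.
Qed.

Lemma trace_shape_eq c x : atlas S c -> ccod c x -> - \tr
  (chart_diff N c x *m (chart_diff phi c x)^T *m invmx (metric phi c x)) = n%:R * H.
Proof.
move=> cS cx; rewrite -raddfN /= -(shape_chart cS cx).
rewrite -(trace_shape_chart phi_imm N_normal cS cx) -(cmc (cinv c x)).
by rewrite /mean_curvature mulrA divff ?mul1r// pnatr_eq0 -lt0n.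
Qed.

Lemma shape_norm2_mC1 : mC1 S A2.
Proof.
move=> c cS; have oc := @open_ccod _ _ _ c.
have P := chart_patch phi_imm N_normal cS.
pose B x := chart_diff N c x *m (chart_diff phi c x)^T *m invmx (metric phi c x).
have BC : C1mx (ccod c) B.
  apply: (C1mxM oc); last exact: (metric_inv_C1 phi_imm N_normal cS).
  exact: (C1mxM oc (patch_E_C1 P) (C1mx_tr (patch_D_C1 P))).
have BBC := C1mxM oc BC BC.
apply: (C1_eq oc _ (C1_sum (index_enum 'I_n) xpredT oc (fun i => BBC i i))) => x cx.
by rewrite /= shape_norm2_chart.
Qed.

Definition lap_comb a b v p := a * (- n%:R * height phi v p + n%:R * H * height N v p)
  + b * (n%:R * H * height phi v p - A2 p * height N v p).

Lemma divergence_comb a b v c x : atlas S c -> ccod c x ->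
  divergence phi (grad phi (height (comb a b) v)) c x = lap_comb a b v (cinv c x).
Proof.
move=> cS cx; have P := chart_patch phi_imm N_normal cS.
rewrite /lap_comb (shape_norm2_chart cS cx).
exact (patch_laplacian_comb P a b v (fun z cz => trace_shape_eq cS cz) cx).
Qed.

End heights.

(** * The index estimate *)

Lemma quad_inv (R : comUnitRingType) n (G : 'M[R]_n) (u : 'rV[R]_n) :
  G \in unitmx -> G^T = G ->
  u *m invmx G *m G *m (u *m invmx G)^T = u *m invmx G *m u^T.
Proof.
by move=> Gu GT; rewrite mulmxKV// trmx_mul trmx_inv GT mulmxA.
Qed.

Lemma pair_sym (R : realType) n (I : 'M[R]_n) (u v : 'rV[R]_n) :
  I^T = I -> u *m I *m v^T = v *m I *m u^T.
Proof. by move=> IT; rewrite -[LHS]tr11 !trmx_mul trmxK IT mulmxA. Qed.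

Section vanishing.
Context {R : realType} {n : nat}.
Variables (U : set 'rV[R]_n) (X N : 'rV[R]_n -> 'rV[R]_n.+2).
Variables D E : 'rV[R]_n -> 'M[R]_(n, n.+2).
Hypothesis P : is_patch U X N D E.

Lemma dotv_mx (p q : 'rV[R]_n.+2) : q *m p^T = (dotv p q)%:M.
Proof. by rewrite -[LHS]tr11 trmx_mul trmxK [LHS]mx11_scalar. Qed.

(** If the height along v vanishes on V, so does its gradient: v has no tangential
    and no position component. *)
Lemma patch_flat_height V v y : open V -> V `<=` U -> V y ->
  (forall z, V z -> dotv (X z) v = 0) -> v = dotv (N y) v *: N y.
Proof.
move=> oV VU Vy Xv; have Uy := VU _ Vy.
have vD : v *m (D y)^T = 0.
  rewrite -(patch_height_grad P v (patch_X P) (patch_D P) Uy); apply/rowP => k.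
  rewrite !mxE (partial_eq_on k oV Vy Xv) /partial derive_cst//.
rewrite {1}(patch_decomp P v Uy) vD !mul0mx add0r !dotv_mx Xv// raddf0 mul0mx add0r.
by rewrite mul_scalar_mx.
Qed.

(** By patch_flat_height, v is a multiple of N on V, and the factor has constant
    square |v|^2.  So dN is a multiple of v, but it is also orthogonal to N, hence
    to v. *)
Lemma patch_zero_height_geodesic V v y : open V -> V `<=` U -> V y -> v != 0 ->
  (forall z, V z -> dotv (X z) v = 0) -> E y = 0.
Proof.
move=> oV VU Vy v0 Xv; have Uy := VU _ Vy.
pose q z := dotv (N z) v.
have vq z : V z -> v = q z *: N z by move=> Vz; exact: patch_flat_height Xv.
pose s := dotv v v.
have s0 : s != 0 by apply: contra v0 => /eqP/dotvv_eq0 ->.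
have qq z : V z -> q z * q z = s.
  by move=> Vz; rewrite -[X in _ * X]/(dotv (N z) v) -dotvZl -(vq z Vz).
have Nq z : V z -> N z = (s^-1 * q z) *: v.
  move=> Vz; have h : s *: N z = q z *: v by rewrite -(qq z Vz) -scalerA -(vq z Vz).
  by rewrite -[LHS]scale1r -(mulVf s0) -[LHS]scalerA h scalerA.
have q0 : q y != 0.
  by apply: contra s0 => /eqP h; rewrite -(qq y Vy) h mul0r.
have dq : differentiable q y.
  have := smooth_on_dotv v (patch_open P) (patch_N P) => /(_ [::] y Uy).
  exact.
have Ek k j : E y k j = (s^-1 * partial k q y) * v ord0 j.
  rewrite (patch_E P k j Uy).
  rewrite (partial_eq_on k oV Vy (g := fun z => (s^-1 * v ord0 j) * q z)); last first.
    by move=> z Vz; rewrite (Nq z Vz) mxE; ring.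
  rewrite (partialM k (differentiable_cst _ _) dq) {2}/partial derive_cst mulr0 addr0.
  exact: mulrAC.
pose C : 'M[R]_(n, 1) := \col_k (s^-1 * partial k q y).
have EC : E y = C *m v.
  by apply/matrixP => k j; rewrite Ek [RHS]mxE big_ord1 mxE.
have := patch_EN P Uy; rewrite EC -mulmxA dotv_mx -/(q y) mul_mx_scalar => /eqP.
by rewrite scaler_eq0 (negbTE q0) => /eqP ->; rewrite mul0mx.
Qed.

End vanishing.

Section index.
Context {R : realType} {n : nat} {M : ptopologicalType}.
Variables (S : smooth_structure R M n) (phi N : M -> 'rV[R]_n.+2).
Variable mu : {measure set (borel M) -> \bar R}.
Variable H : R.
Hypothesis n_gt0 : (0 < n)%N.
Hypothesis hM : hausdorff_space M.
Hypothesis cM : compact [set: M].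
Hypothesis phi_imm : sphere_immersion S phi.
Hypothesis N_normal : unit_normal S phi N.
Hypothesis mu_area : area_measure S phi mu.
Hypothesis cmc : forall p, mean_curvature S phi N p = H.

Let A2 := shape_norm2 S phi N.
Let l v := height phi v.
Let f v := height N v.
Let u v := height (comb phi N 1 (- H)) v.
Let pr g h p := at_point S (grad_pair phi g h) p.
Local Notation Int g := (\int[mu]_(p in [set: borel M]) g p).

Let lS v : smooth_map S (l v). Proof. exact: smooth_height (smooth_phi phi_imm). Qed.
Let fS v : smooth_map S (f v). Proof. exact: smooth_height (smooth_N N_normal). Qed.
Let lC v : mC1 S (l v). Proof. exact: smooth_map_mC1 (lS v). Qed.
Let fC v : mC1 S (f v). Proof. exact: smooth_map_mC1 (fS v). Qed.
Let AC : mC1 S A2. Proof. exact: shape_norm2_mC1. Qed.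
Let mi g : mC1 S g -> mu.-integrable [set: borel M] (EFin \o g).
Proof.
move=> gC; exact: (continuous_integrable phi_imm N_normal mu_area hM cM (mC1_continuous gC)).
Qed.
Let ci g : continuous g -> mu.-integrable [set: borel M] (EFin \o g).
Proof. by move=> gC; exact: (continuous_integrable phi_imm N_normal mu_area hM cM gC). Qed.
Let prc g h : mC1 S g -> mC1 S h -> continuous (pr g h).
Proof. by move=> gC hC; exact: (grad_pair_continuous phi_imm N_normal gC hC). Qed.

Lemma integral_comb2 (a b : R) (g h : M -> R) : mC1 S g -> mC1 S h ->
  Int (fun p => a * g p + b * h p) = a * Int g + b * Int h.
Proof.
move=> gC hC; have aC := mC1M (@mC1_cst _ _ _ S a) gC; have bC := mC1M (@mC1_cst _ _ _ S b) hC.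
rewrite (RintegralD measurableT (mi aC) (mi bC)).
by rewrite (RintegralZl a measurableT (mi gC)) (RintegralZl b measurableT (mi hC)).
Qed.

Lemma grad_pair_sym g h p : pr g h p = pr h g p.
Proof.
rewrite /pr /at_point /grad_pair.
have IT : (invmx (metric phi (chart_at S p) (cmap (chart_at S p) p)))^T =
    invmx (metric phi (chart_at S p) (cmap (chart_at S p) p)).
  by rewrite trmx_inv /metric trmx_mul trmxK.
exact (congr1 (fun A : 'M[R]_1 => A ord0 ord0) (pair_sym _ _ IT)).
Qed.

Lemma grad_norm2_pair g p : grad_norm2 S phi g p = pr g g p.
Proof.
have cS := atlas_chart_at S p; have cx := cmap_cod (cdom_chart_at S p).
have Gu := patch_metric_unit (chart_patch phi_imm N_normal cS) cx.
rewrite /grad_norm2 /pr /at_point /dotv /grad_pair.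
have GT : (metric phi (chart_at S p) (cmap (chart_at S p) p))^T =
    metric phi (chart_at S p) (cmap (chart_at S p) p) by rewrite /metric trmx_mul trmxK.
exact (congr1 (fun A : 'M[R]_1 => A ord0 ord0)
  (quad_inv (chart_grad g (chart_at S p) (cmap (chart_at S p) p)) Gu GT)).
Qed.

Lemma height_position_comb v : l v = height (comb phi N 1 0) v.
Proof. by apply/funext => p; rewrite height_comb mul1r mul0r addr0. Qed.

Lemma height_normal_comb v : f v = height (comb phi N 0 1) v.
Proof. by apply/funext => p; rewrite height_comb mul1r mul0r add0r. Qed.

Lemma green_comb zeta a b v : mC1 S zeta ->
  Int (fun p => zeta p * lap_comb S phi N H a b v p) +
  Int (pr zeta (height (comb phi N a b) v)) = 0.
Proof.
move=> zC.
have kC (k : R) h : mC1 S h -> mC1 S (fun p => k * h p).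
  by move=> hC; exact: mC1M (@mC1_cst _ _ _ S k) hC.
have LC : mC1 S (lap_comb S phi N H a b v).
  exact (mC1D
    (kC a _ (mC1D (kC (- n%:R) _ (lC v)) (kC (n%:R * H) _ (fC v))))
    (kC b _ (mC1D (kC (n%:R * H) _ (lC v)) (mC1N (mC1M AC (fC v)))))).
have uS := smooth_height v (smooth_comb phi_imm N_normal a b).
rewrite -(RintegralD measurableT (mi (mC1M zC LC)) (ci (prc zC (smooth_map_mC1 uS)))).
apply: (green phi_imm N_normal mu_area hM cM zC uS (mC1_continuous LC)) => c x cS cx.
exact: divergence_comb.
Qed.

(** Green's formula with the constant function 1.  This says that the test function
    l - H f has mean zero. *)
Lemma integral_height_balance v : Int (l v) = H * Int (f v).
Proof.
have := green_comb 1 0 v (@mC1_cst _ _ _ S 1).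
have -> : Int (pr (fun=> 1) (height (comb phi N 1 0) v)) = 0.
  rewrite (_ : pr _ _ = fun=> 0) ?Rintegral_cst ?mul0r//; apply/funext => p.
  rewrite /pr /at_point /grad_pair (_ : chart_grad _ _ _ = 0) ?mul0mx ?mxE//.
  by apply/rowP => i; rewrite !mxE /partial derive_cst.
rewrite addr0 (_ : (fun p => _) = fun p => (- n%:R) * l v p + (n%:R * H) * f v p); last first.
  by apply/funext => p; rewrite /lap_comb !mul1r mul0r addr0.
rewrite integral_comb2// => /eqP; rewrite mulNr addrC subr_eq0 -mulrA => /eqP.
by move/mulfI => ->//; rewrite pnatr_eq0 -lt0n.
Qed.

Let a v := Int (fun p => l v p ^+ 2).
Let b v := Int (fun p => l v p * f v p).
Let c v := Int (fun p => f v p ^+ 2).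
Let d v := Int (fun p => A2 p * l v p * f v p).
Let e v := Int (fun p => A2 p * l v p ^+ 2).
Let g v := Int (grad_norm2 S phi (l v)).

Let l2C v : mC1 S (fun p => l v p ^+ 2). Proof. exact (mC1M (lC v) (lC v)). Qed.
Let f2C v : mC1 S (fun p => f v p ^+ 2). Proof. exact (mC1M (fC v) (fC v)). Qed.
Let lfC v : mC1 S (fun p => l v p * f v p). Proof. exact (mC1M (lC v) (fC v)). Qed.
Let AlfC v : mC1 S (fun p => A2 p * l v p * f v p).
Proof. exact (mC1M (mC1M AC (lC v)) (fC v)). Qed.
Let Al2C v : mC1 S (fun p => A2 p * l v p ^+ 2).
Proof. exact (mC1M AC (l2C v)). Qed.

(** The integral of l Delta f - f Delta l vanishes.  This eliminates the integral
    d of |A|^2 l f. *)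
Lemma green_height_normal v :
  n%:R * H * a v - d v = - n%:R * b v + n%:R * H * c v.
Proof.
have h1 := green_comb 0 1 v (lC v); have h2 := green_comb 1 0 v (fC v).
rewrite -height_position_comb in h2; rewrite -height_normal_comb in h1.
rewrite (_ : pr (f v) (l v) = pr (l v) (f v)) in h2; last first.
  by apply/funext => p; exact: grad_pair_sym.
have E1 : Int (fun p => l v p * lap_comb S phi N H 0 1 v p) = n%:R * H * a v - d v.
  rewrite -[d v]mul1r -mulNr -(integral_comb2 _ _ (l2C v) (AlfC v)).
  apply: eq_Rintegral => p _.
  by rewrite /lap_comb -/(l v p) -/(f v p) -/A2; ring.
have E2 : Int (fun p => f v p * lap_comb S phi N H 1 0 v p) = - n%:R * b v + n%:R * H * c v.
  rewrite -(integral_comb2 _ _ (lfC v) (f2C v)); apply: eq_Rintegral => p _.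
  by rewrite /lap_comb -/(l v p) -/(f v p) -/A2; ring.
rewrite -E1 -E2; apply: (addIr (Int (pr (l v) (f v)))); by rewrite h1 h2.
Qed.

(** Green's formula for l with itself expresses the integral of l f through the
    quantity compared in the hypotheses on the heights. *)
Lemma green_height_position v : g v = n%:R * a v - n%:R * H * b v.
Proof.
have h := green_comb 1 0 v (lC v); rewrite -height_position_comb in h.
have E : Int (fun p => l v p * lap_comb S phi N H 1 0 v p) = - n%:R * a v + n%:R * H * b v.
  rewrite -(integral_comb2 _ _ (l2C v) (lfC v)); apply: eq_Rintegral => p _.
  by rewrite /lap_comb -/(l v p) -/(f v p) -/A2; ring.
rewrite E in h.
have -> : g v = Int (pr (l v) (l v)) by apply: eq_Rintegral => p _; exact: grad_norm2_pair.
lra.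
Qed.

(** Since J (l - H f) = (|A|^2 - n H^2) l, the left-hand side is a combination of
    the integrals a, b, d and e; green_height_normal eliminates d and
    green_height_position eliminates b. *)
Lemma jacobi_form_test v : jacobi_form S phi N mu (u v) =
  - Int (fun p => (A2 p - 2 * n%:R * H ^+ 2) * l v p ^+ 2) - n%:R * H ^+ 2 * c v
  + (1 - H ^+ 2) * (n%:R * a v - g v).
Proof.
have lapE p : laplacian S phi (u v) p = lap_comb S phi N H 1 (- H) v p.
  have cS := atlas_chart_at S p; have cp := cdom_chart_at S p.
  rewrite /laplacian /at_point
    (divergence_comb phi_imm N_normal n_gt0 cmc _ _ _ cS (cmap_cod cp)).
  by rewrite cmapK.
have -> : jacobi_form S phi N mu (u v) =
   - (1 * (1 * e v + (- (n%:R * H ^+ 2)) * a v) + 1 * (- H * d v + (n%:R * H ^+ 3) * b v)).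
  have kC (k : R) h : mC1 S h -> mC1 S (fun p => k * h p).
    by move=> hC; exact: mC1M (@mC1_cst _ _ _ S k) hC.
  have C1 := mC1D (kC 1 _ (Al2C v)) (kC (- (n%:R * H ^+ 2)) _ (l2C v)).
  have C2 := mC1D (kC (- H) _ (AlfC v)) (kC (n%:R * H ^+ 3) _ (lfC v)).
  rewrite -(integral_comb2 _ _ (Al2C v) (l2C v)) -(integral_comb2 _ _ (AlfC v) (lfC v)).
  rewrite -(integral_comb2 _ _ C1 C2).
  rewrite /jacobi_form; congr (- _); apply: eq_Rintegral => p _.
  rewrite /jacobi lapE /u height_comb /lap_comb -/(l v p) -/(f v p) -/A2; ring.
have -> : Int (fun p => (A2 p - 2 * n%:R * H ^+ 2) * l v p ^+ 2) =
    1 * e v + (- (2 * n%:R * H ^+ 2)) * a v.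
  by rewrite -(integral_comb2 _ _ (Al2C v) (l2C v)); apply: eq_Rintegral => p _; ring.
have h1 := green_height_normal v; have h2 := green_height_position v.
have -> : d v = n%:R * H * a v + n%:R * b v - n%:R * H * c v by lra.
by rewrite h2; ring.
Qed.

Hypothesis pinching : forall p, 0 <= A2 p - 2 * n%:R * H ^+ 2.
Hypothesis not_umbilical : ~ totally_umbilical S phi N.

Let pinched v p := (A2 p - 2 * n%:R * H ^+ 2) * l v p ^+ 2.

Let pinchedC v : mC1 S (pinched v).
Proof. exact: mC1M (mC1D AC (@mC1_cst _ _ _ S _)) (l2C v). Qed.

Lemma integral_eq0 (h : M -> R) : mC1 S h -> (forall p, 0 <= h p) -> Int h = 0 ->
  forall p, h p = 0.
Proof.
move=> hC h0 I0 p; apply/eqP; rewrite eq_le h0 andbT leNgt; apply/negP => hp.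
have := integral_gt0 phi_imm N_normal mu_area hM cM (mC1_continuous hC) h0 hp.
by rewrite I0 ltxx.
Qed.

Lemma heights_vanish v : (forall p, l v p = 0) -> (forall p, f v p = 0) -> v = 0.
Proof.
move=> lv fv; pose p : M := point.
have cS := atlas_chart_at S p; have cp := cmap_cod (cdom_chart_at S p).
have P := chart_patch phi_imm N_normal cS.
rewrite (patch_flat_height P (patch_open P) (fun z cz => cz) cp (fun z _ => lv _)).
by rewrite [dotv _ _](fv _) scale0r.
Qed.

(** Where |A| vanishes, so does dN.  Elsewhere |A| > 0 nearby, so the height along v
    vanishes nearby and patch_zero_height_geodesic applies. *)
Lemma minimal_normal_jacobian v c0 x : H = 0 -> v != 0 ->
  (forall p, pinched v p = 0) -> atlas S c0 -> ccod c0 x -> chart_diff N c0 x = 0.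
Proof.
move=> H0 v0 pv cS cx; have P := chart_patch phi_imm N_normal cS.
have hA := shape_norm2_chart phi_imm N_normal cS cx.
have [A0|A0] := eqVneq (A2 (cinv c0 x)) 0.
  exact (patch_shape_eq0 P cx (etrans (esym hA) A0)).
have Ap : 0 < A2 (cinv c0 x).
  rewrite lt_neqAle eq_sym A0/=; have := pinching (cinv c0 x).
  by rewrite H0 expr0n mulr0 subr0.
have Ac : (A2 \o cinv c0) y @[y --> x] --> A2 (cinv c0 x).
  exact: C1_continuous (AC cS) cx.
have nA : \forall y \near x, 0 < (A2 \o cinv c0) y by apply: (cvgr_gt _ Ac).
pose W := ccod c0 `&` [set y | 0 < (A2 \o cinv c0) y]°.
have oW : open W by apply: openI; [exact: open_ccod|exact: open_interior].
have Wx : W x by split.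
apply: (patch_zero_height_geodesic P oW _ Wx v0) => [y []//|y [cy /interior_subset/= Ay]].
have := pv (cinv c0 y); rewrite /pinched H0 expr0n mulr0 subr0 => /eqP.
by rewrite mulf_eq0 gt_eqF//= expf_eq0/= => /eqP.
Qed.

Lemma minimal_height_vanish v : H = 0 -> (forall p, pinched v p = 0) -> v = 0.
Proof.
move=> H0 pv; apply/eqP; apply: contrapT => /negP v0; apply: not_umbilical => p.
rewrite cmc H0 raddf0.
have cS := atlas_chart_at S p; have cp := cmap_cod (cdom_chart_at S p).
have E0 := minimal_normal_jacobian H0 v0 pv cS cp.
have := shape_chart phi_imm N_normal cS cp; rewrite E0 !mul0mx oppr0.
exact.
Qed.

(** All three terms of jacobi_form_test are nonpositive, so if their sum is not
    negative then they all vanish.  For H <> 0 this gives f = 0, then l = 0 by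
    green_height_normal, and v is orthogonal to the whole frame.  For H = 0 the
    remaining case is minimal_height_vanish, which needs a nonumbilical point. *)
Lemma jacobi_form_neg v : v != 0 -> (1 - H ^+ 2) * (n%:R * a v - g v) <= 0 ->
  jacobi_form S phi N mu (u v) < 0.
Proof.
move=> v0 K0; rewrite jacobi_form_test ltNge; apply/negP.
have P0 : 0 <= Int (pinched v).
  by apply: Rintegral_ge0 => p _; rewrite mulr_ge0// sqr_ge0.
have c0 : 0 <= c v by apply: Rintegral_ge0 => p _; exact: sqr_ge0.
have nH0 : 0 <= n%:R * H ^+ 2 :> R by rewrite mulr_ge0// sqr_ge0.
have nHc0 : 0 <= n%:R * H ^+ 2 * c v by rewrite mulr_ge0.
rewrite -/(pinched v) => Q0.
have PE : Int (pinched v) = 0 by apply/eqP; rewrite eq_le P0 andbT; lra.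
have cE : n%:R * H ^+ 2 * c v = 0 by apply/eqP; rewrite eq_le nHc0 andbT; lra.
have [H0|H0] := eqVneq H 0.
  move/eqP: v0; apply; apply: (minimal_height_vanish H0).
  apply: (integral_eq0 (pinchedC v) _ PE) => p.
  by rewrite mulr_ge0// sqr_ge0.
have nz : n%:R != 0 :> R by rewrite pnatr_eq0 -lt0n.
have {}cE : c v = 0.
  by move/eqP: cE; rewrite !mulf_eq0 (negbTE nz) (negbTE H0)/= => /eqP.
have fv p : f v p = 0.
  have := integral_eq0 (f2C v) (fun p => sqr_ge0 _) cE p => /eqP.
  by rewrite expf_eq0/= => /eqP.
have b0 : b v = 0.
  have -> : b v = Int (fun=> 0) by apply: eq_Rintegral => p _; rewrite fv mulr0.
  by rewrite Rintegral_cst// mul0r.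
have d0 : d v = 0.
  have -> : d v = Int (fun=> 0) by apply: eq_Rintegral => p _; rewrite fv mulr0.
  by rewrite Rintegral_cst// mul0r.
have aE : a v = 0.
  have := green_height_normal v; rewrite b0 d0 cE !mulr0 subr0 addr0 => /eqP.
  by rewrite !mulf_eq0 (negbTE nz) (negbTE H0)/= => /eqP.
move/eqP: v0; apply; apply: heights_vanish => // p.
have := integral_eq0 (l2C v) (fun p => sqr_ge0 _) aE p => /eqP.
by rewrite expf_eq0/= => /eqP.
Qed.

Lemma test_sum (s : 'I_n.+2 -> R) p :
  \sum_(i < n.+2) s i * u (delta_mx ord0 i) p = u (\row_i s i) p.
Proof.
rewrite [X in u X p]row_sum_delta /u /height dotv_sumr.
by apply: eq_bigr => i _; rewrite dotvZr mxE.
Qed.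

Lemma jacobi_form0 : jacobi_form S phi N mu (fun=> 0) = 0.
Proof.
rewrite /jacobi_form; under eq_Rintegral do rewrite mul0r.
by rewrite Rintegral_cst// mul0r oppr0.
Qed.

Lemma test_mean_zero v : smooth_mean_zero S mu (u v).
Proof.
split; first exact: smooth_height (smooth_comb phi_imm N_normal 1 (- H)).
have -> : Int (u v) = Int (fun p => 1 * l v p + (- H) * f v p).
  by apply: eq_Rintegral => p _; rewrite /u height_comb.
by rewrite (integral_comb2 _ _ (lC v) (fC v)) integral_height_balance; ring.
Qed.

(** The test functions depend linearly on v, and v <> 0 gives a negative value of
    the form, so in particular a nonzero test function: they form a space of
    dimension n + 2. *)
Lemma weak_index_ge : (forall v, (1 - H ^+ 2) * (n%:R * a v - g v) <= 0) ->
  ((n + 2)%:R%:E <= weak_index S phi N mu)%E.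
Proof.
move=> K0; rewrite addn2; apply: ereal_sup_ubound; exists n.+2 => //=.
exists [set h | exists s : 'I_n.+2 -> R,
  h = fun p => \sum_(i < n.+2) s i * u (delta_mx ord0 i) p]; split.
- exists (fun i => u (delta_mx ord0 i)); split=> // s s0 i.
  have [/rowP/(_ i)|sn0] := eqVneq (\row_i s i) 0; first by rewrite !mxE.
  have := jacobi_form_neg sn0 (K0 _).
  have -> : u (\row_i s i) = fun=> 0 by apply/funext => p; rewrite -test_sum s0.
  by rewrite jacobi_form0 ltxx.
- move=> h [s ->]; have -> : (fun p => \sum_(i < n.+2) s i * u (delta_mx ord0 i) p) =
    u (\row_i s i).
    by apply/funext => p; exact: test_sum.
  exact: test_mean_zero.
- move=> h [s ->]; have -> : (fun p => \sum_(i < n.+2) s i * u (delta_mx ord0 i) p) =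
    u (\row_i s i).
    by apply/funext => p; exact: test_sum.
  move=> u0; apply: jacobi_form_neg => //; apply/eqP => s0; apply: u0.
  by rewrite s0; apply/funext => p; rewrite /u /height /dotv trmx0 mulmx0 mxE.
Qed.

End index.

Theorem theorem1 (R : realType) (n : nat) (M : ptopologicalType)
    (S : smooth_structure R M n) (phi N : M -> 'rV[R]_n.+2)
    (mu : {measure set (borel M) -> \bar R}) (H : R)
    (n_gt0 : (0 < n)%N)
    (M_hausdorff : hausdorff_space M)
    (M_compact : compact [set: M])
    (M_oriented : oriented S)
    (phi_immersion : sphere_immersion S phi)
    (N_normal : unit_normal S phi N)
    (mu_area : area_measure S phi mu)
    (cmc : forall p, mean_curvature S phi N p = H)
    (pinching : forall p, 0 <= shape_norm2 S phi N p - 2 * n%:R * H ^+ 2)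
    (not_umbilical : ~ totally_umbilical S phi N) :
  [/\ (H = 1 \/ H = -1) -> ((n + 2)%:R%:E <= weak_index S phi N mu)%E,
      (forall v : 'rV[R]_n.+2,
         n%:R * \int[mu]_p (height phi v p ^+ 2)
           <= \int[mu]_p grad_norm2 S phi (height phi v) p) ->
      `|H| <= 1 -> ((n + 2)%:R%:E <= weak_index S phi N mu)%E &
      (forall v : 'rV[R]_n.+2,
         \int[mu]_p grad_norm2 S phi (height phi v) p
           <= n%:R * \int[mu]_p (height phi v p ^+ 2)) ->
      1 <= `|H| -> ((n + 2)%:R%:E <= weak_index S phi N mu)%E].
Proof.
have HH : H ^+ 2 = `|H| ^+ 2 by rewrite real_normK ?num_real.
have ge := weak_index_ge n_gt0 M_hausdorff M_compact phi_immersion N_normal mu_area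
  cmc pinching not_umbilical.
(* each hypothesis makes (1 - H^2) (n int l^2 - int |grad l|^2) nonpositive *)
split=> [H1|h H1|h H1]; apply: ge => v.
- by case: H1 => ->; rewrite ?sqrrN expr1n subrr mul0r.
- apply: mulr_ge0_le0; last by rewrite subr_le0.
  by rewrite subr_ge0 HH expr_le1.
- apply: mulr_le0_ge0; last by rewrite subr_ge0.
  by rewrite subr_le0 HH expr_ge1.
Qed.
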